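(* Let $s\in(0,1)$ and $\alpha'\in(-1,1-2s)$. There is $T^*>0$ (depending only on $s$ and $\alpha'$) such that for every modulus of continuity $\rho$ there exist a smooth, divergence-free, time-independent vector field $u$ on $\mathbb{R}^2$ with $\|u\|_{X^{\alpha'}}\le 1$ and a smooth function $\theta_0$ with $\|\theta_0\|_{C^2(\mathbb{R}^2)}\le 1$ such that the smooth solution of $\partial_t\theta+u\cdot\nabla\theta+(-\Delta)^s\theta=0$, $\theta(0,\cdot)=\theta_0$, breaks $\rho$ at some time $t\le T^*$.
   Context: For $\alpha\in(-1,1)$: $X^\alpha=C^\alpha(\mathbb{R}^2)$ if $\alpha\in(0,1)$; $X^0=L^\infty(\mathbb{R}^2)$; $X^\alpha=L^{2/|\alpha|}(\mathbb{R}^2)$ if $\alpha\in(-1,0)$. A modulus of continuity is a continuous non-decreasing $\rho:[0,\infty)\to[0,\infty)$ with $\rho(0)=0$; $\theta$ breaks $\rho$ at time $t$ if $|\theta(t,x)-\theta(t,y)|>\rho(|x-y|)$ for some $x,y\in\mathbb{R}^2$. $(-\Delta)^s$ is the fractional Laplacian. *)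

(* Defs.v *)
From HB Require Import structures.
From mathcomp Require Import all_boot all_order all_algebra.
From mathcomp Require Import all_classical all_reals all_analysis.
Set Implicit Arguments. Unset Strict Implicit. Unset Printing Implicit Defensive.
Import Order.TTheory GRing.Theory Num.Def Num.Theory.
Import numFieldNormedType.Exports.
Local Open Scope classical_set_scope.
Local Open Scope ring_scope.

Section Defs.
Context {R : realType}.

Definition enorm (p : R * R) : R := Num.sqrt (p.1 ^+ 2 + p.2 ^+ 2).
Definition edist (x y : R * R) : R := enorm (x.1 - y.1, x.2 - y.2).

Definition leb2 := (@lebesgue_measure R \x @lebesgue_measure R)%E.

Definition Gamma (z : R) : R :=
  Rintegral (@lebesgue_measure R) `]0, +oo[%classic
    (fun t => t `^ (z - 1) * expR (- t)).

(** Normalising constant of (-Delta)^s in dimension 2: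
    C_{2,s} = 4^s Gamma(1+s) / (pi |Gamma(-s)|), with Gamma(-s) = Gamma(1-s)/(-s). *)
Definition frac_const (s : R) : R :=
  4 `^ s * Gamma (1 + s) / (pi * `| Gamma (1 - s) / (- s) |).

Definition pv_trunc (s : R) (f : R * R -> R) (x : R * R) (eps : R) : R :=
  Rintegral leb2 [set y | eps < edist x y]
    (fun y => (f x - f y) / edist x y `^ (2 + 2 * s)).

Definition fraclap (s : R) (f : R * R -> R) (x : R * R) : R :=
  frac_const s * lim (pv_trunc s f x @ 0^'+).

Definition fraclap_defined (s : R) (f : R * R -> R) (x : R * R) : Prop :=
  (forall eps, 0 < eps -> leb2.-integrable [set y | eps < edist x y]
      (fun y => ((f x - f y) / edist x y `^ (2 + 2 * s))%:E))
  /\ cvg (pv_trunc s f x @ 0^'+).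

Definition pd n (i : 'I_n) (f : 'rV[R]_n -> R) (x : 'rV[R]_n) : R :=
  derive1 (fun a : R => f (x + a *: delta_mx 0 i)) 0.
Definition pdw n (w : seq 'I_n) (f : 'rV[R]_n -> R) : 'rV[R]_n -> R :=
  foldr (fun i g => pd i g) f w.

Definition smooth_on n (U : set 'rV[R]_n) (f : 'rV[R]_n -> R) : Prop :=
  forall (w : seq 'I_n) (x : 'rV[R]_n), U x ->
    {for x, continuous (pdw w f)} /\
    forall i : 'I_n, derivable (fun a : R => pdw w f (x + a *: delta_mx 0 i)) 0 1.

Definition smooth2 (f : R * R -> R) : Prop :=
  smooth_on setT (fun v : 'rV[R]_2 => f (v 0 0, v 0 (inord 1))).
Definition smooth_field (u : R * R -> R * R) : Prop :=
  smooth2 (fun p => (u p).1) /\ smooth2 (fun p => (u p).2).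

Definition d1 (f : R * R -> R) (p : R * R) : R := derive1 (fun a => f (a, p.2)) p.1.
Definition d2 (f : R * R -> R) (p : R * R) : R := derive1 (fun b => f (p.1, b)) p.2.
Definition dt (th : R -> R * R -> R) (t : R) (x : R * R) : R :=
  derive1 (fun tau => th tau x) t.

Definition div_free (u : R * R -> R * R) : Prop :=
  forall p, d1 (fun q => (u q).1) p + d2 (fun q => (u q).2) p = 0.

Definition sup_norm (g : R * R -> R) : \bar R :=
  ereal_sup [set (`| g p |)%:E | p in [set: R * R]].
Definition C2norm (f : R * R -> R) : \bar R :=
  (sup_norm f + sup_norm (d1 f) + sup_norm (d2 f)
   + sup_norm (d1 (d1 f)) + sup_norm (d2 (d1 f)) + sup_norm (d2 (d2 f)))%E.

Definition Xnorm (alpha : R) (u : R * R -> R * R) : \bar R :=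
  if 0 < alpha then
    (ereal_sup [set (enorm (u p))%:E | p in [set: R * R]]
     + ereal_sup [set r | exists x y, x <> y /\
                    r = (edist (u x) (u y) / edist x y `^ alpha)%:E])%E
  else if alpha == 0 then Lnorm leb2 +oo%E (fun p => (enorm (u p))%:E)
  else Lnorm leb2 (2 / `| alpha |)%:E (fun p => (enorm (u p))%:E).

Definition modulus (rho : R -> R) : Prop :=
  {within `[0, +oo[%classic, continuous rho}
  /\ (forall a b, 0 <= a -> a <= b -> rho a <= rho b)
  /\ rho 0 = 0.

Definition breaks (th : R -> R * R -> R) (rho : R -> R) (t : R) : Prop :=
  exists x y, rho (edist x y) < `| th t x - th t y |.

Definition is_solution (s : R) (u : R * R -> R * R) (th0 : R * R -> R)
    (th : R -> R * R -> R) : Prop :=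
  smooth_on [set v : 'rV[R]_3 | 0 < v 0 0]
    (fun v => th (v 0 0) (v 0 (inord 1), v 0 (inord 2)))
  /\ {within [set tx : R * (R * R) | 0 <= tx.1], continuous (fun tx => th tx.1 tx.2)}
  /\ (forall x, th 0 x = th0 x)
  /\ (exists M : R, forall t x, 0 <= t -> `| th t x | <= M)
  /\ (forall t x, 0 < t ->
        fraclap_defined s (th t) x /\
        dt th t x + (u x).1 * d1 (th t) x + (u x).2 * d2 (th t) x
          + fraclap s (th t) x = 0).

End Defs.

(* Main.v *)
Require Import Defs.
From HB Require Import structures.
From mathcomp Require Import all_boot all_order all_algebra.
From mathcomp Require Import all_classical all_reals all_analysis.
From mathcomp Require Import measurable_realfun ess_sup_inf ring lra.
Set Implicit Arguments. Unset Strict Implicit. Unset Printing Implicit Defensive.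
Import Order.TTheory GRing.Theory Num.Def Num.Theory.
Import numFieldNormedType.Exports.
Local Open Scope classical_set_scope.
Local Open Scope ring_scope.

(** The velocity is a hyperbolic flow, [u(x) ~ (- x1, x2) |x|^(- g)] near the axes, with
    [2 s < g < 2], cut off at infinity and regularised at scale [dl]; when [g = 1 - alpha'] (or
    slightly less when [alpha' < 0]) its X^alpha' norm is bounded uniformly in [dl].  The datum is
    an odd ramp of height [a] that does not depend on [dl].  Carry the centre [(X, 0)] of a
    parabolic bump [- a + b (1 - |x - (X, 0)|^2 / r^2 - B)] along the flow from [X0] to [dl], with
    radius [r] proportional to [X].  The bump remains a lower barrier for every solution: in the
    moving frame the flow points outwards relative to the shrinking ball, and the dissipation
    costs only [dB ~ X^(g - 2 s)], whose total is small.  The travel time is of order [X0^g],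
    uniformly in [dl].  Reflecting the solution through the origin gives the opposite bound at
    [(- dl, 0)] at the same time, so the solution oscillates by at least [5 a / 8] over the
    distance [2 dl], and [dl] is chosen last, with [rho (2 dl) < 5 a / 8].

    A smooth solution is the limit of an explicit Euler scheme whose steps do not increase the sup
    norm.  The steps are stable on every C^k, and refining the mesh by a factor two in space and four
    in time changes the approximation by a geometrically small amount in every C^k; hence the
    limit semigroup is smooth in space, commutes with its generator, and is smooth in time. *)

(** * Translations and reflections of the plane *)

(** The exponent [g] is squeezed from two sides. Near the origin the velocity has size
    [|x|^(1 - g)], so the X^alpha' norm caps [g] at [1 - alpha']; for alpha' < 0 the cap itself
    would make the L^p integral diverge logarithmically as [dl] tends to 0, hence the slight
    decrease. Crossing the scale [X] takes a time of order [X^g], while diffusion at that scale acts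
    at the rate [X^(- 2 s)]; the losses [X^(g - 2 s)] are summable over the dyadic scales exactly
    when [2 s < g]. Room for [g] is what alpha' < 1 - 2 s provides, and [g < 2] comes from alpha' >
    -1. The conclusion is about every function satisfying [is_solution], and no uniqueness is
    invoked. The barrier argument therefore uses only boundedness and the pointwise equation, and
    the reflected function is treated as a second solution rather than identified with the first. *)

Section LebesguePlane.
Context {R : realType}.
Implicit Types (a b x y : R) (p q z : R * R) (D : set (R * R)).

Local Notation mu := (@lebesgue_measure R).
Local Notation mu2 := (@leb2 R).

Lemma lebesgue_measure_addr a (A : set R) : measurable A ->
  mu ((fun x : R => x + a) @^-1` A) = mu A.
Proof.
move=> mA.
have mf : measurable_fun [set: R] (fun x : R => x + a).
  by apply: continuous_measurable_fun => x; apply: cvgD; [exact: cvg_id|exact: cvg_cst].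
pose m := pushforward mu (fun x : measurableTypeR R => (x + a : measurableTypeR R)).
rewrite -[LHS]/(m A); apply/esym; move: A mA.
apply: (@lebesgue_measure_unique R m) => _ [[c d] _ /= <-].
rewrite /m /pushforward lebesgue_measure_itv /=.
have -> : (fun x : R => x + a) @^-1` `]c, d] = `]c - a, d - a]%classic.
  by apply/seteqP; split => x /=; rewrite !in_itv /= ltrBlDr lerBrDr.
rewrite lebesgue_measure_itv /= !lte_fin ltrD2r; case: ifP => // _.
by rewrite -!EFinB; congr (_%:E); lra.
Qed.

(** The preimage of []c, d]] is [[- d, - c[]: of the other half-open type but of the same length,
    which is all that the uniqueness theorem compares. *)
Lemma lebesgue_measure_oppr (A : set R) : measurable A ->
  mu ((fun x : R => - x) @^-1` A) = mu A.
Proof.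
move=> mA.
have mf : measurable_fun [set: R] (fun x : R => - x).
  by apply: continuous_measurable_fun => x; apply: cvgN; exact: cvg_id.
pose m := pushforward mu (fun x : measurableTypeR R => (- x : measurableTypeR R)).
rewrite -[LHS]/(m A); apply/esym; move: A mA.
apply: (@lebesgue_measure_unique R m) => _ [[c d] _ /= <-].
rewrite /m /pushforward lebesgue_measure_itv /=.
have -> : (fun x : R => - x) @^-1` `]c, d] = `[- d, - c[%classic.
  by apply/seteqP; split => x /=; rewrite !in_itv /=; lra.
rewrite lebesgue_measure_itv /= !lte_fin ltrN2; case: ifP => // _.
by rewrite -!EFinB; congr (_%:E); lra.
Qed.

Definition shift2 p q : R * R := (q.1 + p.1, q.2 + p.2).
Definition opp2 p : R * R := (- p.1, - p.2).

Lemma measurable_shift2 p : measurable_fun [set: R * R] (shift2 p).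
Proof.
apply: measurable_fun_pair; apply: measurable_funD => //.
Qed.

Lemma measurable_opp2 : measurable_fun [set: R * R] opp2.
Proof.
apply: measurable_fun_pair; apply: measurableT_comp => //.
Qed.

Lemma leb2_shift p D : measurable D -> mu2 (shift2 p @^-1` D) = mu2 D.
Proof.
move=> mD; have mf := measurable_shift2 p.
pose m := pushforward mu2 (shift2 p : measurableTypeR R * measurableTypeR R -> measurableTypeR R * measurableTypeR R).
rewrite -[LHS]/(m D); apply/esym; move: D mD.
apply: (@product_measure_unique _ _ _ _ R mu mu m) => A B mA mB.
rewrite -[LHS]/(mu2 (((fun x : R => x + p.1) @^-1` A) `*` ((fun x : R => x + p.2) @^-1` B))).
rewrite [LHS]product_measure1E.
- by congr (_ * _)%E; exact: lebesgue_measure_addr.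
- by rewrite -[X in measurable X]setTI; exact: measurable_funD.
- by rewrite -[X in measurable X]setTI; exact: measurable_funD.
Qed.

Lemma leb2_opp D : measurable D -> mu2 (opp2 @^-1` D) = mu2 D.
Proof.
move=> mD; have mf := measurable_opp2.
pose m := pushforward mu2 (opp2 : measurableTypeR R * measurableTypeR R -> measurableTypeR R * measurableTypeR R).
rewrite -[LHS]/(m D); apply/esym; move: D mD.
apply: (@product_measure_unique _ _ _ _ R mu mu m) => A B mA mB.
rewrite -[LHS]/(mu2 (((fun x : R => - x) @^-1` A) `*` ((fun x : R => - x) @^-1` B))).
rewrite [LHS]product_measure1E.
- by congr (_ * _)%E; exact: lebesgue_measure_oppr.
- by rewrite -[X in measurable X]setTI; exact: measurableT_comp.
- by rewrite -[X in measurable X]setTI; exact: measurableT_comp.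
Qed.

End LebesguePlane.

(** Positive and negative parts are treated separately, so integrability is not assumed; it can
    itself be transported by applying the identity to the absolute value. *)
Lemma integral_invariant d (T : measurableType d) (R : realType)
    (m : {measure set T -> \bar R}) (phi : T -> T) (D : set T) (f : T -> \bar R) :
  measurable_fun setT phi ->
  (forall A, measurable A -> m (phi @^-1` A) = m A) ->
  measurable D -> measurable_fun D f ->
  (\int[m]_(y in D) f y = \int[m]_(z in phi @^-1` D) f (phi z))%E.
Proof.
move=> mphi inv mD mf.
have key (g : T -> \bar R) : measurable_fun D g -> (forall y, 0 <= g y)%E ->
    (\int[m]_(y in D) g y = \int[m]_(z in phi @^-1` D) g (phi z))%E.
  move=> mg g0.
  transitivity (\int[pushforward m phi]_(y in D) g y)%E; last first.
    by apply: ge0_integral_pushforward => // y _; exact: g0.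
  by apply: eq_measure_integral => A mA _; exact/esym/inv.
rewrite [LHS]integralE [RHS]integralE; congr (_ - _)%E.
  transitivity (\int[m]_(z in phi @^-1` D) (f^\+ (phi z)))%E.
    by rewrite -key//; exact: measurable_funepos.
  by apply: eq_integral => z _; rewrite !funeposE.
transitivity (\int[m]_(z in phi @^-1` D) (f^\- (phi z)))%E.
  by rewrite -key//; exact: measurable_funeneg.
by apply: eq_integral => z _; rewrite !funenegE.
Qed.

Section LebesguePlane2.
Context {R : realType}.
Implicit Types (a b x y : R) (p q z : R * R) (D : set (R * R)).

Local Notation mu := (@lebesgue_measure R).
Local Notation mu2 := (@leb2 R).

Lemma integral_leb2_shift p D (f : R * R -> \bar R) :
  measurable D -> measurable_fun D f ->
  (\int[mu2]_(y in D) f y = \int[mu2]_(z in shift2 p @^-1` D) f (shift2 p z))%E.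
Proof.
by move=> mD mf; apply: integral_invariant => //; [exact: measurable_shift2 | move=> A; exact: leb2_shift].
Qed.

Lemma integral_leb2_opp D (f : R * R -> \bar R) :
  measurable D -> measurable_fun D f ->
  (\int[mu2]_(y in D) f y = \int[mu2]_(z in opp2 @^-1` D) f (opp2 z))%E.
Proof.
by move=> mD mf; apply: integral_invariant => //; [exact: measurable_opp2 | move=> A; exact: leb2_opp].
Qed.

End LebesguePlane2.

(** * Integrals of powers of the norm *)

Section KernelIntegrals.
Context {R : realType}.
Implicit Types (a b x y r : R) (p q z : R * R) (D : set (R * R)).

Local Notation mu := (@lebesgue_measure R).
Local Notation mu2 := (@leb2 R).

Lemma enorm_ge0 z : 0 <= enorm z.
Proof. exact: sqrtr_ge0. Qed.

Lemma enorm_sqr z : enorm z ^+ 2 = z.1 ^+ 2 + z.2 ^+ 2.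
Proof. by rewrite sqr_sqrtr// addr_ge0// sqr_ge0. Qed.

Lemma ler_normfst_enorm z : `|z.1| <= enorm z.
Proof.
by rewrite -(@ler_pXn2r _ 2)// ?nnegrE ?enorm_ge0// enorm_sqr real_normK ?num_real// lerDl sqr_ge0.
Qed.

Lemma ler_normsnd_enorm z : `|z.2| <= enorm z.
Proof.
by rewrite -(@ler_pXn2r _ 2)// ?nnegrE ?enorm_ge0// enorm_sqr real_normK ?num_real// lerDr sqr_ge0.
Qed.

Lemma ler_enorm_sum z : enorm z <= `|z.1| + `|z.2|.
Proof.
rewrite -(@ler_pXn2r _ 2)// ?nnegrE ?enorm_ge0// ?addr_ge0// enorm_sqr sqrrD !real_normK ?num_real//.
by rewrite -addrA lerD2l lerDr mulrn_wge0// mulr_ge0.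
Qed.

Lemma enorm_opp z : enorm (opp2 z) = enorm z.
Proof. by rewrite /enorm /= !sqrrN. Qed.

Lemma measurable_enorm : measurable_fun [set: R * R] (@enorm R).
Proof.
have -> : @enorm R = (fun z => (z.1 ^+ 2 + z.2 ^+ 2) `^ 2^-1).
  by apply/funext => z; rewrite powR12_sqrt// addr_ge0// sqr_ge0.
apply: (measurableT_comp (measurable_powR _)).
by apply: measurable_funD; apply: measurable_funX.
Qed.

Lemma measurable_enorm_gt r : measurable [set z : R * R | r < enorm z].
Proof.
rewrite (_ : [set _ | _] = @enorm R @^-1` `]r, +oo[).
  by rewrite -[X in measurable X]setTI; exact: measurable_enorm.
by apply/seteqP; split => z /=; rewrite in_itv /= andbT.
Qed.

Lemma measurable_enorm_le r : measurable [set z : R * R | enorm z <= r].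
Proof.
rewrite (_ : [set _ | _] = @enorm R @^-1` `]-oo, r]).
  by rewrite -[X in measurable X]setTI; exact: measurable_enorm.
by apply/seteqP; split => z /=; rewrite in_itv /=.
Qed.

(** The ball is enclosed in a square; the constant 4 in place of pi is harmless, since only the
    power of [r] matters later. *)
Lemma leb2_ball_le r : 0 <= r -> (mu2 [set z : R * R | (enorm z <= r)%R] <= (4 * r ^+ 2)%:E)%E.
Proof.
move=> r0.
have mI : measurable (`[- r, r]%classic : set (measurableTypeR R)) by exact: measurable_itv.
apply: (@le_trans _ _ (mu2 (`[- r, r]%classic `*` `[- r, r]%classic))).
  apply: le_measure; rewrite ?inE.
  - exact: measurable_enorm_le.
  - exact: measurableX.
  - move=> z /= zr; split; rewrite /= in_itv /= -ler_norml.
      exact: le_trans (ler_normfst_enorm z) zr.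
    exact: le_trans (ler_normsnd_enorm z) zr.
have muI : mu (`[- r, r]%classic : set R) = (2 * r)%:E.
  rewrite lebesgue_measure_itv /= lte_fin; case: ifP => [_|/negbT rr].
    by rewrite -EFinB; congr (_%:E); lra.
  by congr (_%:E); move: rr; rewrite -leNgt; lra.
apply: (@le_trans _ _ ((2 * r)%:E * (2 * r)%:E)%E).
  by rewrite [X in (X <= _)%E]product_measure1E// -[in leRHS]muI.
by rewrite -EFinM lee_fin; nra.
Qed.

(** Replaces polar coordinates: [f] is dominated by the sum over [k] of [c k] times the indicator of
    the ball of radius [t k], and the integrals of these terms by a geometric series. Each point
    needs only one index at which the bound holds. *)
Lemma ge0_le_integral_balls D (f : R * R -> R) (c t : nat -> R) (A x : R) :
  measurable D -> measurable_fun D f -> (forall z, D z -> 0 <= f z) ->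
  (forall k, 0 <= c k) -> (forall k, 0 <= t k) ->
  (forall z, D z -> exists2 k, enorm z <= t k & f z <= c k) ->
  0 <= A -> 0 < x < 1 -> (forall k, c k * (4 * t k ^+ 2) <= A * x ^+ k) ->
  (\int[mu2]_(z in D) (f z)%:E <= (A / (1 - x))%:E)%E.
Proof.
move=> mD mf f0 c0 t0 ftc A0 /andP[x0 x1] cA.
pose g k z := (c k * \1_[set z : R * R | enorm z <= t k] z)%:E : \bar R.
have g0 k z : (0 <= g k z)%E by rewrite lee_fin mulr_ge0.
have mg k : measurable_fun [set: R * R] (g k).
  apply/measurable_EFinP; apply: measurable_funM => //.
  by apply: measurable_indic; exact: measurable_enorm_le.
apply: (@le_trans _ _ (\int[mu2]_(z in D) \sum_(0 <= k <oo) g k z)%E).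
  apply: ge0_le_integral => //.
  - exact/measurable_EFinP.
  - by apply: (ge0_emeasurable_sum (h := g) (P := predT)) => *; rewrite ?g0//; apply: measurable_funS (mg _).
  - move=> z Dz; have [k zk fk] := ftc z Dz.
    apply: (@le_trans _ _ (\sum_(0 <= i < k.+1) g i z)%E); last exact: nneseries_lim_ge.
    rewrite big_nat_recr //=; apply: (@le_trans _ _ (g k z)).
      by rewrite /g indicE mem_set// mulr1 lee_fin.
    by rewrite leeDr// sume_ge0.
rewrite integral_nneseries//; last by move=> k; apply: measurable_funS (mg k).
apply: (@le_trans _ _ (\sum_(0 <= k <oo) (A * x ^+ k)%:E)%E).
  apply: lee_nneseries => [k _ _|k _]; first exact: integral_ge0.
  apply: (@le_trans _ _ (\int[mu2]_z g k z)%E).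
    by apply: ge0_subset_integral => //; apply: measurable_funS (mg k).
  under eq_integral do rewrite /g EFinM.
  rewrite ge0_integralZl//; last 2 first.
    by apply/measurable_EFinP; apply: measurable_indic; exact: measurable_enorm_le.
    by rewrite lee_fin.
  rewrite integral_indic//; last exact: measurable_enorm_le.
  rewrite setIT; apply: (@le_trans _ _ ((c k)%:E * (4 * t k ^+ 2)%:E)%E).
    by rewrite lee_wpmul2l ?lee_fin// leb2_ball_le.
  by rewrite -EFinM lee_fin.
have nx : `|x| < 1 by rewrite ger0_norm// ltW.
have cv := cvg_geometric_series (a := A) nx.
rewrite (_ : (fun _ => _) = EFin \o series (geometric A x)); last first.
  by apply/funext => n; rewrite /= /series /= -sumEFin.
by rewrite (cvg_lim _ (cvg_EFin _ cv)) //; exact: nearW.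
Qed.

Lemma measurable_enorm_powR D a : measurable_fun D (fun z : R * R => enorm z `^ a).
Proof.
by apply: measurable_funTS; exact: (measurableT_comp (measurable_powR _) measurable_enorm).
Qed.

Lemma powR_exprn x a k : 0 <= x -> (x ^+ k) `^ a = (x `^ a) ^+ k.
Proof. by move=> x0; rewrite -!powR_mulrn ?powR_ge0// -!powRrM mulrC. Qed.

Lemma ler_powRN x y a : 0 < x -> x <= y -> 0 <= a -> y `^ (- a) <= x `^ (- a).
Proof.
move=> x0 xy a0; rewrite !powRN lef_pV2 ?posrE ?powR_gt0 ?(lt_le_trans x0 xy)//.
by apply: ge0_ler_powR => //; rewrite nnegrE ltW// (lt_le_trans x0 xy).
Qed.

Lemma powR2_lt1 a : a < 0 -> 0 < (2 : R) `^ a < 1.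
Proof.
move=> a0; rewrite powR_gt0//= -[a]opprK powRN invf_lt1 ?powR_gt0//.
have : (1 : R) `^ (- a) < 2 `^ (- a).
  by apply: gt0_ltr_powR; rewrite ?nnegrE ?oppr_gt0 ?ler0n ?ler01 ?ltr1n.
by rewrite powR1.
Qed.

(** Sum of the geometric series over dyadic shells, of ratio [2^(a - 2)] towards the origin; the
    ratio is [2^(2 - a)] towards infinity in [outer_const]. *)
Definition inner_const a := 4 * 2 `^ a / (1 - 2 `^ (a - 2)) : R.
Definition outer_const a := 16 / (1 - 2 `^ (2 - a)) : R.

Lemma inner_const_ge0 a : a < 2 -> 0 <= inner_const a.
Proof.
move=> a2; have /andP[_ h] : 0 < (2 : R) `^ (a - 2) < 1 by apply: powR2_lt1; lra.
by rewrite /inner_const divr_ge0 ?mulr_ge0 ?powR_ge0//; lra.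
Qed.

Lemma outer_const_ge0 a : 2 < a -> 0 <= outer_const a.
Proof.
move=> a2; have /andP[_ h] : 0 < (2 : R) `^ (2 - a) < 1 by apply: powR2_lt1; lra.
by rewrite /outer_const divr_ge0//; lra.
Qed.

Lemma powR_exponent_split r a : 0 < r -> r `^ (- a) * r ^+ 2 = r `^ (2 - a).
Proof.
by move=> r0; rewrite -powR_mulrn ?ltW// -powRD ?(gt_eqF r0) ?implybT// addrC.
Qed.

Lemma integral_enorm_powR_inner a r : 0 < a -> a < 2 -> 0 < r ->
  (\int[mu2]_(z in [set z | (enorm z <= r)%R]) (enorm z `^ (- a))%:E
     <= (inner_const a * r `^ (2 - a))%:E)%E.
Proof.
move=> a0 a2 r0.
have i2 : 0 < (2^-1 : R) by rewrite invr_gt0.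
rewrite (_ : inner_const a * _ = 4 * 2 `^ a * r `^ (2 - a) / (1 - 2 `^ (a - 2))); last first.
  by rewrite /inner_const; ring.
apply: (@ge0_le_integral_balls [set z | (enorm z <= r)%R] (fun z => enorm z `^ (- a)) (fun k => (r * 2^-1 ^+ k.+1) `^ (- a)) (fun k => r * 2^-1 ^+ k) _ _).
- exact: measurable_enorm_le.
- exact: measurable_enorm_powR.
- by move=> z _; exact: powR_ge0.
- by move=> k; exact: powR_ge0.
- by move=> k; rewrite mulr_ge0 ?exprn_ge0 ?ltW//.
(* The origin lies in no shell; there the power is 0 by convention, the exponent being nonzero, and
   the index 0 serves. *)
- move=> z /= zr; have [z0|z0] := eqVneq (enorm z) 0.
    exists 0%N; rewrite z0 ?mulr_ge0 ?ltW ?exprn_gt0//.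
    by rewrite powR0 ?powR_gt0 ?mulr_gt0 ?exprn_gt0// oppr_eq0 gt_eqF.
  have {}z0 : 0 < enorm z by rewrite lt_neqAle eq_sym z0 enorm_ge0.
  have ex : exists k, r * 2^-1 ^+ k.+1 < enorm z.
    have /cvgrPdist_lt/(_ (enorm z) z0) [N _ hN] := @cvg_geometric R r 2^-1 ltac:(rewrite ger0_norm; lra).
    exists N; have := hN N.+1 (leqnSn N); rewrite /= sub0r normrN ger0_norm//.
    by rewrite mulr_ge0 ?exprn_ge0 ?ltW//.
  (* The least such index is that of the shell of [z]: its predecessor fails, and this failure is
     the required upper bound on [enorm z]. *)
  exists (ex_minn ex); case: ex_minnP => -[|k] hk hmin.
  + by rewrite expr0 mulr1.
  + by rewrite leNgt; apply/negP => /hmin; rewrite ltnn.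
  + by apply: ler_powRN; [rewrite mulr_gt0 ?exprn_gt0 | exact: ltW | exact: ltW].
  + by apply: ler_powRN; [rewrite mulr_gt0 ?exprn_gt0 | exact: ltW | exact: ltW].
- by rewrite !mulr_ge0 ?powR_ge0.
- by apply: powR2_lt1; lra.
- move=> k; set u := 2^-1 ^+ k.
  have u0 : 0 < u by rewrite exprn_gt0.
  have [u0' r0'] := (ltW u0, ltW r0).
  rewrite exprSr -/u mulrA powRM ?mulr_ge0// powRM//.
  rewrite -powR_inv1 // -powRrM mulN1r opprK.
  rewrite (_ : (2 `^ (a - 2)) ^+ k = u `^ (- a) * u ^+ 2); last first.
    rewrite powR_exponent_split// /u powR_exprn// -powR_inv1// -powRrM.
    by congr ((_ `^ _) ^+ _); ring.
  rewrite -(powR_exponent_split a r0) le_eqVlt; apply/orP; left; apply/eqP; ring.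
Qed.

Lemma integral_enorm_powR_outer a r : 2 < a -> 0 < r ->
  (\int[mu2]_(z in [set z | (r < enorm z)%R]) (enorm z `^ (- a))%:E
     <= (outer_const a * r `^ (2 - a))%:E)%E.
Proof.
move=> a2 r0.
rewrite (_ : outer_const a * _ = 16 * r `^ (2 - a) / (1 - 2 `^ (2 - a))); last first.
  by rewrite /outer_const; ring.
apply: (@ge0_le_integral_balls [set z | (r < enorm z)%R] (fun z => enorm z `^ (- a)) (fun k => (r * 2 ^+ k) `^ (- a)) (fun k => r * 2 ^+ k.+1) _ _).
- exact: measurable_enorm_gt.
- exact: measurable_enorm_powR.
- by move=> z _; exact: powR_ge0.
- by move=> k; exact: powR_ge0.
- by move=> k; rewrite mulr_ge0 ?exprn_ge0 ?ltW//.
- move=> z /= zr.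
  have ex : exists k, enorm z <= r * 2 ^+ k.+1.
    have /cvgrPdist_lt/(_ (r / enorm z)) := @cvg_geometric R 1 2^-1 ltac:(rewrite ger0_norm; lra).
    have z0 : 0 < enorm z by lra.
    move=> /(_ (divr_gt0 r0 z0)) [N _ hN].
    exists N; have := hN N.+1 (leqnSn N).
    rewrite /= mul1r sub0r normrN ger0_norm ?exprn_ge0// exprVn.
    rewrite ltr_pdivlMr// mulrC ltr_pdivrMr ?exprn_gt0//; exact: ltW.
  exists (ex_minn ex); case: ex_minnP => // -[|k] hk hmin.
  + by apply: ler_powRN; rewrite ?mulr_gt0 ?exprn_gt0 ?expr0 ?mulr1; lra.
  + apply: ler_powRN; rewrite ?mulr_gt0 ?exprn_gt0//; last by lra.
    by apply/ltW; rewrite ltNge; apply/negP => /hmin; rewrite ltnn.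
- by rewrite !mulr_ge0 ?powR_ge0.
- by apply: powR2_lt1; lra.
- move=> k; set u := 2 ^+ k.
  have u0 : 0 < u by rewrite exprn_gt0.
  have [u0' r0'] := (ltW u0, ltW r0).
  rewrite (exprSr 2 k) -/u mulrA powRM//.
  rewrite (_ : (2 `^ (2 - a)) ^+ k = u `^ (- a) * u ^+ 2); last first.
    by rewrite powR_exponent_split// /u powR_exprn//.
  rewrite -(powR_exponent_split a r0) le_eqVlt; apply/orP; left; apply/eqP; ring.
Qed.

End KernelIntegrals.

(** * Upper bounds for the fractional Laplacian *)

Section PrincipalValue.
Context {R : realType}.
Implicit Types (s a r eps : R) (p q x y z : R * R) (D : set (R * R)) (f g : R * R -> R).

Local Notation mu2 := (@leb2 R).
Local Notation plane := (measurableTypeR R * measurableTypeR R)%type.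

Lemma opp2K : involutive (@opp2 R).
Proof. by move=> [z1 z2]; rewrite /opp2 /= !opprK. Qed.

Lemma integrable_preimage_opp D g : measurable D ->
  mu2.-integrable D (EFin \o g) -> mu2.-integrable (@opp2 R @^-1` D) (EFin \o (g \o @opp2 R)).
Proof.
move=> mD /integrableP[mg ig].
have mgo : measurable_fun (@opp2 R @^-1` D) (EFin \o (g \o @opp2 R)).
  move=> _ A mA.
  have -> : @opp2 R @^-1` D `&` (EFin \o (g \o @opp2 R)) @^-1` A = @opp2 R @^-1` (D `&` (EFin \o g) @^-1` A).
    by rewrite preimage_setI.
  by rewrite -[X in measurable X]setTI; apply: (@measurable_opp2 R) => //; exact: mg.
apply/integrableP; split => //.
rewrite (@integral_leb2_opp R D (abse \o (EFin \o g))) // in ig.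
exact: (measurableT_comp _ mg).
Qed.

Lemma Rintegral_preimage_opp D g : measurable D -> mu2.-integrable D (EFin \o g) ->
  Rintegral mu2 (@opp2 R @^-1` D) (g \o @opp2 R) = Rintegral mu2 D g.
Proof. by move=> mD /integrableP[mg ig]; rewrite /Rintegral (@integral_leb2_opp R D (EFin \o g)). Qed.

Lemma preimage_opp_id D : (forall z, D (opp2 z) <-> D z) -> @opp2 R @^-1` D = D.
Proof. by move=> symD; apply/seteqP; split => z /= /symD. Qed.

Lemma integrable_leb2_opp D g : measurable D -> (forall z, D (opp2 z) <-> D z) ->
  mu2.-integrable D (EFin \o g) -> mu2.-integrable D (EFin \o (g \o @opp2 R)).
Proof. by move=> mD /preimage_opp_id oD ig; have := integrable_preimage_opp mD ig; rewrite oD. Qed.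

Lemma Rintegral_leb2_opp D g : measurable D -> (forall z, D (opp2 z) <-> D z) ->
  mu2.-integrable D (EFin \o g) ->
  Rintegral mu2 D (g \o @opp2 R) = Rintegral mu2 D g.
Proof. by move=> mD /preimage_opp_id oD ig; rewrite -{1}oD; exact: Rintegral_preimage_opp. Qed.

Lemma ge0_integrable_le D (b : R * R -> R) (B : R) : measurable_fun D b ->
  (forall z, D z -> 0 <= b z) -> (\int[mu2]_(z in D) (b z)%:E <= B%:E)%E ->
  mu2.-integrable D (EFin \o b).
Proof.
move=> mb b0 bB; apply/integrableP; split; first exact/measurable_EFinP.
apply: (@le_lt_trans _ _ B%:E); last exact: ltry.
apply: le_trans bB; rewrite le_eqVlt; apply/orP; left; apply/eqP.
by apply: eq_integral => z /set_mem Dz; rewrite /= ger0_norm// b0.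
Qed.

Lemma Rintegral_le_of_integral D (b : R * R -> R) (B : R) :
  (forall z, D z -> 0 <= b z) -> (\int[mu2]_(z in D) (b z)%:E <= B%:E)%E ->
  Rintegral mu2 D b <= B.
Proof.
move=> b0 bB; rewrite -lee_fin /Rintegral fineK//.
rewrite ge0_fin_numE ?(le_lt_trans bB) ?ltry//.
by apply: integral_ge0 => z Dz; rewrite lee_fin b0.
Qed.

Lemma integrable_leb2D D f g : measurable D ->
  mu2.-integrable D (EFin \o f) -> mu2.-integrable D (EFin \o g) ->
  mu2.-integrable D (EFin \o (fun z => f z + g z)).
Proof.
move=> mD mf mg.
exact: (integrableD (mD : measurable (D : set plane)) mf mg).
Qed.

Lemma integrable_leb2Z D f (k : R) : measurable D ->
  mu2.-integrable D (EFin \o f) -> mu2.-integrable D (EFin \o (fun z => k * f z)).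
Proof.
move=> mD mf.
exact: (integrableZl (mD : measurable (D : set plane)) k mf).
Qed.

(* Averaging g over z and -z removes the odd part, hence any linear term. *)
Lemma Rintegral_symmetric_le D g (b : R * R -> R) (B : R) : measurable D ->
  (forall z, D (opp2 z) <-> D z) ->
  mu2.-integrable D (EFin \o g) -> measurable_fun D b ->
  (forall z, D z -> 0 <= b z) ->
  (forall z, D z -> g z + g (opp2 z) <= 2 * b z) ->
  (\int[mu2]_(z in D) (b z)%:E <= B%:E)%E ->
  Rintegral mu2 D g <= B.
Proof.
move=> mD symD ig mb b0 gb bB.
have igo := integrable_leb2_opp mD symD ig.
have ib := ge0_integrable_le mb b0 bB.
have h : Rintegral mu2 D (fun z => g z + (g \o @opp2 R) z) <= Rintegral mu2 D (fun z => 2 * b z).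
  apply: le_Rintegral => //.
  - exact: integrable_leb2D.
  - exact: integrable_leb2Z.
rewrite RintegralD// RintegralZl// Rintegral_leb2_opp// in h.
have := Rintegral_le_of_integral b0 bB; lra.
Qed.

Definition kern s z : R := enorm z `^ (- (2 + 2 * s)).

Lemma kern_ge0 s z : 0 <= kern s z. Proof. exact: powR_ge0. Qed.

Lemma kern_opp s z : kern s (opp2 z) = kern s z.
Proof. by rewrite /kern enorm_opp. Qed.

Lemma measurable_kern s D : measurable_fun D (kern s).
Proof. exact: measurable_enorm_powR. Qed.

Lemma kern_sqr s z : 0 < enorm z -> enorm z ^+ 2 * kern s z = enorm z `^ (- (2 * s)).
Proof.
move=> z0; rewrite /kern -(powR_mulrn 2 (ltW z0)) -powRD ?(gt_eqF z0) ?implybT//.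
by congr (_ `^ _); ring.
Qed.

Lemma symmetric_enorm_gt r z : [set z | r < enorm z] (opp2 z) <-> [set z | r < enorm z] z.
Proof. by rewrite /= enorm_opp. Qed.

Lemma edist_shift x z : Defs.edist x (shift2 x z) = enorm z.
Proof. by rewrite /Defs.edist /shift2 /enorm /=; congr Num.sqrt; ring. Qed.

Lemma shift2_preimage_edist x r :
  shift2 x @^-1` [set y | r < Defs.edist x y] = [set z | r < enorm z].
Proof.
by apply/seteqP; split => z /=; rewrite edist_shift.
Qed.

Lemma measurable_edist_gt x r : measurable [set y | r < Defs.edist x y].
Proof.
rewrite (_ : [set y | _] = shift2 (opp2 x) @^-1` [set z | r < enorm z]); last first.
  apply/seteqP; split => y /=;
  by rewrite -[X in _ < enorm X]opp2K enorm_opp /opp2 /Defs.edist /shift2 /= !opprD !opprK [- y.1 + _]addrC [- y.2 + _]addrC.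
by rewrite -[X in measurable X]setTI; apply: (@measurable_shift2 R _) => //; exact: measurable_enorm_gt.
Qed.

(** The integrand recentred at the origin, where both the kernel and the domain are invariant under
    [opp2]. *)
Definition pv_fun s f x z : R := (f x - f (shift2 x z)) * kern s z.

Lemma pv_fun_shift s f x z :
  (f x - f (shift2 x z)) / Defs.edist x (shift2 x z) `^ (2 + 2 * s) = pv_fun s f x z.
Proof. by rewrite edist_shift /pv_fun /kern powRN. Qed.

Lemma pv_trunc_shift s f x eps :
  measurable_fun [set y | eps < Defs.edist x y] (fun y => (f x - f y) / Defs.edist x y `^ (2 + 2 * s)) ->
  pv_trunc s f x eps = Rintegral mu2 [set z | eps < enorm z] (pv_fun s f x).
Proof.
move=> mf; rewrite /pv_trunc /Rintegral (@integral_leb2_shift R x) //.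
- rewrite shift2_preimage_edist; congr fine; apply: eq_integral => z _.
  by rewrite pv_fun_shift.
- exact: measurable_edist_gt.
- exact/measurable_EFinP.
Qed.

Lemma measurable_pv_shift s f x eps :
  measurable_fun [set y | eps < Defs.edist x y] (fun y => (f x - f y) / Defs.edist x y `^ (2 + 2 * s)) ->
  measurable_fun [set z | eps < enorm z] (pv_fun s f x).
Proof.
move=> mf _ A mA.
rewrite (_ : _ `&` _ = shift2 x @^-1` ([set y | eps < Defs.edist x y] `&`
    (fun y => (f x - f y) / Defs.edist x y `^ (2 + 2 * s)) @^-1` A)).
  rewrite -[X in measurable X]setTI; apply: (@measurable_shift2 R _) => //.
  by apply: mf => //; exact: measurable_edist_gt.
by apply/seteqP; split => z /=; rewrite pv_fun_shift edist_shift.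
Qed.

Lemma integrable_pv_shift s f x eps :
  mu2.-integrable [set y | eps < Defs.edist x y]
    (fun y => ((f x - f y) / Defs.edist x y `^ (2 + 2 * s))%:E) ->
  mu2.-integrable [set z | eps < enorm z] (EFin \o pv_fun s f x).
Proof.
move=> /integrableP[/measurable_EFinP mf ig]; apply/integrableP; split.
  by apply/measurable_EFinP; exact: measurable_pv_shift.
rewrite (@integral_leb2_shift R x) // in ig.
- rewrite shift2_preimage_edist in ig; apply: le_lt_trans ig.
  rewrite le_eqVlt; apply/orP; left; apply/eqP; apply: eq_integral => z _.
  by rewrite /= pv_fun_shift.
- exact: measurable_edist_gt.
- by do 2 apply: measurableT_comp => //.
Qed.

Lemma integrable_pv_unshift s f x eps :
  measurable_fun [set y | eps < Defs.edist x y] (fun y => (f x - f y) / Defs.edist x y `^ (2 + 2 * s)) ->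
  mu2.-integrable [set z | eps < enorm z] (EFin \o pv_fun s f x) ->
  mu2.-integrable [set y | eps < Defs.edist x y]
    (fun y => ((f x - f y) / Defs.edist x y `^ (2 + 2 * s))%:E).
Proof.
move=> mf /integrableP[mg ig]; apply/integrableP; split; first exact/measurable_EFinP.
rewrite (@integral_leb2_shift R x) //.
- rewrite shift2_preimage_edist; apply: le_lt_trans ig.
  rewrite le_eqVlt; apply/orP; left; apply/eqP; apply: eq_integral => z _.
  by rewrite /= pv_fun_shift.
- exact: measurable_edist_gt.
- by do 2 apply: measurableT_comp => //.
Qed.

(** The exponent is [2 * s] and not [2 + 2 * s]: near the origin a second-order increment supplies
    the factor [enorm z ^+ 2]. *)
Definition near_const s : R := inner_const (2 * s).
Definition far_const s : R := outer_const (2 + 2 * s).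

(** * Dissipation at a point of contact with a paraboloid *)

Section Bounds.
Variable s : R.
Hypotheses (s0 : 0 < s) (s1 : s < 1).

Lemma near_const_ge0 : 0 <= near_const s.
Proof. by apply: inner_const_ge0; move: (s1); lra. Qed.

Lemma far_const_ge0 : 0 <= far_const s.
Proof. by apply: outer_const_ge0; move: (s0); lra. Qed.

Lemma integral_kern_far r : 0 < r ->
  (\int[mu2]_(z in [set z | (r < enorm z)%R]) (kern s z)%:E
    <= (far_const s * r `^ (- (2 * s)))%:E)%E.
Proof.
have s2 : 2 < 2 + 2 * s by move: (s0); lra.
move=> r0; have := integral_enorm_powR_outer s2 r0.
by rewrite (_ : 2 - (2 + 2 * s) = - (2 * s)); last by ring.
Qed.

Lemma integral_kern_near r : 0 < r ->
  (\int[mu2]_(z in [set z | (enorm z <= r)%R]) (enorm z `^ (- (2 * s)))%:E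
    <= (near_const s * r `^ (2 - 2 * s))%:E)%E.
Proof. by move=> r0; apply: integral_enorm_powR_inner => //; move: (s0) (s1); lra. Qed.

Lemma integrable_kern r : 0 < r ->
  mu2.-integrable [set z | r < enorm z] (EFin \o kern s).
Proof.
move=> r0; apply: ge0_integrable_le (integral_kern_far r0); first exact: measurable_kern.
by move=> z _; exact: kern_ge0.
Qed.

(** Majorant of the kernel times the symmetrised increment, for a function touched from below by a
    paraboloid of opening [H] and dropping by at most [O] beyond radius [r]. *)
Definition touch_fun (H O : R) r z : R :=
  if enorm z <= r then H * enorm z `^ (- (2 * s)) else O * kern s z.

Lemma integral_touch_fun (H O : R) r eps : 0 <= H -> 0 <= O -> 0 < r ->
  measurable_fun [set z | eps < enorm z] (touch_fun H O r) /\
  (\int[mu2]_(z in [set z | (eps < enorm z)%R]) (touch_fun H O r z)%:E <=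
    (H * (near_const s * r `^ (2 - 2 * s)) + O * (far_const s * r `^ (- (2 * s))))%:E)%E.
Proof.
move=> H0 O0 r0.
pose f1 z := (H * (enorm z `^ (- (2 * s)) * \1_[set z | enorm z <= r] z)).
pose f2 z := (O * (kern s z * \1_[set z | r < enorm z] z)).
have mf1 : measurable_fun [set: R * R] f1.
  apply: measurable_funM => //; apply: measurable_funM; first exact: measurable_enorm_powR.
  by apply: measurable_indic; exact: measurable_enorm_le.
have mf2 : measurable_fun [set: R * R] f2.
  apply: measurable_funM => //; apply: measurable_funM; first exact: measurable_kern.
  by apply: measurable_indic; exact: measurable_enorm_gt.
have f10 z : 0 <= f1 z by rewrite !mulr_ge0 ?powR_ge0.
have f20 z : 0 <= f2 z by rewrite !mulr_ge0 ?kern_ge0.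
have E : touch_fun H O r = (fun z => f1 z + f2 z).
  apply/funext => z; rewrite /touch_fun /f1 /f2 !indicE.
  have [zr|zr] := leP (enorm z) r.
    by rewrite mem_set// memNset /= ?mulr0 ?addr0 ?mulr1// ltNge zr.
  by rewrite memNset/= ?mem_set// ?mulr1 ?mulr0 ?add0r// leNgt zr.
rewrite E; split.
  by apply: measurable_funS (measurable_funD mf1 mf2).
apply: (@le_trans _ _ (\int[mu2]_z (f1 z + f2 z)%:E)%E).
  apply: ge0_subset_integral => //.
  - exact: measurable_enorm_gt.
  - by apply/measurable_EFinP; exact: measurable_funD.
  - by move=> z _; rewrite lee_fin addr_ge0.
under eq_integral do rewrite EFinD.
rewrite ge0_integralD //; last first.
- exact/measurable_EFinP.
- by move=> z _; rewrite lee_fin.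
- exact/measurable_EFinP.
- by move=> z _; rewrite lee_fin.
rewrite EFinD; apply: leeD.
  rewrite /f1; under eq_integral do rewrite EFinM.
  rewrite ge0_integralZl ?lee_fin//; last 2 first.
  - apply/measurable_EFinP; apply: measurable_funM; first exact: measurable_enorm_powR.
    by apply: measurable_indic; exact: measurable_enorm_le.
  - by move=> z _; rewrite lee_fin mulr_ge0 ?powR_ge0.
  rewrite EFinM lee_wpmul2l ?lee_fin//; apply: le_trans (integral_kern_near r0).
  rewrite [leRHS]integral_mkcond le_eqVlt; apply/orP; left; apply/eqP/eq_integral => z _.
  by rewrite patchE indicE; case: ifP => _; rewrite ?mulr1 ?mulr0.
rewrite /f2; under eq_integral do rewrite EFinM.
rewrite ge0_integralZl ?lee_fin//; last 2 first.
- apply/measurable_EFinP; apply: measurable_funM; first exact: measurable_kern.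
  by apply: measurable_indic; exact: measurable_enorm_gt.
- by move=> z _; rewrite lee_fin mulr_ge0 ?kern_ge0.
rewrite EFinM lee_wpmul2l ?lee_fin//; apply: le_trans (integral_kern_far r0).
rewrite [leRHS]integral_mkcond le_eqVlt; apply/orP; left; apply/eqP/eq_integral => z _.
by rewrite patchE indicE; case: ifP => _; rewrite ?mulr1 ?mulr0.
Qed.

Lemma touch_fun_ge0 (H O : R) r z : 0 <= H -> 0 <= O -> 0 <= touch_fun H O r z.
Proof. by move=> H0 O0; rewrite /touch_fun; case: ifP => _; rewrite mulr_ge0 ?powR_ge0 ?kern_ge0. Qed.

(** The linear part [l] is odd and cancels in the symmetric integral; what remains is integrable at
    the origin, so the bound is uniform in [eps]. *)
Lemma pv_trunc_le f x (l : R * R) (H O : R) r eps :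
  0 <= H -> 0 <= O -> 0 < eps -> 0 < r ->
  mu2.-integrable [set y | eps < Defs.edist x y]
    (fun y => ((f x - f y) / Defs.edist x y `^ (2 + 2 * s))%:E) ->
  (forall z, enorm z <= r -> f x - f (shift2 x z) <= l.1 * z.1 + l.2 * z.2 + H * enorm z ^+ 2) ->
  (forall z, r < enorm z -> f x - f (shift2 x z) <= O) ->
  pv_trunc s f x eps <=
    H * (near_const s * r `^ (2 - 2 * s)) + O * (far_const s * r `^ (- (2 * s))).
Proof.
move=> H0 O0 e0 r0 ig fin fout.
have [mt it] := integral_touch_fun eps H0 O0 r0.
rewrite pv_trunc_shift; last by case/integrableP : ig => /measurable_EFinP.
apply: (Rintegral_symmetric_le (b := touch_fun H O r)) => //.
- exact: measurable_enorm_gt.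
- by move=> z; exact: symmetric_enorm_gt.
- exact: integrable_pv_shift.
- by move=> z _; exact: touch_fun_ge0.
move=> z /= ez; rewrite /pv_fun kern_opp -mulrDl /touch_fun.
have z0 : 0 < enorm z by lra.
have [zr|zr] := leP (enorm z) r.
  rewrite -(kern_sqr s z0) mulrA mulrA; apply: ler_wpM2r; first exact: kern_ge0.
  have := fin _ zr; have := fin (opp2 z); rewrite enorm_opp => /(_ zr) /=; lra.
rewrite mulrA; apply: ler_wpM2r; first exact: kern_ge0.
have := fout _ zr; have := fout (opp2 z); rewrite enorm_opp => /(_ zr) /=; lra.
Qed.

(** Where a paraboloid touches the solution from below, this bounds the dissipation from above
    without any control of the second derivatives of the solution. *)
Lemma fraclap_le f x (l : R * R) (H O : R) r :
  0 <= H -> 0 <= O -> 0 < r -> fraclap_defined s f x -> 0 <= frac_const s ->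
  (forall z, enorm z <= r -> f x - f (shift2 x z) <= l.1 * z.1 + l.2 * z.2 + H * enorm z ^+ 2) ->
  (forall z, r < enorm z -> f x - f (shift2 x z) <= O) ->
  fraclap s f x <= frac_const s *
    (H * (near_const s * r `^ (2 - 2 * s)) + O * (far_const s * r `^ (- (2 * s)))).
Proof.
move=> H0 O0 r0 [ig cv] c0 fin fout; rewrite /fraclap ler_wpM2l//.
apply: limr_le => //; near=> eps.
by apply: (pv_trunc_le (l := l)) => //; apply: ig.
Unshelve. all: by end_near. Qed.

End Bounds.

Lemma frac_const_ge0 s : 0 <= frac_const s.
Proof.
have G0 (z : R) : 0 <= Gamma z by apply: Rintegral_ge0 => t _; rewrite mulr_ge0 ?powR_ge0 ?expR_ge0.
by rewrite /frac_const divr_ge0 ?mulr_ge0 ?powR_ge0 ?pi_ge0.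
Qed.

End PrincipalValue.

(** * Derivatives on the line *)

Section Derivatives.
Context {R : realType}.
Implicit Types (f g : R -> R) (c l : R).

(** The division-free form includes [h = 0] and accepts a remainder estimate directly. *)
Lemma is_deriveP f c l : is_derive c (1 : R) f l <->
  (forall e, 0 < e -> exists2 d, 0 < d &
     forall h, `|h| < d -> `|f (c + h) - f c - l * h| <= e * `|h|).
Proof.
have key (h e : R) : h != 0 ->
    (`|l - h^-1 *: ((f \o shift c) (h *: 1) - f c)| <= e) =
    (`|f (c + h) - f c - l * h| <= e * `|h|).
  move=> h0; rewrite -[h%:A]/(h * 1) mulr1 /= -[_ *: _]/(_ * _) (addrC h).
  rewrite -[in RHS](mulrK (x := h) _ (l)) ?unitfE//.
  have -> : f (c + h) - f c - l * h / h * h = - (l - h^-1 * (f (c + h) - f c)) * h by field.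
  by rewrite normrM normrN ler_pM2r// normr_gt0.
split=> [[df dl] e e0|H].
  have /cvgrPdist_le/(_ e e0) : (fun h => h^-1 *: ((f \o shift c) (h *: 1) - f c)) @ 0^' --> l by rewrite -dl; exact: df.
  move=> [d /= d0 hd]; exists d => // h hlt.
  have [->|h0] := eqVneq h 0; first by rewrite addr0 subrr mulr0 subrr normr0 mulr0.
  by rewrite -key//; apply: hd => //=; rewrite sub0r normrN.

have cv : (fun h => h^-1 *: ((f \o shift c) (h *: 1) - f c)) @ 0^' --> l.
  apply/cvgrPdist_le => e e0; have [d d0 hd] := H e e0.
  by exists d => //= h /=; rewrite sub0r normrN => hlt h0; rewrite key// hd.
by split; [apply/cvg_ex; exists l | exact: cvg_lim cv].
Qed.

Lemma derivable_derive1P f c : derivable f c 1 -> is_derive c (1 : R) f (derive1 f c).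
Proof. by move=> df; split => //; rewrite derive1E. Qed.

Lemma is_derive_derive1 f c l : is_derive c (1 : R) f l -> derive1 f c = l.
Proof. by move=> df; rewrite derive1E derive_val. Qed.

Lemma is_derive_unique f c l l' : is_derive c (1 : R) f l -> is_derive c (1 : R) f l' -> l = l'.
Proof. by move=> /is_derive_derive1 <- /is_derive_derive1. Qed.

Lemma is_derive_shift f c a l :
  is_derive a (1 : R) (fun x => f (c + x)) l <-> is_derive (c + a) (1 : R) f l.
Proof.
by split=> /is_deriveP H; apply/is_deriveP => e /H[d d0 hd]; exists d => // h /hd; rewrite addrA.
Qed.

(** Only the past of [c] is compared. In the time variable nothing more is available, since a
    minimum may be attained at the end of the interval. *)
Lemma is_derive_le0_left f c l (a : R) : a < c -> is_derive c (1 : R) f l ->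
  (forall t, a <= t -> t <= c -> f c <= f t) -> l <= 0.
Proof.
move=> ac /is_deriveP df fmin; rewrite leNgt; apply/negP => l0.
have [d d0 hd] := df (l / 2) ltac:(lra).
pose h := Num.min (d / 2) (c - a).
have h0 : 0 < h by rewrite lt_min; lra.
have hdd : h <= d / 2 by rewrite ge_min lexx.
have hca : h <= c - a by rewrite ge_min lexx orbT.
have := hd (- h); rewrite normrN gtr0_norm// => /(_ ltac:(lra)).
have := fmin (c - h) ltac:(lra) ltac:(lra).
rewrite ler_norml => H1 /andP[_]; nra.
Qed.

Lemma is_derive_reflect f c l : is_derive c (1 : R) f l ->
  is_derive (- c) (1 : R) (fun x => f (- x)) (- l).
Proof.
move=> /is_deriveP df; apply/is_deriveP => e /df[d d0 hd]; exists d => // h hlt.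
have := hd (- h); rewrite normrN => /(_ hlt).
by rewrite opprD !opprK mulrN mulNr.
Qed.

Lemma is_derive_min f c l : is_derive c (1 : R) f l -> (forall t, f c <= f t) -> l = 0.
Proof.
move=> df fmin; apply/eqP; rewrite eq_le; apply/andP; split.
  by apply: (is_derive_le0_left (a := c - 1)) df _ => //; lra.
rewrite -oppr_le0; apply: (is_derive_le0_left (a := - c - 1)) (is_derive_reflect df) _; first lra.
by move=> t _ _; rewrite opprK.
Qed.

Lemma derC c (a : R) : is_derive c (1 : R) (fun=> a) 0.
Proof. exact: is_derive_cst. Qed.

Lemma derI c : is_derive c (1 : R) (fun x => x) 1.
Proof. exact: is_derive_id. Qed.

Lemma derD f g c a b : is_derive c (1 : R) f a -> is_derive c (1 : R) g b ->
  is_derive c (1 : R) (fun x => f x + g x) (a + b).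
Proof. by move=> df dg; exact: is_deriveD. Qed.

Lemma derN f c a : is_derive c (1 : R) f a -> is_derive c (1 : R) (fun x => - f x) (- a).
Proof. by move=> df; exact: is_deriveN. Qed.

Lemma derB f g c a b : is_derive c (1 : R) f a -> is_derive c (1 : R) g b ->
  is_derive c (1 : R) (fun x => f x - g x) (a - b).
Proof. by move=> df dg; exact: is_deriveB. Qed.

Lemma derM f g c a b : is_derive c (1 : R) f a -> is_derive c (1 : R) g b ->
  is_derive c (1 : R) (fun x => f x * g x) (f c * b + g c * a).
Proof. by move=> df dg; exact: is_deriveM. Qed.

Lemma derX2 f c a : is_derive c (1 : R) f a ->
  is_derive c (1 : R) (fun x => f x ^+ 2) (2 * f c * a).
Proof. by move=> df; have := derM df df; rewrite (_ : 2 * _ * _ = f c * a + f c * a)//; ring. Qed.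

Lemma der_comp f g c a b : is_derive c (1 : R) g b -> is_derive (g c) (1 : R) f a ->
  is_derive c (1 : R) (fun x => f (g x)) (a * b).
Proof. by move=> dg df; exact: is_derive1_comp. Qed.

Lemma der_eq f c a b : is_derive c (1 : R) f a -> a = b -> is_derive c (1 : R) f b.
Proof. by move=> ? <-. Qed.

Lemma is_derive_continuous f c l : is_derive c (1 : R) f l -> {for c, continuous f}.
Proof. by move=> [df _]; exact/differentiable_continuous/derivable1_diffP. Qed.

Lemma MVT_der f (df : R -> R) (a b : R) : a < b ->
  (forall x, a <= x <= b -> is_derive x (1 : R) f (df x)) ->
  exists c, [/\ a < c, c < b & f b - f a = df c * (b - a)].
Proof.
move=> ab dfx.
have [||c] := @MVT R f df a b ab.
- by move=> x; rewrite in_itv /= => /andP[/ltW ax /ltW xb]; apply: dfx; rewrite ax.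
- by apply: derivable_within_continuous => x; rewrite in_itv /= => /dfx [].
- by rewrite in_itv /= => /andP[ac cb] E; exists c.
Qed.

Lemma der_ge0_le f (df : R -> R) (a b : R) : a <= b ->
  (forall x, a <= x <= b -> is_derive x (1 : R) f (df x)) ->
  (forall x, a <= x <= b -> 0 <= df x) -> f a <= f b.
Proof.
rewrite le_eqVlt => /predU1P[-> //|ab] dfx df0.
have [c [ac cb E]] := MVT_der ab dfx.
have : 0 <= df c by apply: df0; lra.
by move=> h; rewrite -subr_ge0 E mulr_ge0// subr_ge0 ltW.
Qed.

Lemma antiderivative f (S : R) : continuous f -> exists F : R -> R,
  F 0 = 0 /\ forall x, 0 <= x <= S -> is_derive x (1 : R) F (f x).
Proof.
move=> cf; have [S0|S0] := ltP S 0.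
  by exists (fun=> 0); split=> // x; lra.
(* The base point [- 1] and the upper limit [S + 1] make 0 and [S] interior points, where the
   derivative is two-sided. *)
pose F0 x := Rintegral (@lebesgue_measure R) [set` Interval (BLeft (- 1 : R)) (BRight x)] f.
have dF0 x : 0 <= x <= S -> is_derive x (1 : R) F0 (f x).
  move=> xS; have xS1 : x < S + 1 by lra.
  have ig : (@lebesgue_measure R).-integrable [set` Interval (BLeft (- 1 : R)) (BRight (S + 1))] (EFin \o f).
    apply: continuous_compact_integrable; first exact: segment_compact.
    by apply: continuous_subspaceT => y; exact: cf.
  have [|d e] := continuous_FTC1 xS1 ig _ (cf x); first by rewrite lte_fin; lra.
  exact: der_eq (derivable_derive1P d) e.
exists (fun x => F0 x - F0 0); split; first by rewrite subrr.
by move=> x /dF0 d; apply: der_eq (derB d (derC x (F0 0))) _; rewrite subr0.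
Qed.

Lemma der_powR (a c : R) : 0 < c -> is_derive c (1 : R) (fun x => x `^ a) (a * c `^ (a - 1)).
Proof. by move=> c0; exact: is_derive1_powR. Qed.

Lemma der_expRN (a c : R) : is_derive c (1 : R) (fun x => expR (- (a * x))) (- a * expR (- (a * c))).
Proof.
have h : is_derive c (1 : R) (fun x => - (a * x)) (- a).
  by apply: der_eq (derN (derM (derC c a) (derI c))) _; ring.
by apply: der_eq (der_comp h (is_derive_expR _)) _; rewrite mulrC.
Qed.

End Derivatives.

(** * Comparison with quadratic barriers *)

Lemma within_cvg_comp (T U V : topologicalType) (A : set T) (B : set U)
    (ph : T -> U) (g : U -> V) (x : T) (l : V) :
  ph @ nbhs x --> ph x -> (forall p, A p -> B (ph p)) ->
  g @ within B (nbhs (ph x)) --> l -> (fun p => g (ph p)) @ within A (nbhs x) --> l.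
Proof.
move=> cph AB cg N /cg hN; have := cph _ hN.
by rewrite !nbhs_simpl /= /within /=; apply: filterS => p hp /AB; exact: hp.
Qed.

Section Solutions.
Context {R : realType}.
Implicit Types (s t : R) (u : R * R -> R * R) (x : R * R).

Definition row3 (t : R) (x : R * R) : 'rV[R]_3 := \row_j nth 0 [:: t; x.1; x.2] j.

Lemma row3_0 t x : row3 t x 0 0 = t. Proof. by rewrite mxE. Qed.
Lemma row3_1 t x : row3 t x 0 (inord 1) = x.1. Proof. by rewrite mxE inordK. Qed.
Lemma row3_2 t x : row3 t x 0 (inord 2) = x.2. Proof. by rewrite mxE inordK. Qed.

Lemma inord1_neq0 n : (inord 1 == 0 :> 'I_n.+2) = false.
Proof. by apply/negP => /eqP/(congr1 val); rewrite /= inordK. Qed.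

Lemma inord2_neq0 n : (inord 2 == 0 :> 'I_n.+3) = false.
Proof. by apply/negP => /eqP/(congr1 val); rewrite /= inordK. Qed.

Lemma inord2_neq1 n : (inord 2 == inord 1 :> 'I_n.+3) = false.
Proof. by apply/negP => /eqP/(congr1 val); rewrite /= !inordK. Qed.

Lemma ord3_cases (j : 'I_3) : [\/ j = 0, j = inord 1 | j = inord 2].
Proof.
by case: j => -[|[|[|//]]] h; [apply: Or31|apply: Or32|apply: Or33]; apply/val_inj; rewrite /= ?inordK.
Qed.

Lemma row3_shift0 t x a : row3 t x + a *: delta_mx 0 0 = row3 (t + a) x.
Proof.
apply/rowP => j; rewrite !mxE; case: (ord3_cases j) => ->;
  by rewrite ?inord1_neq0 ?inord2_neq0 ?inordK //= ?mulr1 ?mulr0 ?addr0.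
Qed.

Lemma row3_shift1 t x a : row3 t x + a *: delta_mx 0 (inord 1) = row3 t (x.1 + a, x.2).
Proof.
apply/rowP => j; rewrite !mxE; case: (ord3_cases j) => ->;
  by rewrite ?[0 == inord 1]eq_sym ?inord1_neq0 ?inord2_neq1 ?eqxx ?inordK //= ?mulr1 ?mulr0 ?addr0.
Qed.

Lemma row3_shift2 t x a : row3 t x + a *: delta_mx 0 (inord 2) = row3 t (x.1, x.2 + a).
Proof.
apply/rowP => j; rewrite !mxE; case: (ord3_cases j) => ->;
  by rewrite ?[_ == inord 2]eq_sym ?inord2_neq0 ?inord2_neq1 ?eqxx ?inordK //= ?mulr1 ?mulr0 ?addr0.
Qed.

Lemma solution_is_derive s u (th0 : R * R -> R) (th : R -> R * R -> R) t x : is_solution s u th0 th -> 0 < t ->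
  [/\ is_derive t (1 : R) (fun tau => th tau x) (dt th t x),
      is_derive x.1 (1 : R) (fun a => th t (a, x.2)) (d1 (th t) x)
    & is_derive x.2 (1 : R) (fun b => th t (x.1, b)) (d2 (th t) x)].
Proof.
move=> [sm _] t0.
have x0 : 0 < row3 t x 0 0 by rewrite row3_0.
have key (g : R -> R) (c : R) : derivable (fun a => g (c + a)) 0 1 -> is_derive c (1 : R) g (derive1 g c).
  move=> /derivable_derive1P/is_derive_shift; rewrite addr0 => dg.
  by apply: derivable_derive1P; case: dg.
have D i := proj2 (sm [::] (row3 t x) x0) i.
split; apply: key.
- rewrite [X in derivable X](_ : _ = (fun a : R => pdw [::] (fun v => th (v 0 0) (v 0 (inord 1), v 0 (inord 2)))
      (row3 t x + a *: delta_mx 0 0))); first exact: D.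
  by apply/funext => a; rewrite row3_shift0 /= row3_0 row3_1 row3_2 -surjective_pairing.
- rewrite [X in derivable X](_ : _ = (fun a : R => pdw [::] (fun v => th (v 0 0) (v 0 (inord 1), v 0 (inord 2)))
      (row3 t x + a *: delta_mx 0 (inord 1)))); first exact: D.
  by apply/funext => a; rewrite row3_shift1 /= row3_0 row3_1 row3_2.
- rewrite [X in derivable X](_ : _ = (fun a : R => pdw [::] (fun v => th (v 0 0) (v 0 (inord 1), v 0 (inord 2)))
      (row3 t x + a *: delta_mx 0 (inord 2)))); first exact: D.
  by apply/funext => a; rewrite row3_shift2 /= row3_0 row3_1 row3_2.
Qed.

(** Here [sg] is the barrier's own parameter; the solution is read at the physical time [tau sg]. *)
Definition qbarrier (X beta k : R -> R) (sg : R) x : R :=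
  beta sg - k sg * ((x.1 - X sg) ^+ 2 + x.2 ^+ 2).

(** If the inequality failed, the difference between [th (tau sg)] and the barrier would have a
    negative minimum over all [sg] in [[0, S]] and all points. It is attained because the barrier
    falls below the lower bound [- m] far away. There the space gradients agree, the [sg]-derivative
    of the difference is nonpositive, and a vertical translate of the barrier touches the solution
    from below, so that [fraclap_le] bounds the dissipation; the equation then contradicts the
    strict subsolution inequality. That inequality is required only where the barrier exceeds [- m],
    and its splitting radius [r] may vary with the point. *)
Lemma quadratic_comparison s u (th0 : R * R -> R) (th : R -> R * R -> R) (tau X beta k tau' X' beta' k' : R -> R) (S m k0 b1 X1 : R) :
  0 < s -> s < 1 -> is_solution s u th0 th -> 0 <= S -> 0 < k0 ->
  (forall sg, 0 <= sg <= S ->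
    [/\ is_derive sg (1 : R) tau (tau' sg), is_derive sg (1 : R) X (X' sg),
        is_derive sg (1 : R) beta (beta' sg) & is_derive sg (1 : R) k (k' sg)]) ->
  (forall sg, 0 <= sg <= S -> [/\ k0 <= k sg, beta sg <= b1 & `|X sg| <= X1]) ->
  tau 0 = 0 -> (forall sg, 0 < sg <= S -> 0 < tau sg) -> (forall sg, 0 < sg <= S -> 0 < tau' sg) ->
  (forall sg x, 0 <= sg <= S -> - m <= th (tau sg) x) ->
  (forall x, qbarrier X beta k 0 x <= th0 x) ->
  (forall sg x, 0 < sg <= S -> - m < qbarrier X beta k sg x ->
     exists2 r, 0 < r &
     beta' sg - k' sg * ((x.1 - X sg) ^+ 2 + x.2 ^+ 2) + 2 * k sg * (x.1 - X sg) * X' sg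
     + tau' sg * (- 2 * k sg * ((u x).1 * (x.1 - X sg) + (u x).2 * x.2)
       + frac_const s * (k sg * (near_const s * r `^ (2 - 2 * s))
         + (qbarrier X beta k sg x + m) * (far_const s * r `^ (- (2 * s))))) < 0) ->
  forall sg x, 0 <= sg <= S -> qbarrier X beta k sg x <= th (tau sg) x.
Proof.
move=> s0 s1 sol S0 k00 D bnd tau0 tau_gt0 tau'_gt0 thm init sub sg1 x1 sg1S.
rewrite leNgt; apply/negP => lt1.
pose Q := qbarrier X beta k.
pose w (p : R * (R * R)) := th (tau p.1) p.2 - Q p.1 p.2.
(* Where the barrier exceeds [- m], [k0] times the squared distance to its centre is at most
   [b1 + m]; this confines a negative minimum to a compact box. *)
have [L L0 far] : exists2 L, 0 <= L & forall sg x, 0 <= sg <= S -> - m < Q sg x -> `|x.1| <= L /\ `|x.2| <= L.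
  pose A := Num.sqrt (`|b1 + m| / k0).
  have A0 : 0 <= A by exact: sqrtr_ge0.
  exists (A + `|X1|); first by rewrite addr_ge0.
  move=> sg x sgS Qm; have [hk hb hX] := bnd _ sgS.
  have hq : (x.1 - X sg) ^+ 2 + x.2 ^+ 2 <= A ^+ 2.
    rewrite sqr_sqrtr ?divr_ge0 ?(ltW k00)// ler_pdivlMr//.
    have q0 : 0 <= (x.1 - X sg) ^+ 2 + x.2 ^+ 2 by rewrite addr_ge0 ?sqr_ge0.
    have : b1 + m <= `|b1 + m| by exact: ler_norm.
    by move: Qm; rewrite /Q /qbarrier; nra.
  have sqle (y : R) : y ^+ 2 <= A ^+ 2 -> `|y| <= A.
    by rewrite -[y ^+ 2]real_normK ?num_real// ler_pXn2r ?nnegrE.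
  have h1 : `|x.1 - X sg| <= A by apply: sqle; apply: le_trans hq; rewrite lerDl sqr_ge0.
  have h2 : `|x.2| <= A by apply: sqle; apply: le_trans hq; rewrite lerDr sqr_ge0.
  split; last by apply: (le_trans h2); rewrite lerDl.
  rewrite -[x.1](subrK (X sg)) (le_trans (ler_normD _ _))// lerD// (le_trans hX)//.
  exact: ler_norm.
pose K : set (R * (R * R)) := `[0, S] `*` (`[- L, L] `*` `[- L, L]).
have cK : compact K by do 2 (apply: compact_setX; first exact: segment_compact); exact: segment_compact.
have inK sg x : 0 <= sg <= S -> - m < Q sg x -> K (sg, x).
  move=> sgS /(far _ _ sgS)[h1 h2]; split => /=; first by rewrite in_itv.
  by split; rewrite /= in_itv /= -ler_norml.
have neg_inK sg x : 0 <= sg <= S -> w (sg, x) < 0 -> K (sg, x).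
  by move=> sgS wn; apply: inK => //; have := thm sg x sgS; move: wn; rewrite /w /=; lra.
have w1 : w (sg1, x1) < 0 by rewrite /w /= subr_lt0.
have cw : {within K, continuous w}.
  apply/subspace_continuousP => -[sg x] Kp.
  have sgS : 0 <= sg <= S by case: Kp => /=; rewrite in_itv.
  have [dtau dX dbeta dk] := D _ sgS.
  case: (sol) => _ [/subspace_continuousP cth _].
  have tau0' : 0 <= tau sg.
    have [->|sg0] := eqVneq sg 0; first by rewrite tau0.
    by apply/ltW/tau_gt0; case/andP: sgS => h ->; rewrite andbT lt_neqAle eq_sym sg0.
  have ct (f : R -> R) (l : R) : is_derive sg (1 : R) f l -> (fun p : R * (R * R) => f p.1) @ nbhs (sg, x) --> f sg.
    move=> df; have cf := is_derive_continuous df.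
    by apply: (@cvg_comp _ _ _ fst f); [exact: cvg_fst|exact: cf].
  have c1 : (fun p : R * (R * R) => p.2.1) @ nbhs (sg, x) --> x.1.
    by apply: (@cvg_comp _ _ _ snd fst); [exact: cvg_snd|exact: cvg_fst].
  have c2 : (fun p : R * (R * R) => p.2.2) @ nbhs (sg, x) --> x.2.
    by apply: (@cvg_comp _ _ _ snd snd); [exact: cvg_snd|exact: cvg_snd].
  apply: (@cvgB _ _ _ _ _ (fun p : R * (R * R) => th (tau p.1) p.2) (fun p => Q p.1 p.2)).
    pose ph (p : R * (R * R)) := (tau p.1, p.2).
    have cph : ph @ nbhs (sg, x) --> (tau sg, x).
      by apply: (@cvg_pair _ _ _ (nbhs (sg, x)) (nbhs (tau sg)) (nbhs x)); [exact: ct dtau | exact: cvg_snd].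
    apply: (within_cvg_comp (B := [set tx : R * (R * R) | 0 <= tx.1]) (ph := ph)
      (g := fun q => th q.1 q.2) cph _ (cth (tau sg, x) tau0')) => p [s' _] /=.
    move: s'; rewrite /= in_itv /= => s'.
    have [->|sg0] := eqVneq p.1 0; first by rewrite tau0.
    by apply/ltW/tau_gt0; case/andP: s' => h ->; rewrite andbT lt_neqAle eq_sym sg0.
  apply: cvg_within_filter.
  apply: cvgB; first exact: ct dbeta.
  apply: cvgM; first exact: ct dk.
  apply: cvgD; rewrite !expr2; apply: cvgM => //; apply: cvgB => //; exact: ct dX.
have [[sg2 x2] /set_mem K2 min2] := compact_EVT_min (ex_intro _ _ (neg_inK _ _ sg1S w1)) cK cw.
have sg2S : 0 <= sg2 <= S by case: K2 => /=; rewrite in_itv.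
have w2 : w (sg2, x2) < 0.
  by apply: (le_lt_trans _ w1); apply: min2; apply/mem_set/neg_inK.
(* A negative value can occur only in [K], so the minimum over [K] is a minimum over the whole
   slab. *)
have gmin sg x : 0 <= sg <= S -> w (sg2, x2) <= w (sg, x).
  move=> sgS; have [wn|wp] := ltP (w (sg, x)) 0; last by apply: (le_trans (ltW w2)).
  by apply: min2; apply/mem_set/neg_inK.
have sg2_gt0 : 0 < sg2.
  move/andP: (sg2S) => [h _]; rewrite lt_neqAle h andbT eq_sym; apply/eqP => E.
  move: w2; rewrite E /w /= tau0; case: (sol) => _ [_ [-> _]].
  by rewrite subr_lt0 ltNge init.
have sg2S' : 0 < sg2 <= S by rewrite sg2_gt0; case/andP: sg2S.
have t2 := tau_gt0 _ sg2S'.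
have [dth d1th d2th] := solution_is_derive x2 sol t2.
have [dtau dX dbeta dk] := D _ sg2S.
have Qm : - m < Q sg2 x2.
  by have := thm sg2 x2 sg2S; move: w2; rewrite /w /=; lra.
set c := w (sg2, x2) in gmin w2.
have Ddt : beta' sg2 - k' sg2 * ((x2.1 - X sg2) ^+ 2 + x2.2 ^+ 2)
    + 2 * k sg2 * (x2.1 - X sg2) * X' sg2 >= tau' sg2 * dt th (tau sg2) x2.
  rewrite -subr_le0.
  have dQ : is_derive sg2 (1 : R) (fun sg => w (sg, x2)) (tau' sg2 * dt th (tau sg2) x2 -
      (beta' sg2 - (k sg2 * (2 * (x2.1 - X sg2) * (- X' sg2)) + k' sg2 * ((x2.1 - X sg2) ^+ 2 + x2.2 ^+ 2)))).
    have dq := derM dk (derD (derX2 (derB (derC sg2 x2.1) dX)) (derC sg2 (x2.2 ^+ 2))).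
    have := derB (der_comp dtau dth) (derB dbeta dq).
    by move=> h; apply: (der_eq h) => /=; ring.
  apply: le_trans (is_derive_le0_left sg2_gt0 dQ _); first by lra.
  by move=> t t0 t2'; apply: gmin; rewrite t0 (le_trans t2')//; case/andP: sg2S.
have D1 : d1 (th (tau sg2)) x2 = - 2 * k sg2 * (x2.1 - X sg2).
  apply/eqP; rewrite -subr_eq0; apply/eqP.
  have dQ : is_derive x2.1 (1 : R) (fun a => w (sg2, (a, x2.2)))
      (d1 (th (tau sg2)) x2 - (- 2 * k sg2 * (x2.1 - X sg2))).
    have dq := derM (derC x2.1 (k sg2)) (derD (derX2 (derB (derI x2.1) (derC x2.1 (X sg2)))) (derC x2.1 (x2.2 ^+ 2))).
    by have := derB d1th (derB (derC x2.1 (beta sg2)) dq); move=> h; apply: (der_eq h) => /=; ring.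
  by apply: (is_derive_min dQ) => a; rewrite -surjective_pairing; exact: gmin.
have D2 : d2 (th (tau sg2)) x2 = - 2 * k sg2 * x2.2.
  apply/eqP; rewrite -subr_eq0; apply/eqP.
  have dQ : is_derive x2.2 (1 : R) (fun a => w (sg2, (x2.1, a)))
      (d2 (th (tau sg2)) x2 - (- 2 * k sg2 * x2.2)).
    have dq := derM (derC x2.2 (k sg2)) (derD (derC x2.2 ((x2.1 - X sg2) ^+ 2)) (derX2 (derI x2.2))).
    by have := derB d2th (derB (derC x2.2 (beta sg2)) dq); move=> h; apply: (der_eq h) => /=; ring.
  by apply: (is_derive_min dQ) => a; rewrite -surjective_pairing; exact: gmin.
have [r r0 hsub] := sub _ _ sg2S' Qm.
case: (sol) => _ [_ [_ [_ /(_ _ x2 t2)[fd pde]]]].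
have kk : 0 <= k sg2 by have [h _ _] := bnd _ sg2S; lra.
have frac_le : fraclap s (th (tau sg2)) x2 <= frac_const s *
    (k sg2 * (near_const s * r `^ (2 - 2 * s)) + (Q sg2 x2 + m) * (far_const s * r `^ (- (2 * s)))).
  (* The linear part comes from expanding the square in the barrier. The drop is at most [Q + m]
     because the solution is below the barrier at the contact point and above [- m] everywhere. *)
  apply: (fraclap_le s0 s1 (l := (2 * k sg2 * (x2.1 - X sg2), 2 * k sg2 * x2.2))) => //.
  - by move: Qm; lra.
  - exact: frac_const_ge0.
  - move=> z _; have := gmin sg2 (shift2 x2 z) sg2S; rewrite /c /w /= enorm_sqr /Q /qbarrier /shift2 /=.
    by lra.
  - move=> z _; have := thm sg2 (shift2 x2 z) sg2S; have := w2; rewrite /c /w /=; lra.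
have tp := tau'_gt0 _ sg2S'.
rewrite D1 D2 in pde.
move: hsub Ddt frac_le pde; rewrite -/(Q sg2 x2).
set fr := frac_const s * _; set E := beta' sg2 - _ + _ => hsub Ddt frac_le pde.
have : tau' sg2 * dt th (tau sg2) x2 = tau' sg2 * (- ((u x2).1 * (- 2 * k sg2 * (x2.1 - X sg2)) + (u x2).2 * (- 2 * k sg2 * x2.2) + fraclap s (th (tau sg2)) x2)).
  by congr (_ * _); lra.
have : tau' sg2 * fraclap s (th (tau sg2)) x2 <= tau' sg2 * fr by rewrite ler_pM2l.
by move: hsub Ddt; lra.
Qed.

End Solutions.

(** * The hyperbolic flow *)

Section HyperbolicFlow.
Context {R : realType}.
Implicit Types (q a e r t : R) (x y z : R * R).

Section Flow.
Variables (kp dl g : R).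

(** The argument is the squared radius: the strain is of order [kp |x|^(- g)] for [dl <= |x| <= 1],
    and the last factor makes the velocity decay at infinity. *)
Definition strain q : R := kp * (q + dl ^+ 2) `^ (- (g / 2)) * (1 + q)^-1 ^+ 2.
Definition strain_rate q : R := g / 2 / (q + dl ^+ 2) + 2 / (1 + q).
Definition nrm2 x : R := x.1 ^+ 2 + x.2 ^+ 2.
(** Perpendicular gradient [(- d2 psi, d1 psi)] of the stream function [psi = x1 x2 strain(|x|^2)];
    [strain_rate] is minus the logarithmic derivative of [strain]. *)
Definition flow x : R * R :=
  (- x.1 * strain (nrm2 x) + 2 * x.1 * x.2 ^+ 2 * strain (nrm2 x) * strain_rate (nrm2 x),
   x.2 * strain (nrm2 x) - 2 * x.1 ^+ 2 * x.2 * strain (nrm2 x) * strain_rate (nrm2 x)).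

Lemma nrm2_ge0 x : 0 <= nrm2 x.
Proof. by rewrite addr_ge0 ?sqr_ge0. Qed.

Lemma nrm2_opp x : nrm2 (opp2 x) = nrm2 x.
Proof. by rewrite /nrm2 /= !sqrrN. Qed.

Lemma flow_opp x : flow (opp2 x) = opp2 (flow x).
Proof. by rewrite /flow nrm2_opp /opp2 /=; congr pair; ring. Qed.

(** The [strain_rate] part of the flow is tangent to circles about the origin and drops out. *)
Lemma flow_dot x : (flow x).1 * x.1 + (flow x).2 * x.2 = (x.2 ^+ 2 - x.1 ^+ 2) * strain (nrm2 x).
Proof. by rewrite /flow /=; ring. Qed.

Hypotheses (kp0 : 0 < kp) (dl0 : 0 < dl) (g0 : 0 < g) (g2 : g < 2).

Lemma strain_gt0 q : 0 <= q -> 0 < strain q.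
Proof.
move=> q0; have [d2 q1] : 0 < q + dl ^+ 2 /\ 0 < 1 + q by move: (exprn_gt0 2 dl0); lra.
by rewrite /strain !mulr_gt0 ?powR_gt0 ?exprn_gt0 ?invr_gt0.
Qed.

Lemma strain_le q r : 0 <= q -> q <= r -> strain r <= strain q.
Proof.
move=> q0 qr; have d2 := exprn_gt0 2 dl0.
rewrite /strain -!mulrA ler_pM2l//; apply: ler_pM.
- exact: powR_ge0.
- by rewrite exprn_ge0// invr_ge0; lra.
- by apply: ler_powRN; [lra|lra|rewrite divr_ge0// ltW].
- by rewrite ler_pXn2r ?nnegrE ?invr_ge0 ?lef_pV2 ?posrE//; lra.
Qed.

(** Two factors [c] pay for the power, since [c^2] raised to [1 - g / 2] is at most 1 when [g < 2];
    four pay for the squared cutoff. *)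
Lemma strain_comparable q r (c : R) : 0 < c -> c <= 1 -> 0 <= r -> c ^+ 2 * r <= q ->
  c ^+ 6 * strain q <= strain r.
Proof.
move=> c0 c1 r0 rq; have d2 := exprn_gt0 2 dl0.
have c2 : 0 < c ^+ 2 by rewrite exprn_gt0.
have c21 : c ^+ 2 <= 1 by rewrite expr_le1 // ltW.
have q0 : 0 <= q by apply: le_trans rq; rewrite mulr_ge0// ltW.
have h1 : c ^+ 2 * (q + dl ^+ 2) `^ (- (g / 2)) <= (r + dl ^+ 2) `^ (- (g / 2)).
  apply: (@le_trans _ _ (c ^+ 2 * (c ^+ 2 * (r + dl ^+ 2)) `^ (- (g / 2)))).
    rewrite ler_pM2l//; apply: ler_powRN; [by rewrite mulr_gt0//; lra|nra|by move: (g0); lra].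
  rewrite powRM; [|exact: ltW|lra].
  rewrite mulrA -[leRHS]mul1r ler_wpM2r ?powR_ge0//.
  rewrite -{1}(powRr1 (ltW c2)) -powRD ?(gt_eqF c2) ?implybT//.
  rewrite -[leRHS](powRr0 (c ^+ 2)); apply: ger_powR; first by rewrite c2.
  by move: (g2); lra.
have h2 : c ^+ 4 * (1 + q)^-1 ^+ 2 <= (1 + r)^-1 ^+ 2.
  rewrite (_ : c ^+ 4 = (c ^+ 2) ^+ 2); last by rewrite -exprM.
  rewrite -exprMn ler_pXn2r ?nnegrE ?mulr_ge0 ?invr_ge0//; try lra.
  by rewrite ler_pdivrMr 1?mulrC ?ler_pdivlMr; [nra|lra|nra].
have -> : c ^+ 6 * strain q = kp * ((c ^+ 2 * (q + dl ^+ 2) `^ (- (g / 2))) * (c ^+ 4 * (1 + q)^-1 ^+ 2)).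
  by rewrite /strain; ring.
rewrite /strain -[leRHS]mulrA ler_pM2l//; apply: ler_pM => //.
  by rewrite mulr_ge0 ?powR_ge0// ltW.
by rewrite mulr_ge0 ?exprn_ge0 ?invr_ge0 ?(ltW c0)//; lra.
Qed.

(* The ball of radius [lm * X] about (X, 0), carried by the velocity of its centre and shrunk at
   the rate [strain (X^2)], is crossed outwards by the flow. *)
Lemma flow_outward (zt lm X : R) x :
  zt = (2 - g) / 8 -> lm = zt / 3 -> 0 < X -> 8 * X ^+ 2 <= zt ->
  (x.1 - X) ^+ 2 + x.2 ^+ 2 <= (lm * X) ^+ 2 ->
  0 <= ((flow x).1 + strain (X ^+ 2) * X) * (x.1 - X) + (flow x).2 * x.2
     + strain (X ^+ 2) * ((x.1 - X) ^+ 2 + x.2 ^+ 2).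
Proof.
move=> ztE lmE X0 X1 hx; have d2 := exprn_gt0 2 dl0.
have [g0' g2'] := (g0, g2).
set m := strain (X ^+ 2); set G := strain (nrm2 x); set H := strain_rate (nrm2 x).
set d := x.1 - X; set q := nrm2 x.
have zt0 : 0 < zt by lra.
have lm0 : 0 < lm by lra.
have lm1 : lm < 12^-1 by lra.
have q0 : 0 <= q := nrm2_ge0 x.
have G0 : 0 < G by exact: strain_gt0.
have m0 : 0 < m by apply: strain_gt0; rewrite sqr_ge0.
have dX : - (lm * X) <= d <= lm * X.
  rewrite -ler_norml -(@ler_pXn2r _ 2)// ?nnegrE ?mulr_ge0 ?(ltW lm0) ?(ltW X0)//.
  by rewrite real_normK ?num_real//; apply: le_trans hx; rewrite lerDl sqr_ge0.
have xX : x.1 = X + d by rewrite /d; ring.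
have x0 : (1 - lm) * X <= x.1 by rewrite xX; lra.
have xp : 0 < x.1 by apply: lt_le_trans x0; rewrite mulr_gt0//; lra.
have qx : x.1 ^+ 2 <= q by rewrite lerDl sqr_ge0.
(* The singular part of [strain_rate] contributes at most [g (1 + 2 lm)] and the cutoff at most
   [zt]; with [g = 2 - 8 zt] and [lm = zt / 3] a margin [2 zt] is left. This is where [g < 2] is
   decisive. *)
have bracket : 2 * x.1 * X * H <= 2 - 2 * zt.
  have h1 : 2 * x.1 * X * (g / 2 / (q + dl ^+ 2)) <= g * (1 + 2 * lm).
    rewrite (_ : _ * _ = g * x.1 * X / (q + dl ^+ 2)); last by field; nra.
    rewrite ler_pdivrMr; last by nra.
    rewrite -!mulrA ler_pM2l//.
    have : x.1 * X <= (1 + 2 * lm) * x.1 ^+ 2.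
      rewrite expr2 mulrCA ler_pM2l//.
      by nra.
    by nra.
  have h2 : 2 * x.1 * X * (2 / (1 + q)) <= zt.
    rewrite mulrA ler_pdivrMr; last by lra.
    have : x.1 * X <= 2 * X ^+ 2 by nra.
    by nra.
  rewrite /H /strain_rate mulrDr; apply: (le_trans (lerD h1 h2)).
  by rewrite ztE lmE; nra.
rewrite (_ : _ + _ + _ = x.1 * d * (m - G) + x.2 ^+ 2 * (m + G - 2 * x.1 * X * H * G)); last first.
  by rewrite /flow /= -/G -/H xX; ring.
have hb : m - G + 2 * zt * G <= m + G - 2 * x.1 * X * H * G by nra.
have y0 : 0 <= x.2 ^+ 2 := sqr_ge0 _.
have ztG : 0 <= 2 * zt * G by move: (mulr_gt0 zt0 G0); lra.
(* Three regions. Beyond the centre, [G <= m] and both terms are nonnegative. Before the centre and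
   inside the circle of radius [X], [G] exceeds [m] by a factor at most [(1 - lm)^(- 6)], which the
   margin absorbs. Before the centre and outside that circle, the first term is negative but is
   compensated through [- d x1 <= x2^2]. *)
have [dn|dp] := ltP d 0; last first.
  have Gm : G <= m by apply: strain_le; [exact: sqr_ge0|rewrite /nrm2; nra].
  by rewrite addr_ge0// mulr_ge0//; [rewrite mulr_ge0// ltW|lra|lra].
have [qX|qX] := leP q (X ^+ 2).
  have mG : m <= G by exact: strain_le.
  have : (1 - lm) ^+ 6 * G <= m.
    apply: strain_comparable; [lra|lra|exact: sqr_ge0|rewrite -exprMn].
    by apply: le_trans qx; rewrite ler_pXn2r ?nnegrE ?(ltW xp)// mulr_ge0 ?(ltW X0)//; lra.
  have : 1 - 6 * lm <= (1 - lm) ^+ 6.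
    have : 1 - 2 * lm <= (1 - lm) ^+ 2 by nra.
    rewrite (_ : (1 - lm) ^+ 6 = (1 - lm) ^+ 2 * (1 - lm) ^+ 2 * (1 - lm) ^+ 2); last by ring.
    set v := (1 - lm) ^+ 2 => hv; have : 1 - 4 * lm <= v * v by nra.
    by nra.
  move=> h6 hG; apply: addr_ge0; first by rewrite -mulrA; apply: mulr_ge0; [exact: ltW | apply: mulr_le0; lra].
  apply: mulr_ge0 => //; apply: le_trans hb.
  have : (1 - 6 * lm) * G <= m by apply: le_trans hG; rewrite ler_pM2r.
  have -> : 6 * lm = 2 * zt by lra.
  by lra.
have Gm : G <= m by apply: strain_le (ltW qX); exact: sqr_ge0.
have hy : - d * x.1 <= x.2 ^+ 2 by move: qX; rewrite /q /nrm2 xX; nra.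
have : - d * x.1 * (m - G) <= x.2 ^+ 2 * (m - G) by rewrite ler_wpM2r// subr_ge0.
by nra.
Qed.

End Flow.
End HyperbolicFlow.

(** * Focusing *)

Section Breaking.
Context {R : realType}.
Implicit Types (s q a e r t : R) (x y z : R * R).

(** The barrier is [- a - e t - eta |x|^2]. The small opening [eta] pushes it below any bounded
    solution at infinity, and the slope [e] in time pays for drift and dissipation. The choices are
    made in the order [e], [r], [eta]. *)
Lemma minimum_principle s (u : R * R -> R * R) (th0 : R * R -> R) (th : R -> R * R -> R) a (C : R) :
  0 < s -> s < 1 -> is_solution s u th0 th ->
  (forall x, `|(u x).1 * x.1 + (u x).2 * x.2| <= C) ->
  (forall x, - a <= th0 x) -> forall t x, 0 <= t -> - a <= th t x.
Proof.
move=> s0 s1 sol uC th0a t x t0.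
have c0 := @frac_const_ge0 R s.
have [n0 f0] := (near_const_ge0 s1, far_const_ge0 s0).
have C0 : 0 <= C by apply: le_trans (uC (0, 0)).
case: (sol) => _ [_ [_ [[M thM] _]]].
pose m := `|M| + `|a|.
pose m1 := m + `|a|.
have m0 : 0 <= m1 by rewrite !addr_ge0.
suff H e : 0 < e -> - a - e * t - e * nrm2 x <= th t x.
  rewrite leNgt; apply/negP => lt.
  pose v := t + nrm2 x + 1.
  have v0 : 0 < v by move: (nrm2_ge0 x); rewrite /v; lra.
  have := H ((- a - th t x) / (2 * v)) ltac:(rewrite divr_gt0//; lra).
  set w := (- a - th t x) / (2 * v) => Hw.
  have : w * v = (- a - th t x) / 2 by rewrite /w; field; lra.
  have : 0 < w by rewrite /w divr_gt0//; lra.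
  by rewrite /v; nra.
move=> e0.
(* The radius [r] is so large that the far dissipation, for heights up to [m1], costs at most
   [e / 3]; [eta] is then so small that drift and near dissipation together cost at most [e / 3]. *)
pose y := e / (3 * (frac_const s * m1 * far_const s + 1)).
have cmf : 0 <= frac_const s * m1 * far_const s by exact: mulr_ge0 (mulr_ge0 c0 m0) f0.
have y0 : 0 < y by rewrite /y divr_gt0//; lra.
pose r := y `^ (- (2 * s)^-1).
have r0 : 0 < r by rewrite powR_gt0.
have rE : r `^ (- (2 * s)) = y.
  by rewrite /r -powRrM (_ : _ * _ = 1) ?powRr1 ?ltW//; field; lra.
pose A := 2 * C + frac_const s * (near_const s * r `^ (2 - 2 * s)).
have A0 : 0 <= A by apply: addr_ge0; [rewrite mulr_ge0|exact: mulr_ge0 c0 (mulr_ge0 n0 (powR_ge0 _ _))].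
pose eta := e / (3 * (A + 1)).
have eta0 : 0 < eta by rewrite /eta divr_gt0//; lra.
have etae : eta <= e by rewrite /eta ler_pdivrMr; nra.
have etaA : eta * A <= e / 3.
  rewrite /eta mulrAC ler_pdivrMr; last by lra.
  by rewrite (_ : e / 3 * (3 * (A + 1)) = e * (A + 1)); [nra|field].
have yA : frac_const s * m1 * far_const s * y <= e / 3.
  rewrite /y mulrA ler_pdivrMr; last by lra.
  rewrite (_ : e / 3 * _ = e * (frac_const s * m1 * far_const s + 1)); last by field.
  by nra.
have := @quadratic_comparison R s u th0 th id (fun=> 0) (fun sg => - a - e * sg) (fun=> eta)
  (fun=> 1) (fun=> 0) (fun=> - e) (fun=> 0) t m eta (- a) 0 s0 s1 sol t0 eta0.
move=> /(_ _ _ _ _ _ _ _ _ t x); rewrite /qbarrier !subr0 => H.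
apply: (le_trans _ (H _ _ _ _ _ _ _ _ _)).
- by rewrite lerB// ler_wpM2r ?nrm2_ge0.
- move=> sg _; split; [exact: derI|exact: derC| |exact: derC].
  by apply: der_eq (derB (derC sg (- a)) (derM (derC sg e) (derI sg))) _; ring.
- by move=> sg /andP[sg0 _]; split => //; [nra|rewrite normr0].
- by [].
- by move=> sg /andP[].
- by [].
- move=> sg z /andP[sg0 _]; have := thM sg z sg0.
  by rewrite ler_norml => /andP[h _]; rewrite /m; move: (ler_norm M) (normr_ge0 a); lra.
- move=> z; rewrite mulr0 subr0 subr0; apply: le_trans (th0a z).
  by rewrite gerBl; exact: mulr_ge0 (ltW eta0) (nrm2_ge0 z).
- move=> sg z sgt hz; exists r => //; rewrite rE.
  have hu := uC z; rewrite ler_norml in hu.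
  have q0 := nrm2_ge0 z.
  set Q := _ - eta * _ + m.
  have Qm : Q <= m1.
    rewrite /Q /m1; have : 0 <= eta * (z.1 ^+ 2 + z.2 ^+ 2) by exact: mulr_ge0 (ltW eta0) q0.
    have : 0 <= e * sg by case/andP: sgt => /ltW sg0 _; exact: mulr_ge0 (ltW e0) sg0.
    by move: (ler_norm (- a)); rewrite normrN; lra.
  have h1 : frac_const s * (Q * (far_const s * y)) <= e / 3.
    apply: le_trans yA; rewrite mulrA -[leRHS]mulrA; apply: ler_wpM2r.
      exact: mulr_ge0 f0 (ltW y0).
    exact: ler_wpM2l.
  have h2 : - 2 * eta * ((u z).1 * z.1 + (u z).2 * z.2)
      + frac_const s * (eta * (near_const s * r `^ (2 - 2 * s))) <= e / 3.
    apply: le_trans etaA; rewrite /A [leRHS]mulrDr; apply: lerD; last by rewrite mulrCA.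
    by nra.
  rewrite mul0r mulr0 mul1r mulrDr; lra.
- by rewrite t0 lexx.
Qed.

(** Far outside the scale [mu] this is [a] times the cosine of the polar angle; the regularisation
    makes it smooth at the origin. *)
Definition ramp (a mu : R) x : R := a * (x.1 * (nrm2 x + mu ^+ 2) `^ (- 2^-1)).

Lemma ramp_bound (a mu : R) x : 0 <= a -> 0 < mu -> `|ramp a mu x| <= a.
Proof.
move=> a0 mu0; have d2 := exprn_gt0 2 mu0; have q0 := nrm2_ge0 x.
have w0 : 0 < nrm2 x + mu ^+ 2 by lra.
rewrite /ramp normrM (ger0_norm a0) -[leRHS]mulr1 ler_wpM2l// normrM (ger0_norm (powR_ge0 _ _)).
rewrite powRN powR12_sqrt ?(ltW w0)// ler_pdivrMr ?sqrtr_gt0// mul1r -sqrtr_sqr ler_sqrt ?(ltW w0)//.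
by rewrite /nrm2; move: (sqr_ge0 x.2); lra.
Qed.

Lemma ramp_ge_half (a mu : R) x : 0 <= a -> 0 < mu -> 0 < x.1 -> x.2 ^+ 2 + mu ^+ 2 <= 3 * x.1 ^+ 2 ->
  a / 2 <= ramp a mu x.
Proof.
move=> a0 mu0 x0 hx; have d2 := exprn_gt0 2 mu0; have q0 := nrm2_ge0 x.
have w0 : 0 < nrm2 x + mu ^+ 2 by lra.
rewrite /ramp ler_wpM2l// powRN powR12_sqrt ?(ltW w0)// ler_pdivlMr ?sqrtr_gt0//.
rewrite mulrC ler_pdivrMr// -[x.1 * 2]ger0_norm ?mulr_ge0 ?(ltW x0)// -sqrtr_sqr ler_sqrt ?sqr_ge0//.
by rewrite /nrm2; nra.
Qed.

Lemma ramp_opp (a mu : R) x : ramp a mu (opp2 x) = - ramp a mu x.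
Proof. by rewrite /ramp nrm2_opp /=; ring. Qed.

Lemma powR_split (b r t : R) : 0 < b -> b `^ (r + t) = b `^ r * b `^ t.
Proof. by move=> b0; rewrite powRD// (gt_eqF b0) implybT. Qed.

(** The 8 is a factor 2 from [X^2 + dl^2 <= 2 X^2], raised to a power below 1, and a factor 4 from
    the cutoff. *)
Lemma strain_inv_le (kp dl g X : R) : 0 < kp -> 0 < dl -> 0 < g -> g < 2 -> dl <= X -> X <= 1 ->
  (strain kp dl g (X ^+ 2))^-1 <= 8 / kp * X `^ g.
Proof.
move=> kp0 dl0 g0 g2 dX X1; have X0 : 0 < X by lra.
have [d2 x2] := (exprn_gt0 2 dl0, exprn_gt0 2 X0).
have h1 : (X ^+ 2 + dl ^+ 2) `^ (g / 2) <= 2 * X `^ g.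
  apply: (@le_trans _ _ ((2 * X ^+ 2) `^ (g / 2))).
    apply: ge0_ler_powR; rewrite ?nnegrE; [lra|lra|lra|].
    by move: (ler_pXn2r (ltn0Sn 1) (ltW dl0 : dl \in Num.nneg) (ltW X0 : X \in Num.nneg)); rewrite dX; lra.
  rewrite (powRM _ (ler0n _ 2) (ltW x2)) -(powR_mulrn 2 (ltW X0)) -powRrM (_ : 2%:R * (g / 2) = g); last by field.
  rewrite ler_wpM2r ?powR_ge0// -[leRHS](powRr1 (_ : 0 <= 2)) ?ler_powR ?ler1n//; lra.
have h2 : (1 + X ^+ 2) ^+ 2 <= 4.
  have : X ^+ 2 <= 1 by rewrite expr_le1 // ltW.
  by set v := X ^+ 2 in x2 *; nra.
have p0 : 0 < (X ^+ 2 + dl ^+ 2) `^ (g / 2) by rewrite powR_gt0//; lra.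
have -> : (strain kp dl g (X ^+ 2))^-1 = kp^-1 * (X ^+ 2 + dl ^+ 2) `^ (g / 2) * (1 + X ^+ 2) ^+ 2.
  by rewrite /strain powRN; field; rewrite !gt_eqF//; lra.
rewrite (_ : 8 / kp * X `^ g = kp^-1 * (2 * X `^ g) * 4); last by ring.
apply: ler_pM => //.
- by rewrite mulr_ge0 ?powR_ge0// invr_ge0 ltW.
- by rewrite exprn_ge0; lra.
- by rewrite ler_wpM2l// invr_ge0 ltW.
Qed.

(** Relative loss of height per unit of [sg], up to the power [X^(g - 2 s)]: the time density
    [8 / kp * X^g] times the dissipation rate at the bump radius [(2 - g) / 24 * X]. The [+ 1] makes
    a later inequality strict. *)
Definition loss_rate (s g kp : R) : R :=
  8 / kp * (frac_const s * (near_const s + far_const s) + 1) * ((2 - g) / 24) `^ (- (2 * s)).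

(** The parameter is [sg = ln (X0 / X)], one unit per factor e of distance; with
    [tau' = 1 / strain(X^2)] the centre [(X, 0)] moves exactly with the flow. The time found does
    not depend on [th], so it also serves for the reflected solution. *)
Lemma focusing s (kp dl g X0 a : R) :
  0 < s -> s < 1 -> 2 * s < g -> g < 2 -> 0 < kp -> 0 < dl -> dl <= X0 -> X0 <= 1 ->
  64 * X0 ^+ 2 <= 2 - g -> 0 < a ->
  8 * (loss_rate s g kp * X0 `^ (g - 2 * s)) <= g - 2 * s ->
  exists t, 0 <= t <= 8 / (kp * g) * X0 `^ g /\
    forall th, is_solution s (flow kp dl g) (ramp a (X0 / 2)) th -> 5 / 16 * a <= th t (dl, 0).
Proof.
move=> s0 s1 gs g2 kp0 dl0 dX X01 X0g a0 lossX.
have g0 : 0 < g by lra.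
have X00 : 0 < X0 by lra.
pose lm := (2 - g) / 24.
have lm0 : 0 < lm by rewrite /lm; lra.
have mu0 : 0 < X0 / 2 by lra.
pose X (sg : R) := X0 * expR (- (1 * sg)).
have X_gt0 sg : 0 < X sg by rewrite mulr_gt0// expR_gt0.
pose S := ln (X0 / dl).
have XS : X S = dl.
  by rewrite /X /S mul1r expRN lnK ?posrE ?divr_gt0// invf_div mulrC divfK ?gt_eqF.
have S0 : 0 <= S by rewrite ln_ge0// ler_pdivlMr// mul1r.
have X_le sg : 0 <= sg -> X sg <= X0.
  by move=> sg0; rewrite ler_piMr ?(ltW X00)// -[leRHS]expR0 ler_expR mul1r oppr_le0.
have X_ge sg : sg <= S -> dl <= X sg.
  by move=> sgS; rewrite -XS ler_pM2l// ler_expR !mul1r lerN2.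
have X_powR r sg : X sg `^ r = X0 `^ r * expR (- (r * sg)).
  rewrite powRM ?(ltW X00) ?(ltW (expR_gt0 _))// -expRM; congr (_ * expR _); ring.
have dX' sg : is_derive sg (1 : R) X (- X sg).
  by apply: der_eq (derM (derC sg X0) (der_expRN 1 sg)) _; rewrite /X; ring.
pose tau' (sg : R) := (strain kp dl g (X sg ^+ 2))^-1.
have st0 sg : 0 < strain kp dl g (X sg ^+ 2) by rewrite strain_gt0// sqr_ge0.
have tau'0 sg : 0 < tau' sg by rewrite invr_gt0.
have ctau' : continuous tau'.
  have -> : tau' = (fun sg => kp^-1 * (X sg ^+ 2 + dl ^+ 2) `^ (g / 2) * (1 + X sg ^+ 2) ^+ 2).
    apply/funext => sg; have d2 := exprn_gt0 2 dl0; have x2 := sqr_ge0 (X sg).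
    have p0 : 0 < (X sg ^+ 2 + dl ^+ 2) `^ (g / 2) by rewrite powR_gt0//; lra.
    by rewrite /tau' /strain powRN; field; rewrite !gt_eqF//; lra.
  move=> sg; have d2 := exprn_gt0 2 dl0; have x2 := sqr_ge0 (X sg).
  have w0 : 0 < X sg ^+ 2 + dl ^+ 2 by lra.
  have dw := derD (derX2 (dX' sg)) (derC sg (dl ^+ 2)).
  have dv := derX2 (derD (derC sg 1) (derX2 (dX' sg))).
  exact: is_derive_continuous (derM (derM (derC sg kp^-1) (der_comp dw (der_powR (g / 2) w0))) dv).
have [tau [tau0 dtau]] := antiderivative S ctau'.
have tau'_le sg : 0 <= sg <= S -> tau' sg <= 8 / kp * X0 `^ g * expR (- (g * sg)).
  move=> /andP[sg0 sgS]; rewrite -mulrA -X_powR.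
  by apply: strain_inv_le => //; [exact: X_ge | exact: le_trans (X_le _ sg0) X01].
have tau_gt0 sg : 0 < sg <= S -> 0 < tau sg.
  move=> /andP[sg0 sgS]; have [x|c [c0 cs]] := @MVT_der R tau tau' 0 sg sg0.
    by move=> h; apply: dtau; lra.
  by rewrite tau0 !subr0 => ->; rewrite mulr_gt0.
have tau_ge0 sg : 0 <= sg <= S -> 0 <= tau sg.
  move=> sgS; have [->|sg0] := eqVneq sg 0; first by rewrite tau0.
  by apply/ltW/tau_gt0; case/andP: sgS => h ->; rewrite andbT lt_neqAle eq_sym sg0.
(* The bound on [tau'] decays exponentially in [sg], so the total time is controlled uniformly in
   [dl] although [S] is not. *)
have tauS : tau S <= 8 / (kp * g) * X0 `^ g.
  pose C := 8 / kp * X0 `^ g.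
  have C0 : 0 <= C by rewrite mulr_ge0 ?powR_ge0 ?divr_ge0// ltW.
  have dF sg : 0 <= sg <= S -> is_derive sg (1 : R) (fun t => C / g * (1 - expR (- (g * t))) - tau t)
      (C * expR (- (g * sg)) - tau' sg).
    move=> sgS; apply: der_eq (derB (derM (derC sg (C / g)) (derB (derC sg 1) (der_expRN g sg))) (dtau _ sgS)) _.
    by field; lra.
  have dF0 sg : 0 <= sg <= S -> 0 <= C * expR (- (g * sg)) - tau' sg.
    by move=> sgS; rewrite subr_ge0; exact: tau'_le.
  have := der_ge0_le S0 dF dF0; rewrite tau0 subr0 (_ : - (g * 0) = 0); last by ring.
  rewrite expR0 subrr mulr0 subr_ge0 => H; apply: (le_trans H).
  rewrite (_ : 8 / (kp * g) * X0 `^ g = C / g); last by rewrite /C; field; rewrite !gt_eqF.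
  rewrite -[leRHS]mulr1 ler_wpM2l ?divr_ge0 ?(ltW g0)//.
(* The initial summit [- a + b] is [a / 2], the height that [ramp_ge_half] guarantees near
   [(X0, 0)]; after a relative loss of at most [1 / 8] the summit is at least [5 / 16 * a]. *)
pose b := 3 / 2 * a.
pose nu := g - 2 * s.
have nu0 : 0 < nu by rewrite /nu; lra.
pose K := loss_rate s g kp * X0 `^ nu.
have K0 : 0 <= K.
  rewrite mulr_ge0 ?powR_ge0// /loss_rate mulr_ge0 ?powR_ge0// mulr_ge0//; first by rewrite divr_ge0// ltW.
  by rewrite addr_ge0// mulr_ge0 ?frac_const_ge0 ?addr_ge0 ?near_const_ge0 ?far_const_ge0.
have K8 : K / nu <= 1 / 8 by rewrite ler_pdivrMr//; move: lossX; rewrite -/nu -/K; lra.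
pose B (sg : R) := K / nu * (1 - expR (- (nu * sg))).
have B0 sg : 0 <= sg -> 0 <= B sg.
  move=> sg0; apply: mulr_ge0; first by rewrite divr_ge0// ltW.
  by rewrite subr_ge0 -[leRHS]expR0 ler_expR oppr_le0 mulr_ge0// ltW.
have B8 sg : B sg <= 1 / 8.
  apply: (le_trans _ K8); rewrite /B -[leRHS]mulr1 ler_wpM2l ?divr_ge0 ?(ltW nu0)//.
have dB sg : is_derive sg (1 : R) B (K * expR (- (nu * sg))).
  apply: der_eq (derM (derC sg (K / nu)) (derB (derC sg 1) (der_expRN nu sg))) _; field; lra.
(* This is the opening for which the bump comes down to [- a] within the radius [lm * X sg]; the
   exponential form gives [k' = 2 k] at once. *)
pose k (sg : R) := b / (lm * X0) ^+ 2 * expR (- (- 2 * sg)).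
have kE sg : k sg = b / (lm * X sg) ^+ 2.
  rewrite /k /X mul1r (_ : - (- 2 * sg) = sg + sg); last by ring.
  rewrite expRD expRN; have e0 := expR_gt0 sg.
  by field; rewrite !gt_eqF.
have dk sg : is_derive sg (1 : R) k (2 * k sg).
  by apply: der_eq (derM (derC sg _) (der_expRN (- 2) sg)) _; rewrite /k; ring.
have b0 : 0 < b by rewrite /b; lra.
have k_gt0 sg : 0 < k sg by rewrite kE divr_gt0// exprn_gt0// mulr_gt0.
exists (tau S); split; first by rewrite tauS andbT tau_ge0// S0 lexx.
move=> th sol.
(* The bound on the radial drift may degenerate as [dl] tends to 0: the conclusion [- a] does not
   involve it. *)
have th_ge t x : 0 <= t -> - a <= th t x.
  apply: (minimum_principle (C := kp * (dl ^+ 2) `^ (- (g / 2))) s0 s1 sol) => z.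
    rewrite flow_dot normrM.
    have q0 := nrm2_ge0 z; have d2 := exprn_gt0 2 dl0.
    rewrite (ger0_norm (ltW (strain_gt0 g kp0 dl0 q0))).
    apply: (@le_trans _ _ (nrm2 z * strain kp dl g (nrm2 z))).
      apply: ler_wpM2r; first exact: ltW (strain_gt0 g kp0 dl0 q0).
      by rewrite /nrm2 ler_norml; move: (sqr_ge0 z.1) (sqr_ge0 z.2); lra.
    have h1 : (nrm2 z + dl ^+ 2) `^ (- (g / 2)) <= (dl ^+ 2) `^ (- (g / 2)).
      by apply: ler_powRN; lra.
    have h2 : nrm2 z * (1 + nrm2 z)^-1 ^+ 2 <= 1.
      by rewrite exprVn ler_pdivrMr ?mul1r; nra.
    rewrite /strain (_ : nrm2 z * _ = kp * ((nrm2 z + dl ^+ 2) `^ (- (g / 2)) * (nrm2 z * (1 + nrm2 z)^-1 ^+ 2))); last by ring.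
    rewrite ler_pM2l// -[leRHS]mulr1; apply: ler_pM => //; first exact: powR_ge0.
    by rewrite mulr_ge0// exprn_ge0// invr_ge0; lra.
  by have := ramp_bound z (ltW a0) mu0; rewrite ler_norml => /andP[].
have -> : 5 / 16 * a = - a + b * (1 - 1 / 8) by rewrite /b; field.
apply: (@le_trans _ _ (qbarrier X (fun sg => - a + b * (1 - B sg)) k S (dl, 0))).
  rewrite /qbarrier /= XS subrr expr0n /= addr0 mulr0 subr0 lerD2l ler_pM2l//.
  by move: (B8 S); lra.
apply: (@quadratic_comparison R s _ _ th tau X (fun sg => - a + b * (1 - B sg)) k tau' (fun sg => - X sg)
  (fun sg => - b * (K * expR (- (nu * sg)))) (fun sg => 2 * k sg) S a (k 0) (- a + b) X0 s0 s1 sol S0) => //.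
- move=> sg sgS; split => //; first exact: dtau.
  by apply: der_eq (derD (derC sg (- a)) (derM (derC sg b) (derB (derC sg 1) (dB sg)))) _; ring.
- move=> sg /andP[sg0 sgS]; split.
  + have bL : 0 < b / (lm * X0) ^+ 2 by rewrite divr_gt0// exprn_gt0// mulr_gt0.
    by rewrite ler_pM2l// ler_expR; lra.
  + by rewrite lerD2l ler_piMr ?(ltW b0)//; move: (B0 _ sg0); lra.
  + by rewrite gtr0_norm// X_le.
- by move=> sg x sgS; apply: th_ge; exact: tau_ge0.
- move=> x; have mE : k 0 = b / (lm * X0) ^+ 2 by rewrite kE /X mulr0 oppr0 expR0 mulr1.
  have B00 : B 0 = 0 by rewrite /B mulr0 oppr0 expR0 subrr mulr0.
  have XX0 : X 0 = X0 by rewrite /X mulr0 oppr0 expR0 mulr1.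
  rewrite /qbarrier B00 XX0 subr0 mulr1 mE.
  set v := _ ^+ 2 + _ ^+ 2; have L0 : 0 < (lm * X0) ^+ 2 by rewrite exprn_gt0// mulr_gt0.
  have [far|near] := leP ((lm * X0) ^+ 2) v.
    have : - a <= ramp a (X0 / 2) x by have := ramp_bound x (ltW a0) mu0; rewrite ler_norml => /andP[].
    apply: le_trans; suff : b <= b / (lm * X0) ^+ 2 * v by lra.
    by rewrite mulrAC ler_pdivlMr// ler_pM2l.
  apply: (@le_trans _ _ (a / 2)).
    have : 0 <= b / (lm * X0) ^+ 2 * v.
      by rewrite mulr_ge0 ?addr_ge0 ?sqr_ge0// divr_ge0// ltW.
    by rewrite /b; lra.
  have lm1 : lm < 12^-1 by rewrite /lm; lra.
  have hv : v < (X0 / 12) ^+ 2.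
    apply: (lt_le_trans near); rewrite ler_pXn2r ?nnegrE//; try nra.
  have hX : X0 * (11 / 12) <= x.1.
    rewrite leNgt; apply/negP => hlt; move: hv; rewrite /v; move: (sqr_ge0 x.2); nra.
  apply: ramp_ge_half; [exact: ltW|exact: mu0|lra|].
  by move: hv; rewrite /v; move: (sqr_ge0 (x.1 - X0)); nra.
(* Splitting the dissipation at the bump radius [r] makes its near and far parts of the same order
   [b r^(- 2 s)]. *)
- move=> sg x /andP[sg0 sgS] hQ; exists (lm * X sg); first by rewrite mulr_gt0.
  have Xs := X_gt0 sg; have r0 : 0 < lm * X sg by rewrite mulr_gt0.
  set v := _ ^+ 2 + _ ^+ 2.
  have hQ' : 0 < b * (1 - B sg) - k sg * v by move: hQ; rewrite /qbarrier -/v; lra.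
  have v0 : 0 <= v by rewrite addr_ge0 ?sqr_ge0.
  have bB : b * (1 - B sg) <= b.
    by move: (B0 _ (ltW sg0)) => h; rewrite ler_piMr ?(ltW b0)//; lra.
  have vr : v <= (lm * X sg) ^+ 2.
    have : k sg * v <= b by lra.
    by rewrite kE mulrAC ler_pdivrMr ?exprn_gt0// ler_pM2l.
  have out := @flow_outward R kp dl g kp0 dl0 g0 g2 ((2 - g) / 8) lm (X sg) x erefl _ Xs _ vr.
  have {}out : 0 <= ((flow kp dl g x).1 + strain kp dl g (X sg ^+ 2) * X sg) * (x.1 - X sg) + (flow kp dl g x).2 * x.2
     + strain kp dl g (X sg ^+ 2) * v.
    apply: out; first by rewrite /lm; field.
    have : X sg ^+ 2 <= X0 ^+ 2 by rewrite ler_pXn2r ?nnegrE ?(ltW Xs) ?(ltW X00)// X_le// ltW.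
    by lra.
  set r := lm * X sg in r0 vr *; set m := strain kp dl g (X sg ^+ 2) in out *.
  have m0 : 0 < m := st0 sg.
  have rE : k sg * (near_const s * r `^ (2 - 2 * s)) = b * near_const s * r `^ (- (2 * s)).
    rewrite kE -/r.
    rewrite powR_split// powR_mulrn ?(ltW r0)//; field; lra.
  have pr := powR_ge0 r (- (2 * s)).
  have [n0 f0] := (near_const_ge0 s1, far_const_ge0 s0).
  have c0 := frac_const_ge0 s.
  have Qb : qbarrier X (fun sg => - a + b * (1 - B sg)) k sg x + a <= b.
    by rewrite /qbarrier -/v; move: (mulr_ge0 (ltW (k_gt0 sg)) v0); lra.
  set Q := qbarrier _ _ _ _ _ in Qb *.
  have fl : frac_const s * (k sg * (near_const s * r `^ (2 - 2 * s)) + (Q + a) * (far_const s * r `^ (- (2 * s))))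
      <= b * (frac_const s * (near_const s + far_const s) * r `^ (- (2 * s))).
    have -> : b * (frac_const s * (near_const s + far_const s) * r `^ (- (2 * s))) =
        frac_const s * (b * near_const s * r `^ (- (2 * s)) + b * (far_const s * r `^ (- (2 * s)))) by ring.
    rewrite rE.
    apply: ler_wpM2l => //; rewrite lerD2l; apply: ler_wpM2r => //; exact: mulr_ge0.
  have Kbig : tau' sg * (frac_const s * (near_const s + far_const s) * r `^ (- (2 * s))) < K * expR (- (nu * sg)).
    have Xle : tau' sg <= 8 / kp * X sg `^ g.
      by apply: strain_inv_le => //; [exact: X_ge | exact: le_trans (X_le _ (ltW sg0)) X01].
    rewrite /K mulrA -[in ltRHS]mulrA -X_powR /nu powR_split// /r powRM ?(ltW lm0) ?(ltW Xs)//.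
    set A := frac_const s * _; have A0 : 0 <= A by rewrite mulr_ge0 ?addr_ge0.
    set L := lm `^ _; have L0 : 0 < L by rewrite powR_gt0.
    set Y := X sg `^ (- (2 * s)); have Y0 : 0 < Y by rewrite powR_gt0.
    rewrite (_ : loss_rate s g kp * _ = (8 / kp * X sg `^ g) * (A + 1) * (L * Y)); last first.
      by rewrite /loss_rate -/lm -/L -/A; ring.
    rewrite ltr_pM2r ?mulr_gt0//; apply: (@le_lt_trans _ _ (8 / kp * X sg `^ g * A)).
      by rewrite ler_wpM2r.
    by rewrite ltr_pM2l ?ltrDl// mulr_gt0 ?powR_gt0 ?divr_gt0.
  have e1 : tau' sg * m = 1 by rewrite /tau' mulVf// gt_eqF.
  (* In the clock [sg] the strain at the centre has rate 1, so [flow_outward] multiplied by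
     [k * tau'] produces the transport terms of the barrier, including those from [X' = - X] and
     [k' = 2 k]. *)
  have e2 : tau' sg * (((flow kp dl g x).1 + m * X sg) * (x.1 - X sg) + (flow kp dl g x).2 * x.2 + m * v)
     = tau' sg * ((flow kp dl g x).1 * (x.1 - X sg) + (flow kp dl g x).2 * x.2) + (tau' sg * m) * (X sg * (x.1 - X sg) + v) by ring.
  rewrite e1 mul1r in e2.
  have e3 := mulr_ge0 (ltW (mulr_gt0 (k_gt0 sg) (tau'0 sg))) out.
  rewrite -mulrA e2 in e3.
  have e4 := ler_wpM2l (ltW (tau'0 sg)) fl.
  have e5 : b * (tau' sg * (frac_const s * (near_const s + far_const s) * r `^ (- (2 * s)))) < b * (K * expR (- (nu * sg))) by rewrite ltr_pM2l.
  rewrite [tau' sg * (_ + frac_const s * _)]mulrDr.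
  set T1 := tau' sg * (frac_const s * (_ + _)) in e4 *.
  set fd := (flow kp dl g x).1 * _ + _ in e3 *.
  have : T1 < b * (K * expR (- (nu * sg))).
    by apply: le_lt_trans e5; apply: (le_trans e4); rewrite mulrCA.
  by lra.
- by rewrite S0 lexx.
Qed.

End Breaking.

(** * Functions with bounded derivatives *)

Section BoundedSmooth.
Context {R : realType}.
Implicit Types (i : bool) (a M C c : R) (p x : R * R) (f g h : R * R -> R) (k : nat).

Definition sh i a p : R * R := if i then (p.1 + a, p.2) else (p.1, p.2 + a).

Definition isd i f g := forall p, is_derive (0 : R) (1 : R) (fun a => f (sh i a p)) (g p).

(** One bound [M] for all iterated partial derivatives of order at most [k]. Derivatives enter
    through the relation [isd], so existence and bound are asserted together. *)
Fixpoint bddC k M f : Prop := (forall x, `|f x| <= M) /\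
  if k is k'.+1 then forall i, exists g, isd i f g /\ bddC k' M g else True.

Definition smoothb f := forall k, exists M, bddC k M f.

Lemma shD i a c p : sh i (a + c) p = sh i c (sh i a p).
Proof. by case: i; rewrite /sh /= addrA. Qed.

Lemma sh0 i p : sh i 0 p = p.
Proof. by case: i; case: p => p1 p2; rewrite /sh /= addr0. Qed.

Lemma isd_at i f g p a : isd i f g ->
  is_derive a (1 : R) (fun a => f (sh i a p)) (g (sh i a p)).
Proof.
move=> fg; rewrite -[X in is_derive X]addr0; apply/is_derive_shift.
rewrite [X in is_derive _ _ X](_ : _ = (fun c => f (sh i c (sh i a p)))); first exact: fg.
by apply/funext => c; rewrite shD.
Qed.

Lemma isd_unique i f g h : isd i f g -> isd i f h -> g = h.
Proof. by move=> fg fh; apply/funext => p; exact: is_derive_unique (fg p) (fh p). Qed.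

(** A uniform quadratic remainder survives limits and integration; derivatives are passed through
    [flim] and [kern_avg] in this way. *)
Lemma isd_taylor_intro i f g C :
  (forall p a, `|f (sh i a p) - f p - a * g p| <= C * a ^+ 2) -> isd i f g.
Proof.
move=> H p; apply/is_deriveP => e e0.
have C0 : 0 <= `|C| + 1 by rewrite addr_ge0.
have C1 : 0 < `|C| + 1 by rewrite ltr_wpDl.
exists (e / (`|C| + 1)); first by rewrite divr_gt0.
move=> a ha; rewrite add0r sh0 (mulrC (g p)); apply: (le_trans (H p a)).
rewrite -[a ^+ 2]real_normK ?num_real// expr2 mulrA ler_wpM2r//.
move: ha; rewrite ltr_pdivlMr// => ha.
have : C * `|a| <= (`|C| + 1) * `|a| by rewrite ler_wpM2r// (le_trans (ler_norm C))// lerDl.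
by lra.
Qed.

Lemma bddC_bound k M f : bddC k M f -> forall x, `|f x| <= M.
Proof. by case: k => [|k] []. Qed.

Lemma bddC_ge0 k M f : bddC k M f -> 0 <= M.
Proof. by move=> /bddC_bound /(_ (0, 0)); apply: le_trans. Qed.

Lemma bddC_S k M f i g : bddC k.+1 M f -> isd i f g -> bddC k M g.
Proof. by move=> [_ /(_ i)[g' [fg' bg']]] fg; rewrite (isd_unique fg fg'). Qed.

Lemma bddC_mono k M M' f : M <= M' -> bddC k M f -> bddC k M' f.
Proof.
move=> MM'; elim: k f => [|k IH] f [fM fd]; split=> //; try by move=> x; exact: le_trans (fM x) MM'.
by move=> i; have [g [fg /IH gM]] := fd i; exists g.
Qed.

Lemma bddC_pred k M f : bddC k.+1 M f -> bddC k M f.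
Proof.
elim: k f => [|k IH] f [fM fd]; split=> // i.
by have [g [fg gM]] := fd i; exists g; split => //; exact: IH.
Qed.

Lemma bddC_le k k' M f : (k' <= k)%N -> bddC k M f -> bddC k' M f.
Proof.
move=> /subnKC <-; elim: (k - k')%N => [|n IH]; first by rewrite addn0.
by rewrite addnS => /bddC_pred.
Qed.

Lemma smoothb_isd f i : smoothb f -> exists g, isd i f g.
Proof. by move=> /(_ 1%N)[M [_ /(_ i)[g [fg _]]]]; exists g. Qed.

Lemma smoothb_der f i g : smoothb f -> isd i f g -> smoothb g.
Proof. by move=> sf fg k; have [M /bddC_S/(_ fg)] := sf k.+1; exists M. Qed.

Lemma isd_cst i c : isd i (fun=> c) (fun=> 0).
Proof. by move=> p; exact: derC. Qed.

Lemma isdD i f g f' g' : isd i f f' -> isd i g g' -> isd i (fun x => f x + g x) (fun x => f' x + g' x).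
Proof. by move=> df dg p; exact: derD. Qed.

Lemma isdM i f g f' g' : isd i f f' -> isd i g g' ->
  isd i (fun x => f x * g x) (fun x => f x * g' x + g x * f' x).
Proof. by move=> df dg p; apply: der_eq (derM (df p) (dg p)) _; rewrite sh0. Qed.

Lemma isdZ i f f' c : isd i f f' -> isd i (fun x => c * f x) (fun x => c * f' x).
Proof. by move=> df p; apply: der_eq (derM (derC 0 c) (df p)) _; rewrite mulr0 addr0. Qed.

Lemma isdB i f g f' g' : isd i f f' -> isd i g g' -> isd i (fun x => f x - g x) (fun x => f' x - g' x).
Proof. by move=> df dg p; exact: derB. Qed.

Lemma bddC_cst k c : bddC k `|c| (fun=> c).
Proof.
suff H c' : `|c'| <= `|c| -> bddC k `|c| (fun=> c') by exact: H.
elim: k c' => [|k IH] c' cc; split => // i; exists (fun=> 0); split; first exact: isd_cst.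
by apply: IH; rewrite normr0.
Qed.

Lemma bddCD k M M' f g : bddC k M f -> bddC k M' g -> bddC k (M + M') (fun x => f x + g x).
Proof.
elim: k f g => [|k IH] f g [fM fd] [gM gd]; split=> //;
  try by move=> x; exact: le_trans (ler_normD _ _) (lerD (fM x) (gM x)).
move=> i; have [f' [df f'M]] := fd i; have [g' [dg g'M]] := gd i.
by exists (fun x => f' x + g' x); split; [exact: isdD|exact: IH].
Qed.

Lemma bddCZ k M f c : bddC k M f -> bddC k (`|c| * M) (fun x => c * f x).
Proof.
elim: k f => [|k IH] f [fM fd]; split=> //; try by move=> x; rewrite normrM ler_wpM2l.
move=> i; have [f' [df f'M]] := fd i.
by exists (fun x => c * f' x); split; [exact: isdZ|exact: IH].
Qed.

Lemma bddCB k M M' f g : bddC k M f -> bddC k M' g -> bddC k (M + M') (fun x => f x - g x).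
Proof.
move=> hf hg; have := bddCD hf (bddCZ (- 1) hg).
by rewrite normrN1 mul1r; under eq_fun do rewrite mulN1r.
Qed.

(** Each application of the Leibniz rule doubles the number of terms, whence [2 ^+ k]. *)
Lemma bddCM k M M' f g : bddC k M f -> bddC k M' g ->
  bddC k (2 ^+ k * (M * M')) (fun x => f x * g x).
Proof.
elim: k M M' f g => [|k IH] M M' f g hf hg.
  split=> // x; rewrite expr0 mul1r normrM ler_pM//; [exact: (bddC_bound hf)|exact: (bddC_bound hg)].
have [M0 M'0] := (bddC_ge0 hf, bddC_ge0 hg).
have [[fM fd] [gM gd]] := (hf, hg).
have MM : M * M' <= 2 ^+ k.+1 * (M * M').
  by rewrite ler_peMl ?mulr_ge0// exprn_ege1// ler1n.
split=> [x|i]; first by apply: le_trans MM; rewrite normrM ler_pM.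
have [f' [df f'M]] := fd i; have [g' [dg g'M]] := gd i.
exists (fun x => f x * g' x + g x * f' x); split; first exact: isdM.
rewrite (_ : 2 ^+ k.+1 * _ = 2 ^+ k * (M * M') + 2 ^+ k * (M' * M)); last by rewrite exprS; ring.
by apply: bddCD; apply: IH => //; exact: bddC_pred.
Qed.

Lemma smoothb_cst c : smoothb (fun=> c).
Proof. by move=> k; exists `|c|; exact: bddC_cst. Qed.

Lemma smoothbD f g : smoothb f -> smoothb g -> smoothb (fun x => f x + g x).
Proof. by move=> sf sg k; have [M hf] := sf k; have [M' hg] := sg k; exists (M + M'); exact: bddCD. Qed.

Lemma smoothbZ f c : smoothb f -> smoothb (fun x => c * f x).
Proof. by move=> sf k; have [M hf] := sf k; exists (`|c| * M); exact: bddCZ. Qed.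

Lemma smoothbB f g : smoothb f -> smoothb g -> smoothb (fun x => f x - g x).
Proof. by move=> sf sg k; have [M hf] := sf k; have [M' hg] := sg k; exists (M + M'); exact: bddCB. Qed.

Lemma smoothbM f g : smoothb f -> smoothb g -> smoothb (fun x => f x * g x).
Proof. by move=> sf sg k; have [M hf] := sf k; have [M' hg] := sg k; exists (2 ^+ k * (M * M')); exact: bddCM. Qed.

Lemma mvt_abs (F F' : R -> R) a M : (forall t, is_derive t (1 : R) F (F' t)) ->
  (forall t, `|t| <= `|a| -> `|F' t| <= M) -> `|F a - F 0| <= M * `|a|.
Proof.
move=> dF F'M; have [a0|a0|->] := ltgtP a 0; last by rewrite subrr normr0 mulr0.
- have [c [c1 c2 E]] := @MVT_der R F F' a 0 a0 (fun t _ => dF t).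
  rewrite distrC E sub0r normrM normrN ler_wpM2r// F'M//.
  by rewrite !ltr0_norm ?lerN2 ?ltW.
- have [c [c1 c2 E]] := @MVT_der R F F' 0 a a0 (fun t _ => dF t).
  rewrite E subr0 normrM ler_wpM2r// F'M//.
  by rewrite !gtr0_norm ?ltW.
Qed.

Lemma bddC_lip i M f a p : bddC 1 M f -> `|f (sh i a p) - f p| <= M * `|a|.
Proof.
move=> [_ /(_ i)[g [fg [gM _]]]].
have := @mvt_abs (fun a => f (sh i a p)) (fun a => g (sh i a p)) a M (fun t => isd_at p t fg) (fun t _ => gM _).
by rewrite sh0.
Qed.

Lemma bddC_taylor i M f g a p : bddC 2 M f -> isd i f g ->
  `|f (sh i a p) - f p - a * g p| <= M * a ^+ 2.
Proof.
move=> fM fg; have gM := bddC_S fM fg.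
pose F a := f (sh i a p) - a * g p.
have dF t : is_derive t (1 : R) F (g (sh i t p) - g p).
  apply: der_eq (derB (isd_at p t fg) (derM (derI t) (derC t (g p)))) _; ring.
have := @mvt_abs F _ a (M * `|a|) dF; rewrite /F sh0 mul0r subr0 => H.
rewrite addrAC -[a ^+ 2]real_normK ?num_real// expr2 mulrA; apply: H => t ta.
apply: le_trans (bddC_lip _ _ _ gM) _; rewrite ler_wpM2l//; exact: bddC_ge0 fM.
Qed.

(** * Geometrically convergent sequences in all C^k *)

Section Limits.
Variable r : R.
Hypotheses (r0 : 0 <= r) (r1 : r < 1).
Implicit Types F G : nat -> R * R -> R.

(** The ratio is common to all orders and only the constant depends on [k]; hence the class is
    closed under differentiation. *)
Definition gcauchy F := (forall n, smoothb (F n)) /\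
  forall k, exists C, forall n, bddC k (C * r ^+ n) (fun x => F n.+1 x - F n x).

Definition flim F x : R := limn (fun n => F n x).

Lemma gcauchy_dist F k C : (forall n, bddC k (C * r ^+ n) (fun x => F n.+1 x - F n x)) ->
  forall n m, bddC k (C * r ^+ n / (1 - r)) (fun x => F (n + m)%N x - F n x).
Proof.
move=> H n m; have r1' := r1.
have C0 : 0 <= C by have := bddC_ge0 (H 0%N); rewrite expr0 mulr1.
(* The exact partial sum of the geometric series is kept so that the induction on [m] closes. *)
suff : bddC k (C * r ^+ n * (1 - r ^+ m) / (1 - r)) (fun x => F (n + m)%N x - F n x).
  apply: bddC_mono; rewrite ler_pM2r ?invr_gt0 ?subr_gt0// ler_piMr ?mulr_ge0 ?exprn_ge0//.
  by rewrite gerBl exprn_ge0.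
elim: m => [|m IH].
  rewrite expr0 subrr mulr0 mul0r addn0; have := bddC_cst k 0.
  by rewrite normr0; under [X in _ -> bddC _ _ X]eq_fun do rewrite subrr.
have := bddCD IH (H (n + m)%N).
rewrite addnS; under eq_fun do rewrite addrC addrA subrK.
apply: bddC_mono; rewrite le_eqVlt; apply/orP; left; apply/eqP.
by rewrite exprD exprS; field; lra.
Qed.

Lemma gcauchy_cvg F x : gcauchy F -> (fun n => F n x) @ \oo --> flim F x.
Proof.
move=> [_ /(_ 0%N)[C HC]]; have D := gcauchy_dist HC; have r1' := r1.
have C0 : 0 <= C by have := bddC_ge0 (HC 0%N); rewrite expr0 mulr1.
suff : cvgn (fun n => F n x) by [].
apply/cauchy_cvgP/cauchy_exP => e e0.
have /cvgrPdist_lt/(_ e e0)[n _ hn] := @cvg_geometric R (C / (1 - r)) r ltac:(by rewrite ger0_norm).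
exists (F n x); exists n => // m /= /subnKC <-.
rewrite /ball /= distrC; apply: le_lt_trans (bddC_bound (D n (m - n)%N) x) _.
have := hn n (leqnn n); rewrite /= sub0r normrN ger0_norm; last by rewrite mulr_ge0 ?exprn_ge0 ?divr_ge0// subr_ge0 ltW.
by rewrite mulrAC.
Qed.

Lemma gcauchy_bound F k : gcauchy F -> exists M, forall n, bddC k M (F n).
Proof.
move=> [sF /(_ k)[C HC]]; have D := gcauchy_dist HC 0%N; have [M0 h0] := sF 0%N k.
exists (C * r ^+ 0 / (1 - r) + M0) => n.
by have := bddCD (D n) h0; under eq_fun do rewrite add0n subrK.
Qed.

Lemma gcauchy_der F i : gcauchy F ->
  exists G, gcauchy G /\ forall n, isd i (F n) (G n).
Proof.
move=> [sF cF].
have /choice[G hG] : forall n, exists g, isd i (F n) g by move=> n; exact: smoothb_isd.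
exists G; split=> //; split=> [n|k]; first exact: smoothb_der (sF n) (hG n).
have [C HC] := cF k.+1; exists C => n.
exact: bddC_S (HC n) (isdB (hG n.+1) (hG n)).
Qed.

Lemma flim_isd F G i : gcauchy F -> gcauchy G -> (forall n, isd i (F n) (G n)) ->
  isd i (flim F) (flim G).
Proof.
move=> cF cG FG; have [M hM] := gcauchy_bound 2 cF.
apply: (isd_taylor_intro (C := M)) => p a.
have cv : (fun n => `|F n (sh i a p) - F n p - a * G n p|) @ \oo -->
    `|flim F (sh i a p) - flim F p - a * flim G p|.
  apply: cvg_norm; apply: cvgB; first by apply: cvgB; exact: gcauchy_cvg.
  by apply: cvgM; [exact: cvg_cst|exact: gcauchy_cvg].
apply: (cvgr_to_le cv); apply: nearW => n; exact: bddC_taylor (hM n) (FG n).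
Qed.

Lemma flim_bddC F k M : gcauchy F -> (forall n, bddC k M (F n)) -> bddC k M (flim F).
Proof.
have bF j H : (forall n, bddC j M (H n)) -> gcauchy H -> forall x, `|flim H x| <= M.
  move=> hF cF x.
  have cv : (fun n => `|H n x|) @ \oo --> `|flim H x| by apply: cvg_norm; exact: gcauchy_cvg.
  apply: (cvgr_to_le cv); apply: nearW => n.
  exact: bddC_bound (hF n) x.
elim: k F => [|k IH] F cF hF; split=> //; try exact: bF hF cF.
move=> i; have [G [cG FG]] := gcauchy_der i cF.
exists (flim G); split; first exact: flim_isd.
by apply: IH => // n; exact: bddC_S (hF n) (FG n).
Qed.

Lemma flim_smoothb F : gcauchy F -> smoothb (flim F).
Proof. by move=> cF k; have [M hM] := gcauchy_bound k cF; exists M; exact: flim_bddC. Qed.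

(** The error is the limit in [m] of [F (n + m) - F n], to which [flim_bddC] applies. *)
Lemma flim_dist F k C : gcauchy F ->
  (forall n, bddC k (C * r ^+ n) (fun x => F n.+1 x - F n x)) ->
  forall n, bddC k (C * r ^+ n / (1 - r)) (fun x => flim F x - F n x).
Proof.
move=> cF HC n; have [sF cF'] := cF.
pose G m x := F (n + m)%N x - F n x.
have cG : gcauchy G.
  split=> [m|j]; first exact: smoothbB.
  have [D HD] := cF' j; exists (D * r ^+ n) => m.
  have := HD (n + m)%N; rewrite exprD mulrA.
  by rewrite /G addnS; under [X in _ -> bddC _ _ X]eq_fun do rewrite opprB addrA subrK.
suff <- : flim G = (fun x => flim F x - F n x).
  by apply: flim_bddC => // m; exact: gcauchy_dist.
apply/funext => x; apply/cvg_lim => //; apply: cvgB; last exact: cvg_cst.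
have := @gcauchy_cvg F x cF; rewrite -(cvg_shiftn n); under eq_fun do rewrite addnC.
by [].
Qed.

End Limits.
End BoundedSmooth.

(** * The truncated nonlocal operator *)

Section NonlocalOperator.
Context {R : realType}.
Implicit Types (i j : bool) (a M e eps : R) (p x z : R * R) (f g h : R * R -> R) (k m : nat).

Local Notation mu2 := (@leb2 R).
Local Notation plane := (measurableTypeR R * measurableTypeR R)%type.

(** A Lipschitz function is the supremum of the cones [G q] with vertices over rational points, so
    its superlevel sets are countable unions of measurable sets. *)
Lemma lipschitz_measurable f M : (forall i p a, `|f (sh i a p) - f p| <= M * `|a|) ->
  measurable_fun [set: R * R] f.
Proof.
move=> fM.
pose G (q : rat * rat) x : R := f (ratr q.1, ratr q.2) - M * `|x.1 - ratr q.1| - M * `|x.2 - ratr q.2|.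
have Glip x y : `|f x - f y| <= M * `|x.1 - y.1| + M * `|x.2 - y.2|.
  have h1 := fM true y (x.1 - y.1); have h2 := fM false (sh true (x.1 - y.1) y) (x.2 - y.2).
  have E : sh false (x.2 - y.2) (sh true (x.1 - y.1) y) = x.
    by rewrite /sh /=; case: x {h1 h2} => x1 x2 /=; congr pair; ring.
  rewrite E in h2.
  rewrite (_ : f x - f y = (f x - f (sh true (x.1 - y.1) y)) + (f (sh true (x.1 - y.1) y) - f y)); last by ring.
  by apply: (le_trans (ler_normD _ _)); rewrite addrC lerD.
apply: (measurability _ (RGenOInfty.measurableE R)) => _ [_ [c ->] <-]; rewrite setTI.
have -> : f @^-1` `]c, +oo[ = \bigcup_(q1 in [set: rat]) \bigcup_(q2 in [set: rat]) (G (q1, q2) @^-1` `]c, +oo[).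
  apply/seteqP; split => x /=; rewrite in_itv /= andbT.
    (* With this [d] each of the four error terms, two from the Lipschitz bound and two from the
       cone, is at most [(f x - c) / 8], and the cone still exceeds [c] at [x]. *)
    move=> cx; pose d := (f x - c) / (8 * (`|M| + 1)).
    have M1 : 0 < `|M| + 1 by rewrite ltr_wpDl.
    have d0 : 0 < d by rewrite divr_gt0 ?subr_gt0 ?mulr_gt0.
    have ex (y : R) : exists q : rat, `|y - ratr q| <= d.
      have [|q] := @rat_in_itvoo R (y - d) (y + d); first by lra.
      by rewrite in_itv /= => hq; exists q; rewrite ler_norml; lra.
    have [q1 h1] := ex x.1; have [q2 h2] := ex x.2.
    exists q1 => //; exists q2 => //=; rewrite in_itv /= andbT /G /=.
    have := Glip x (ratr q1, ratr q2); rewrite ler_norml => /andP[_] /=.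
    have dE : d * (`|M| + 1) = (f x - c) / 8 by rewrite /d; field; lra.
    have MM (y : R) : 0 <= y -> y <= d -> M * y <= (f x - c) / 8.
      move=> y0 yd; rewrite -dE.
      have : M * y <= `|M| * y by rewrite ler_wpM2r// ler_norm.
      have : `|M| * y <= `|M| * d by rewrite ler_wpM2l.
      by lra.
    have := MM _ (normr_ge0 _) h1; have := MM _ (normr_ge0 _) h2; lra.
  move=> [q1 _ [q2 _ /=]]; rewrite in_itv /= andbT /G /=.
  have := Glip x (ratr q1, ratr q2); rewrite ler_norml => /andP[+ _] /=; lra.
apply: bigcupT_measurable_rat => q1; apply: bigcupT_measurable_rat => q2.
have mc (y : R * R -> R) c' : measurable_fun [set: R * R] y ->
    measurable_fun [set: R * R] (fun x : R * R => M * `|y x - c'|).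
  by move=> my; apply: measurable_funM => //; apply: measurableT_comp => //; exact: measurable_funB.
have mG : measurable_fun [set: R * R] (G (q1, q2)).
  by apply: measurable_funB; [apply: measurable_funB => //; exact: mc|exact: mc].
by rewrite -[X in measurable X]setTI; exact: mG.
Qed.

Lemma smoothb_measurable f : smoothb f -> measurable_fun [set: R * R] f.
Proof. by move=> /(_ 1%N)[M hM]; apply: (@lipschitz_measurable f M) => i p a; exact: bddC_lip. Qed.

Lemma shift2_sh i a x z : shift2 (sh i a x) z = sh i a (shift2 x z).
Proof. by case: i; rewrite /shift2 /sh /= addrA. Qed.

Lemma shift2E x z : shift2 x z = sh true z.1 (sh false z.2 x).
Proof. by rewrite /shift2 /sh /= (addrC z.1) (addrC z.2). Qed.

Lemma measurable_comp_shift2 f x D : measurable_fun [set: R * R] f ->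
  measurable_fun D (fun z => f (shift2 x z)).
Proof. by move=> mf; apply: measurable_funTS; apply: (measurableT_comp mf); exact: measurable_shift2. Qed.

Section Kernel.
Variable s : R.
Hypotheses (s0 : 0 < s) (s1 : s < 1).

Definition far eps : set (R * R) := [set z | eps < enorm z].

Lemma integrable_bounded_kern h M eps D : 0 < eps -> measurable D -> D `<=` far eps ->
  measurable_fun D h ->
  (forall z, `|h z| <= M) -> mu2.-integrable D (EFin \o (fun z => h z * kern s z)).
Proof.
move=> e0 mD De mh hM.
have ik : mu2.-integrable D (EFin \o kern s).
  have mf : measurable (far eps) by exact: measurable_enorm_gt.
  exact: (integrableS (mf : measurable (far eps : set plane)) (mD : measurable (D : set plane)) De
    (integrable_kern s0 e0)).
have mh' : measurable_fun D (fun z => h z * kern s z) by apply: measurable_funM => //; exact: measurable_kern.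
apply: (@le_integrable _ plane R mu2 D mD _ _ _ _ (integrable_leb2Z M mD ik)).
  exact/measurable_EFinP.
move=> z _; rewrite /= lee_fin !normrM; apply: ler_wpM2r => //.
exact: le_trans (hM z) (ler_norm _).
Qed.

Definition kern_mass eps : R := Rintegral mu2 (far eps) (kern s).
Definition kern_avg eps f x : R := Rintegral mu2 (far eps) (fun z => f (shift2 x z) * kern s z).

Lemma kern_mass_ge0 eps : 0 <= kern_mass eps.
Proof. by apply: Rintegral_ge0 => z _; exact: kern_ge0. Qed.

Lemma kern_mass_le eps : 0 < eps -> kern_mass eps <= far_const s * eps `^ (- (2 * s)).
Proof.
by move=> e0; apply: Rintegral_le_of_integral (integral_kern_far s0 e0) => z _; exact: kern_ge0.
Qed.

Lemma integrable_avg f M eps x : 0 < eps -> measurable_fun [set: R * R] f -> (forall y, `|f y| <= M) ->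
  mu2.-integrable (far eps) (EFin \o (fun z => f (shift2 x z) * kern s z)).
Proof.
move=> e0 mf fM; apply: (integrable_bounded_kern (M := M) e0) => //; first exact: measurable_enorm_gt.
exact: measurable_comp_shift2.
Qed.

Lemma Rintegral_kern_abs h M eps : 0 < eps -> measurable_fun (far eps) h ->
  (forall z, `|h z| <= M) ->
  `|Rintegral mu2 (far eps) (fun z => h z * kern s z)| <= M * kern_mass eps.
Proof.
move=> e0 mh hM; have mD : measurable (far eps) by exact: measurable_enorm_gt.
have ih := integrable_bounded_kern e0 mD (@subset_refl _ _) mh hM.
apply: (le_trans (le_normr_Rintegral _ ih)) => //.
rewrite /kern_mass -RintegralZl//; last exact: integrable_kern.
apply: le_Rintegral => //.
- exact: integrable_abse ih.
- by apply: integrable_leb2Z => //; exact: integrable_kern.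
- by move=> z _; rewrite normrM (ger0_norm (kern_ge0 _ _)) ler_wpM2r ?kern_ge0.
Qed.

Lemma kern_avg_abs f M eps x : 0 < eps -> measurable_fun [set: R * R] f -> (forall y, `|f y| <= M) ->
  `|kern_avg eps f x| <= M * kern_mass eps.
Proof. by move=> e0 mf fM; apply: Rintegral_kern_abs => //; exact: measurable_comp_shift2. Qed.

(** Through [isd] this also asserts that [T f] is differentiable. *)
Definition commutes (T : (R * R -> R) -> R * R -> R) := forall i f g,
  smoothb f -> isd i f g -> isd i (T f) (T g).

(** Since derivatives pass through [T], one sup-norm estimate yields the C^k estimates for all [k]
    with the same constant. *)
Lemma commutes_bddC T m e : commutes T ->
  (forall f M, smoothb f -> bddC m M f -> forall x, `|T f x| <= e * M) ->
  forall k f M, smoothb f -> bddC (k + m) M f -> bddC k (e * M) (T f).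
Proof.
move=> cT bT; elim=> [|k IH] f M sf fM; first by split=> // x; exact: bT sf fM x.
split=> [x|i]; first by apply: (bT _ _ sf); apply: bddC_le fM; rewrite leq_addl.
have [g fg] := smoothb_isd i sf.
exists (T g); split; first exact: cT.
by apply: IH; [exact: smoothb_der fg|exact: bddC_S fM fg].
Qed.

Lemma commutes_smoothb T m e : commutes T ->
  (forall f M, smoothb f -> bddC m M f -> forall x, `|T f x| <= e * M) ->
  forall f, smoothb f -> smoothb (T f).
Proof.
by move=> cT bT f sf k; have [M hM] := sf (k + m)%N; exists (e * M); exact: commutes_bddC hM.
Qed.

(** Subtraction under the integral leaves the Taylor remainder of [f], at most [M a^2], against a
    kernel of finite mass. *)
Lemma kern_avg_commutes eps : 0 < eps -> commutes (kern_avg eps).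
Proof.
move=> e0 i f g sf fg; have sg := smoothb_der sf fg.
have [mf mg] := (smoothb_measurable sf, smoothb_measurable sg).
have [M fM] := sf 2%N; have [M' gM] := sg 0%N.
apply: (isd_taylor_intro (C := M * kern_mass eps)) => p a.
have mD : measurable (far eps) by exact: measurable_enorm_gt.
have if1 := integrable_avg (sh i a p) e0 mf (bddC_bound fM).
have if2 := integrable_avg p e0 mf (bddC_bound fM).
have ig := integrable_avg p e0 mg (bddC_bound gM).
rewrite /kern_avg -RintegralZl// -RintegralB// -RintegralB//; last 2 first.
  exact: integrableB if1 if2.
  exact: integrable_leb2Z.
rewrite mulrAC.
under eq_Rintegral do rewrite mulrA -!mulrBl.
apply: Rintegral_kern_abs => //.
  apply: measurable_funB; first by apply: measurable_funB; exact: measurable_comp_shift2.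
  by apply: measurable_funM => //; exact: measurable_comp_shift2.
by move=> z; rewrite shift2_sh; exact: bddC_taylor.
Qed.

Lemma measurable_pv_fun f x eps : measurable_fun [set: R * R] f ->
  measurable_fun [set y | eps < Defs.edist x y]
    (fun y => (f x - f y) / Defs.edist x y `^ (2 + 2 * s)).
Proof.
move=> mf; apply: measurable_funTS; apply: measurable_funM; first exact: measurable_funB.
have -> : (fun y => (Defs.edist x y `^ (2 + 2 * s))^-1) = (fun y => kern s (shift2 (opp2 x) y)).
  apply/funext => y; rewrite /kern powRN; congr (_ `^ _)^-1.
  by rewrite /Defs.edist /enorm /shift2 /=; congr Num.sqrt; ring.
exact: (measurableT_comp (@measurable_kern R s setT) (measurable_shift2 (opp2 x))).
Qed.

Lemma pv_trunc_smoothb f x eps : 0 < eps -> smoothb f ->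
  pv_trunc s f x eps = kern_mass eps * f x - kern_avg eps f x.
Proof.
move=> e0 sf; have mf := smoothb_measurable sf; have [M fM] := sf 0%N.
have mD : measurable (far eps) by exact: measurable_enorm_gt.
have if1 := integrable_avg x e0 mf (bddC_bound fM).
rewrite pv_trunc_shift.
  rewrite /kern_mass mulrC -RintegralZl//; last exact: integrable_kern.
  rewrite -RintegralB//; last by apply: integrable_leb2Z => //; exact: integrable_kern.
  by apply: eq_Rintegral => z _; rewrite /pv_fun mulrBl.
exact: measurable_pv_fun.
Qed.

Lemma integrable_pv_smoothb f x eps : 0 < eps -> smoothb f ->
  mu2.-integrable (far eps) (EFin \o pv_fun s f x).
Proof.
move=> e0 sf; have mf := smoothb_measurable sf; have [M fM] := sf 0%N.
apply: (integrable_bounded_kern (M := `|f x| + M) e0) => //.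
- exact: measurable_enorm_gt.
- by apply: measurable_funB => //; exact: measurable_comp_shift2.
- by move=> z; apply: (le_trans (ler_normB _ _)); rewrite lerD2l; exact: bddC_bound fM _.
Qed.

(** The linear parts of the expansions at [z] and [- z] cancel. Each expansion moves along the
    second axis and then the first; the variation of [g1] in between gives the cross term. *)
Lemma second_difference_le f M x z : smoothb f -> bddC 2 M f ->
  `|2 * f x - f (shift2 x z) - f (shift2 x (opp2 z))| <= 4 * M * enorm z ^+ 2.
Proof.
move=> sf fM.
have [g1 fg1] := smoothb_isd true sf; have [g2 fg2] := smoothb_isd false sf.
have M0 := bddC_ge0 fM.
have g1M := bddC_S fM fg1.
have key w : `|f (shift2 x w) - f x - w.1 * g1 x - w.2 * g2 x| <= 2 * M * enorm w ^+ 2.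
  rewrite shift2E enorm_sqr; set y := sh false w.2 x.
  have h1 := bddC_taylor w.1 y fM fg1; have h2 := bddC_taylor w.2 x fM fg2.
  have h3 := bddC_lip false w.2 x g1M; rewrite -/y in h2 h3.
  have h4 : `|w.1 * (g1 y - g1 x)| <= M * (w.1 ^+ 2 + w.2 ^+ 2).
    rewrite normrM -[w.1 ^+ 2]real_normK ?num_real// -[w.2 ^+ 2]real_normK ?num_real//.
    apply: (@le_trans _ _ (`|w.1| * (M * `|w.2|))); first by rewrite ler_wpM2l.
    rewrite mulrCA ler_wpM2l//; set a := `|w.1|; set b := `|w.2|.
    by have := sqr_ge0 (a - b); have := sqr_ge0 a; have := sqr_ge0 b; rewrite sqrrB mulr2n; lra.
  rewrite (_ : f _ - f x - _ - _ = (f (sh true w.1 y) - f y - w.1 * g1 y) + w.1 * (g1 y - g1 x)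
     + (f y - f x - w.2 * g2 x)); last by ring.
  apply: (le_trans (ler_normD _ _)).
  apply: (le_trans (lerD (le_trans (ler_normD _ _) (lerD h1 h4)) h2)); lra.
have k1 := key z; have k2 := key (opp2 z); rewrite enorm_opp /= in k2.
rewrite (_ : _ - _ - _ = - ((f (shift2 x z) - f x - z.1 * g1 x - z.2 * g2 x)
   + (f (shift2 x (opp2 z)) - f x - - z.1 * g1 x - - z.2 * g2 x))); last by ring.
by rewrite normrN; apply: (le_trans (ler_normD _ _)); move: k1 k2; lra.
Qed.

Definition annulus e eps : set (R * R) := [set z | e < enorm z /\ enorm z <= eps].

Lemma measurable_annulus e eps : measurable (annulus e eps).
Proof.
rewrite (_ : annulus e eps = far e `&` [set z | enorm z <= eps])//.
by apply: measurableI; [exact: measurable_enorm_gt|exact: measurable_enorm_le].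
Qed.

Lemma annulus_le g (H : R) e eps : 0 <= H -> 0 < e -> 0 < eps ->
  mu2.-integrable (annulus e eps) (EFin \o g) ->
  (forall z, annulus e eps z -> g z + g (opp2 z) <= 2 * (H * enorm z `^ (- (2 * s)))) ->
  Rintegral mu2 (annulus e eps) g <= H * (near_const s * eps `^ (2 - 2 * s)).
Proof.
move=> H0 e0 eps0 ig gH.
have mA := measurable_annulus e eps.
apply: (Rintegral_symmetric_le (b := fun z => H * enorm z `^ (- (2 * s)))) => //.
- by move=> z; rewrite /annulus /= enorm_opp.
- by apply: measurable_funM => //; exact: measurable_enorm_powR.
- by move=> z _; rewrite mulr_ge0 ?powR_ge0.
under eq_integral do rewrite EFinM.
rewrite ge0_integralZl ?lee_fin//; last 2 first.
- by apply/measurable_EFinP; exact: measurable_enorm_powR.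
- by move=> z _; rewrite lee_fin powR_ge0.
rewrite EFinM lee_wpmul2l ?lee_fin//; apply: le_trans (integral_kern_near s0 s1 eps0).
apply: ge0_subset_integral => //.
- exact: measurable_enorm_le.
- by apply/measurable_EFinP; exact: measurable_enorm_powR.
- by move=> z _; rewrite lee_fin powR_ge0.
- by move=> z [].
Qed.

Lemma pv_trunc_annulus f x e eps : 0 < e -> e <= eps -> smoothb f ->
  pv_trunc s f x e = pv_trunc s f x eps + Rintegral mu2 (annulus e eps) (pv_fun s f x).
Proof.
move=> e0 ee sf; have eps0 : 0 < eps by lra.
have mf := smoothb_measurable sf.
rewrite !pv_trunc_shift; try exact: measurable_pv_fun.
have E : far e = far eps `|` annulus e eps.
  apply/seteqP; split => z; rewrite /far /annulus /=.
    by move=> ez; have [h|h] := leP (enorm z) eps; [right|left].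
  by move=> [|[]//]; exact: le_lt_trans.
rewrite -/(far e) -/(far eps) E Rintegral_setU//.
- exact: measurable_enorm_gt.
- exact: measurable_annulus.
- by rewrite -E; exact: integrable_pv_smoothb.
- by apply/disj_setPS => z [] /=; rewrite /far /annulus /= => h [_]; rewrite leNgt h.
Qed.

(** Two truncations differ by an integral over an annulus, where symmetrisation leaves second
    differences. The power [eps^(2 - 2 s)] gives both the existence of the principal value and the
    consistency order of the scheme. *)
Lemma pv_trunc_dist f M x e eps : 0 < e -> e <= eps -> smoothb f -> bddC 2 M f ->
  `|pv_trunc s f x e - pv_trunc s f x eps| <= 2 * M * (near_const s * eps `^ (2 - 2 * s)).
Proof.
move=> e0 ee sf fM; have eps0 : 0 < eps by lra.
have M0 := bddC_ge0 fM.
rewrite (pv_trunc_annulus x e0 ee sf) addrC addKr.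
have iA : mu2.-integrable (annulus e eps) (EFin \o pv_fun s f x).
  have mD : measurable (far e) by exact: measurable_enorm_gt.
  have De : annulus e eps `<=` far e by move=> z [].
  exact: (integrableS (mD : measurable (far e : set plane))
    (measurable_annulus e eps : measurable (annulus e eps : set plane)) De (integrable_pv_smoothb x e0 sf)).
have bound z : annulus e eps z ->
    `|pv_fun s f x z + pv_fun s f x (opp2 z)| <= 2 * (2 * M * enorm z `^ (- (2 * s))).
  move=> [ez _]; have z0 : 0 < enorm z by lra.
  rewrite /pv_fun kern_opp -mulrDl normrM (ger0_norm (kern_ge0 _ _)) -(kern_sqr s z0).
  have H := second_difference_le x z sf fM.
  rewrite (_ : 2 * (2 * M * _) = 4 * M * enorm z ^+ 2 * kern s z); last by ring.
  apply: ler_wpM2r; first exact: kern_ge0.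
  by rewrite (_ : _ + _ = 2 * f x - f (shift2 x z) - f (shift2 x (opp2 z))); last by ring.
rewrite ler_norml; apply/andP; split; last first.
  apply: annulus_le => //; first by rewrite mulr_ge0.
  by move=> z /bound; rewrite ler_norml => /andP[].
rewrite lerNl.
have -> : - Rintegral mu2 (annulus e eps) (pv_fun s f x) = Rintegral mu2 (annulus e eps) (fun z => -1 * pv_fun s f x z).
  by rewrite RintegralZl ?mulN1r//; exact: measurable_annulus.
apply: annulus_le => //; first by rewrite mulr_ge0.
  by apply: integrable_leb2Z => //; exact: measurable_annulus.
by move=> z /bound; rewrite ler_norml => /andP[]; lra.
Qed.

Lemma powR_cvg0_nbhs a e : 0 < a -> 0 < e -> exists2 d, 0 < d & forall t, 0 < t -> t <= d -> t `^ a <= e.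
Proof.
move=> a0 e0; exists (e `^ a^-1); first by rewrite powR_gt0.
move=> t t0 td; apply: (@le_trans _ _ ((e `^ a^-1) `^ a)).
  by apply: ge0_ler_powR; rewrite ?nnegrE ?powR_ge0 // ltW.
by rewrite -powRrM mulVf ?gt_eqF// powRr1// ltW.
Qed.

Lemma pv_trunc_cvg f x : smoothb f -> cvg (pv_trunc s f x @ 0^'+).
Proof.
move=> sf; have [M fM] := sf 2%N; have M0 := bddC_ge0 fM.
have n0 := near_const_ge0 s1.
apply/cauchy_cvgP/cauchy_exP => e e0.
have s2 : 0 < 2 - 2 * s by move: (s1); lra.
pose A := 2 * M * near_const s.
have A0 : 0 <= A by exact: mulr_ge0 (mulr_ge0 (ler0n _ 2) M0) n0.
have e2 : 0 < e / 2 / (A + 1) by rewrite !divr_gt0// ltr_wpDl.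
have [d d0 hd] := powR_cvg0_nbhs s2 e2.
exists (pv_trunc s f x d).
suff : \forall t \near (0 : R)^'+, ball (pv_trunc s f x d) e (pv_trunc s f x t) by [].
near=> t.
have t0 : 0 < t by near: t; exact: nbhs_right_gt.
have td : t <= d by near: t; exact: nbhs_right_le.
rewrite /ball /= distrC; apply: le_lt_trans (pv_trunc_dist x t0 td sf fM) _.
have := hd d d0 (lexx d); set y := _ `^ _ => yd.
have y0 : 0 <= y := powR_ge0 _ _.
rewrite (_ : 2 * M * (near_const s * y) = A * y); last by rewrite /A; ring.
move: yd; rewrite ler_pdivlMr ?ltr_wpDl//; lra.
Unshelve. all: by end_near. Qed.

Lemma fraclap_dist f M x eps : 0 < eps -> smoothb f -> bddC 2 M f ->
  `|fraclap s f x - frac_const s * pv_trunc s f x eps| <= frac_const s * (2 * M * (near_const s * eps `^ (2 - 2 * s))).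
Proof.
move=> e0 sf fM; rewrite /fraclap -mulrBr normrM (ger0_norm (frac_const_ge0 s)) ler_wpM2l ?frac_const_ge0//.
have cv := pv_trunc_cvg (x := x) sf.
have cv' : (fun e => `|pv_trunc s f x e - pv_trunc s f x eps|) @ 0^'+ -->
   `|lim (pv_trunc s f x @ 0^'+) - pv_trunc s f x eps|.
  by apply: cvg_norm; apply: cvgB => //; exact: cvg_cst.
apply: (cvgr_to_le cv'); near=> e; apply: pv_trunc_dist => //.
by near: e; apply: nbhs_right_le.
Unshelve. all: by end_near. Qed.

Lemma fraclap_defined_smoothb f x : smoothb f -> fraclap_defined s f x.
Proof.
move=> sf; split; last exact: pv_trunc_cvg.
move=> eps e0; apply: integrable_pv_unshift; last exact: integrable_pv_smoothb.
by apply: measurable_pv_fun; exact: smoothb_measurable.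
Qed.

End Kernel.
End NonlocalOperator.

(** * Limits of Euler schemes *)

Section Semigroup.
Context {R : realType}.
Implicit Types (i : bool) (a M C t : R) (x : R * R) (f g : R * R -> R) (k n m j : nat).

(** Derivatives are unique, so the witnesses obtained for different [e] coincide. *)
Lemma bddC_inf k M f : (forall e, 0 < e -> bddC k (M + e) f) -> bddC k M f.
Proof.
elim: k f => [|k IH] f H; split=> //; try by move=> x; apply/ler_addgt0Pr => e /H /bddC_bound.
move=> i; have [g [fg _]] : exists g, isd i f g /\ bddC k (M + 1) g by case: (H 1 ltr01) => _.
by exists g; split=> //; apply: IH => e /H /bddC_S /(_ fg).
Qed.

Lemma bddC_ext k M f g : f =1 g -> bddC k M f -> bddC k M g.
Proof. by move=> /funext ->. Qed.

Lemma bddC_zero k f : (forall x, f x = 0) -> bddC k 0 f.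
Proof.
move=> f0; have := @bddC_cst R k 0; rewrite normr0; apply: bddC_ext => x; exact/esym/f0.
Qed.

Lemma geometric_cvg0 (r c : R) (v : nat -> R) : 0 <= r -> r < 1 ->
  (forall n, `|v n| <= c * r ^+ n) -> v @ \oo --> 0.
Proof.
move=> r0 r1 vb; apply/norm_cvg0P.
have cg := @cvg_geometric R c r ltac:(by rewrite ger0_norm ?r1 ?r0).
apply: (squeeze_cvgr _ (cvg_cst (0 : R)) cg).
by apply: nearW => n; rewrite normr_ge0 vb.
Qed.

Variables (L : nat -> (R * R -> R) -> R * R -> R) (h0 r : R).

(** Parabolic refinement: one step at level [n] lasts as long as four steps at level [n.+1]. *)
Definition stp n : R := h0 * 4^-1 ^+ n.
Definition euler n f x : R := f x + stp n * L n f x.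
Definition generator f : R * R -> R := flim (fun n => L n f).
Definition steps n t : nat := Num.truncn (t / stp n).
Definition approx n t f := iter (steps n t) (euler n) f.
Definition semigroup t f : R * R -> R := flim (fun n => approx n t f).

Hypotheses (h00 : 0 < h0) (r14 : 4^-1 <= r) (r1 : r < 1).
Hypothesis L_smooth : forall n f, smoothb f -> smoothb (L n f).
Hypothesis L_lin : forall n f g a, smoothb f -> smoothb g ->
  L n (fun x => a * f x + g x) = (fun x => a * L n f x + L n g x).
Hypothesis L_stable0 : forall n f M, smoothb f -> bddC 0 M f -> bddC 0 M (euler n f).
Hypothesis L_stable : forall k, exists2 C, 0 <= C & forall n f M, smoothb f -> bddC k M f ->
  bddC k ((1 + C * stp n) * M) (euler n f).
Hypothesis L_bounded : forall k, exists2 C, 0 <= C & forall n f M, smoothb f -> bddC k.+2 M f ->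
  bddC k (C * M) (L n f).
Hypothesis L_cauchy : forall k, exists2 C, 0 <= C & forall n f M, smoothb f -> bddC k.+2 M f ->
  bddC k (C * M * r ^+ n) (fun x => L n.+1 f x - L n f x).

Let r0 : 0 <= r. Proof. by move: (r14); lra. Qed.

Lemma stp_gt0 n : 0 < stp n.
Proof. by rewrite mulr_gt0 ?exprn_gt0 ?invr_gt0. Qed.

Lemma stpS n : stp n = 4 * stp n.+1.
Proof. by rewrite /stp exprS; field. Qed.

(** First-order errors in time are thus of the same order [r^n] as the change of operator between
    consecutive levels. *)
Lemma stp_le n : stp n <= h0 * r ^+ n.
Proof. by rewrite ler_pM2l// lerXn2r// nnegrE ?invr_ge0. Qed.

Lemma euler_smooth n f : smoothb f -> smoothb (euler n f).
Proof. by move=> sf; apply: smoothbD => //; apply: smoothbZ; exact: L_smooth. Qed.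

Lemma iter_smooth n j f : smoothb f -> smoothb (iter j (euler n) f).
Proof. by move=> sf; elim: j => //= j; exact: euler_smooth. Qed.

Lemma L_sub n f g : smoothb f -> smoothb g ->
  L n (fun x => f x - g x) = (fun x => L n f x - L n g x).
Proof.
move=> sf sg; have := L_lin n (-1) sg sf.
under eq_fun do rewrite mulN1r addrC.
by under [X in _ = X -> _]eq_fun do rewrite mulN1r addrC.
Qed.

Lemma euler_lin n f g a : smoothb f -> smoothb g ->
  euler n (fun x => a * f x + g x) = (fun x => a * euler n f x + euler n g x).
Proof. by move=> sf sg; apply/funext => x; rewrite /euler L_lin//; ring. Qed.

Lemma iter_lin n j f g a : smoothb f -> smoothb g ->
  iter j (euler n) (fun x => a * f x + g x) = (fun x => a * iter j (euler n) f x + iter j (euler n) g x).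
Proof. by move=> sf sg; elim: j => //= j ->; rewrite euler_lin//; exact: iter_smooth. Qed.

Lemma iter_sub n j f g : smoothb f -> smoothb g ->
  iter j (euler n) (fun x => f x - g x) = (fun x => iter j (euler n) f x - iter j (euler n) g x).
Proof.
move=> sf sg; have := iter_lin n j (-1) sg sf.
under eq_fun do rewrite mulN1r addrC.
by under [X in _ = X -> _]eq_fun do rewrite mulN1r addrC.
Qed.

Lemma iter_L n j f : smoothb f -> L n (iter j (euler n) f) = iter j (euler n) (L n f).
Proof.
move=> sf; elim: j => //= j <-; set g := iter j _ _.
have sg : smoothb g by exact: iter_smooth.
rewrite /euler; have := L_lin n (stp n) (L_smooth n sg) sg.
under eq_fun do rewrite addrC.
by move=> ->; apply/funext => x; rewrite addrC.
Qed.

Lemma iter_stable0 n j f M : smoothb f -> bddC 0 M f -> bddC 0 M (iter j (euler n) f).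
Proof. by move=> sf fM; elim: j => //= j; apply: L_stable0; exact: iter_smooth. Qed.

(** The growth factors multiply to at most [exp (C |T|)], whatever the level. *)
Lemma iter_stable k T : exists2 E, 1 <= E & forall n j f M, j%:R * stp n <= T ->
  smoothb f -> bddC k M f -> bddC k (E * M) (iter j (euler n) f).
Proof.
have [C C0 HC] := L_stable k.
exists (expR (C * `|T|)); first by rewrite -expR0 ler_expR mulr_ge0.
move=> n j f M jT sf fM; have M0 := bddC_ge0 fM.
have H : bddC k ((1 + C * stp n) ^+ j * M) (iter j (euler n) f).
  elim: j {jT} => [|j IH] /=; first by rewrite expr0 mul1r.
  by rewrite exprS -mulrA; apply: HC => //; exact: iter_smooth.
apply: bddC_mono H; rewrite ler_wpM2r//.
apply: (@le_trans _ _ (expR (C * stp n) ^+ j)).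
  have Cst : 0 <= C * stp n by exact: mulr_ge0 C0 (ltW (stp_gt0 n)).
  by rewrite lerXn2r ?nnegrE ?expR_ge0 ?expR_ge1Dx//; lra.
rewrite -expRM_natl ler_expR mulrCA ler_wpM2l// (le_trans jT)//; exact: ler_norm.
Qed.

Lemma iter_increment k T : exists2 C, 0 <= C & forall n j f M, j%:R * stp n <= T ->
  smoothb f -> bddC k.+2 M f ->
  bddC k (C * M * (j%:R * stp n)) (fun x => iter j (euler n) f x - f x).
Proof.
have [E E1 HE] := iter_stable k.+2 T; have [A A0 HA] := L_bounded k.
exists (A * E) => [|n j f M jT sf fM]; first by rewrite mulr_ge0//; lra.
elim: j jT => [|j IH] jT /=.
  rewrite mul0r mulr0; by apply: bddC_zero => x; rewrite subrr.
have jT' : j%:R * stp n <= T.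
  by apply: le_trans jT; rewrite ler_wpM2r ?(ltW (stp_gt0 n))// ler_nat.
have sj := iter_smooth n j sf.
have := bddCD (IH jT') (bddCZ (stp n) (HA n _ _ sj (HE n j f M jT' sf fM))).
rewrite (gtr0_norm (stp_gt0 n)) -natr1 (_ : _ + _ = A * E * M * ((j%:R + 1) * stp n)); last by ring.
by apply: bddC_ext => x; rewrite /euler /=; ring.
Qed.

(** The next step changes the remainder by [stp n] times [L n] of the increment accumulated so far,
    which is of the order of the elapsed time; summation gives the square. Two uses of the operator
    cost four derivatives. *)
Lemma iter_second_order k T : exists2 C, 0 <= C & forall n j f M, j%:R * stp n <= T ->
  smoothb f -> bddC k.+4 M f ->
  bddC k (C * M * (j%:R * stp n) ^+ 2) (fun x => iter j (euler n) f x - f x - j%:R * stp n * L n f x).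
Proof.
have [E E0 HE] := iter_increment k.+2 T; have [A A0 HA] := L_bounded k.
exists (A * E) => [|n j f M jT sf fM]; first by rewrite mulr_ge0.
have st := stp_gt0 n; have M0 := bddC_ge0 fM.
elim: j jT => [|j IH] jT /=.
  rewrite !mul0r expr0n mulr0; by apply: bddC_zero => x; rewrite subrr mul0r subr0.
have jT' : j%:R * stp n <= T.
  by apply: le_trans jT; rewrite ler_wpM2r ?(ltW (stp_gt0 n))// ler_nat.
have sj := iter_smooth n j sf.
have := bddCD (IH jT') (bddCZ (stp n) (HA n _ _ (smoothbB sj sf) (HE n j f M jT' sf fM))).
rewrite (gtr0_norm st) L_sub// => H.
apply: bddC_ext (bddC_mono _ H) => [x|]; first by rewrite /euler /= -natr1; ring.
rewrite -natr1; set J := j%:R; have J0 : 0 <= J by rewrite ler0n.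
rewrite (_ : _ + _ = A * E * M * ((J * stp n) ^+ 2 + J * stp n * stp n)); last by ring.
rewrite ler_wpM2l ?mulr_ge0//.
have : 0 <= J * stp n * stp n + stp n ^+ 2 by exact: addr_ge0 (mulr_ge0 (mulr_ge0 J0 (ltW st)) (ltW st)) (sqr_ge0 _).
rewrite (_ : ((J + 1) * stp n) ^+ 2 = (J * stp n) ^+ 2 + J * stp n * stp n + (J * stp n * stp n + stp n ^+ 2)); last by ring.
by lra.
Qed.

(** Local error of one coarse step: the second-order remainder of the four fine steps is of order
    [stp n ^+ 2], hence of order [stp n * r ^+ n] by [stp_le], and so is the effect of changing the
    operator. *)
Lemma iter4_consistent k : exists2 C, 0 <= C & forall n f M, smoothb f -> bddC k.+4 M f ->
  bddC k (C * M * stp n * r ^+ n) (fun x => iter 4 (euler n.+1) f x - euler n f x).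
Proof.
have [C2 C20 H2] := iter_second_order k h0; have [A A0 HA] := L_cauchy k.
exists (C2 * h0 + A) => [|n f M sf fM]; first by rewrite addr_ge0 ?mulr_ge0// ltW.
have st := stp_gt0 n; have M0 := bddC_ge0 fM.
have n4 : 4%:R * stp n.+1 = stp n by rewrite -stpS.
have rn0 : 0 <= r ^+ n by rewrite exprn_ge0.
have rn1 : r ^+ n <= 1 by rewrite exprn_ile1// ltW.
have sh0' : stp n <= h0 by apply: (le_trans (stp_le n)); rewrite ler_piMr// ltW.
have h2 := H2 n.+1 4%N f M (_ : 4%:R * stp n.+1 <= h0) sf fM; rewrite n4 in h2.
have := bddCD (h2 sh0') (bddCZ (stp n) (HA n f M sf (bddC_pred (bddC_pred fM)))).
rewrite (gtr0_norm st) => H; apply: bddC_ext (bddC_mono _ H) => [x|].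
  by rewrite /euler; ring.
rewrite (_ : (C2 * h0 + A) * M * stp n * r ^+ n = C2 * M * (stp n * (h0 * r ^+ n)) + stp n * (A * M * r ^+ n)); last by ring.
rewrite lerD2r ler_wpM2l ?mulr_ge0// expr2 ler_pM2l//; exact: stp_le.
Qed.

(** Consistency and stability: each local error is carried forward by the stable coarse scheme, and
    the [j] errors add up to the elapsed time multiplied by [r ^+ n]. *)
Lemma iter_compare k T : exists2 C, 0 <= C & forall n j f M, j%:R * stp n <= T ->
  smoothb f -> bddC k.+4 M f ->
  bddC k (C * M * r ^+ n) (fun x => iter (4 * j) (euler n.+1) f x - iter j (euler n) f x).
Proof.
have [C C0 HC] := L_stable k; have [Q Q0 HQ] := iter4_consistent k.
have [E E1 HE] := iter_stable k.+4 T.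
exists (expR (C * `|T|) * `|T| * (Q * E)) => [|n j f M jT sf fM].
  by rewrite !mulr_ge0 ?expR_ge0//; lra.
have st := stp_gt0 n; have M0 := bddC_ge0 fM.
have rn0 : 0 <= r ^+ n by rewrite exprn_ge0.
have E0 : 0 <= E by lra.
have T0 : 0 <= T by apply: le_trans jT; rewrite mulr_ge0// ltW.
have C1 : 1 <= 1 + C * stp n by rewrite lerDl mulr_ge0// ltW.
have H : bddC k ((1 + C * stp n) ^+ j * (j%:R * (Q * (E * M) * stp n * r ^+ n)))
    (fun x => iter (4 * j) (euler n.+1) f x - iter j (euler n) f x).
  elim: j jT => [|j IH] jT.
    rewrite mul0r mulr0; by apply: bddC_zero => x; rewrite muln0 subrr.
  have jT' : j%:R * stp n <= T.
    by apply: le_trans jT; rewrite ler_wpM2r ?(ltW st)// ler_nat.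
  have s4 := iter_smooth n.+1 (4 * j) sf; have sj := iter_smooth n j sf.
  have b4 : bddC k.+4 (E * M) (iter (4 * j) (euler n.+1) f).
    by apply: HE => //; rewrite natrM mulrAC -stpS mulrC.
  have := bddCD (HC n _ _ (smoothbB s4 sj) (IH jT')) (HQ n _ _ s4 b4).
  move=> H; apply: bddC_ext (bddC_mono _ H) => [x|].
    have -> : euler n (fun x => iter (4 * j) (euler n.+1) f x - iter j (euler n) f x) x
       = euler n (iter (4 * j) (euler n.+1) f) x - euler n (iter j (euler n) f) x.
      by rewrite {1}/euler L_sub// /euler; ring.
    by rewrite mulnS iterD /=; ring.
  rewrite exprS -natr1; set v := (1 + _) ^+ j; set w := Q * _ * _ * _.
  have v1 : 1 <= v by rewrite exprn_ege1.
  have w0 : 0 <= w by rewrite !mulr_ge0// ltW.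
  have : w <= (1 + C * stp n) * v * w by rewrite ler_peMl// -[leLHS]mulr1 ler_pM.
  rewrite (_ : (1 + C * stp n) * v * ((j%:R + 1) * w) = (1 + C * stp n) * (v * (j%:R * w)) + (1 + C * stp n) * v * w); last by ring.
  by lra.
apply: bddC_mono H.
rewrite (_ : expR (C * `|T|) * `|T| * (Q * E) * M * r ^+ n = expR (C * `|T|) * (`|T| * (Q * (E * M) * r ^+ n))); last by ring.
apply: ler_pM.
- by rewrite exprn_ge0//; lra.
- by rewrite !mulr_ge0// ltW.
- apply: (@le_trans _ _ (expR (C * stp n) ^+ j)).
    by rewrite lerXn2r ?nnegrE ?expR_ge0 ?expR_ge1Dx//; lra.
  by rewrite -expRM_natl ler_expR mulrCA ler_wpM2l// (le_trans jT)//; exact: ler_norm.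
- rewrite (_ : j%:R * _ = j%:R * stp n * (Q * (E * M) * r ^+ n)); last by ring.
  by rewrite ler_wpM2r ?mulr_ge0// (le_trans jT)//; exact: ler_norm.
Qed.

Lemma steps_le n t : 0 <= t -> (steps n t)%:R * stp n <= t.
Proof.
move=> t0; have st := stp_gt0 n; have /truncn_itv/andP[h _] : 0 <= t / stp n by rewrite divr_ge0// ltW.
by rewrite -ler_pdivlMr.
Qed.

Lemma steps_gt n t : 0 <= t -> t < (steps n t)%:R * stp n + stp n.
Proof.
move=> t0; have st := stp_gt0 n; have /truncn_itv/andP[_ h] : 0 <= t / stp n by rewrite divr_ge0// ltW.
by move: h; rewrite ltr_pdivrMr// -natr1 mulrDl mul1r.
Qed.

Lemma steps_mono n t t' : 0 <= t -> t <= t' -> (steps n t <= steps n t')%N.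
Proof.
move=> t0 tt'; have st := stp_gt0 n.
have h1 := steps_le n t0; have h2 := steps_gt n (le_trans t0 tt').
rewrite -ltnS -(ltr_nat R) -(ltr_pM2r st) -natr1 mulrDl mul1r; lra.
Qed.

(** Rounding down leaves fewer than four fine steps unmatched by coarse ones. *)
Lemma stepsS n t : 0 <= t -> exists2 q, (q < 4)%N & steps n.+1 t = (q + 4 * steps n t)%N.
Proof.
move=> t0; have st := stp_gt0 n.+1.
have [a1 a2] := (steps_le n t0, steps_gt n t0).
have [b1 b2] := (steps_le n.+1 t0, steps_gt n.+1 t0).
rewrite stpS in a1 a2; set a := steps n t in a1 a2 *; set b := steps n.+1 t in b1 b2 *.
have h1 : (4 * a < b.+1)%N.
  rewrite -(ltr_nat R) natrM -natr1 -(ltr_pM2r st); lra.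
have h2 : (b < 4 * a + 4)%N.
  rewrite -(ltr_nat R) natrD natrM -(ltr_pM2r st); lra.
exists (b - 4 * a)%N; first by rewrite ltn_subLR// addnC.
by rewrite subnK.
Qed.

Lemma approx_smooth n t f : smoothb f -> smoothb (approx n t f).
Proof. exact: iter_smooth. Qed.

Lemma approx_stable k T : exists2 E, 1 <= E & forall n t f M, 0 <= t <= T ->
  smoothb f -> bddC k M f -> bddC k (E * M) (approx n t f).
Proof.
have [E E1 HE] := iter_stable k T; exists E => // n t f M /andP[t0 tT] sf fM.
by apply: HE => //; exact: le_trans (steps_le n t0) tT.
Qed.

(** The unmatched fine steps act on a function bounded in C^(k+2) and cost a multiple of [stp n];
    the matched ones fall under [iter_compare]. *)
Lemma approx_cauchy k T : exists2 C, 0 <= C & forall n t f M, 0 <= t <= T ->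
  smoothb f -> bddC k.+4 M f ->
  bddC k (C * M * r ^+ n) (fun x => approx n.+1 t f x - approx n t f x).
Proof.
have [C1 C10 H1] := iter_increment k T; have [C2 C20 H2] := iter_compare k T.
have [E E1 HE] := iter_stable k.+2 T.
exists (C1 * E * h0 + C2) => [|n t f M /andP[t0 tT] sf fM].
  by apply: addr_ge0 => //; apply: mulr_ge0 (ltW h00); apply: mulr_ge0 => //; lra.
have M0 := bddC_ge0 fM.
have [q q4 qE] := stepsS n t0.
have st := stp_gt0 n.+1.
have tq : (q + 4 * steps n t)%:R * stp n.+1 <= T by rewrite -qE; exact: le_trans (steps_le n.+1 t0) tT.
have q0 : 0 <= (q%:R : R) * stp n.+1 by rewrite mulr_ge0 ?(ltW st).
have a0 : 0 <= (4 * steps n t)%:R * stp n.+1 by rewrite mulr_ge0 ?(ltW st).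
rewrite natrD mulrDl in tq.
set g := iter (4 * steps n t) (euler n.+1) f.
have sg : smoothb g by exact: iter_smooth.
have gM : bddC k.+2 (E * M) g by apply: HE => //; [lra|exact: bddC_pred (bddC_pred fM)].
have h1 := H1 n.+1 q g (E * M) ltac:(lra) sg gM.
have h2 := H2 n (steps n t) f M (le_trans (steps_le n t0) tT) sf fM.
apply: bddC_ext (bddC_mono _ (bddCD h1 h2)) => [x|].
  by rewrite /approx qE iterD -/g; ring.
rewrite (_ : (C1 * E * h0 + C2) * M * r ^+ n = C1 * (E * M) * (h0 * r ^+ n) + C2 * M * r ^+ n); last by ring.
rewrite lerD2r ler_wpM2l//; first by rewrite mulr_ge0// mulr_ge0//; lra.
apply: le_trans (stp_le n); rewrite (stpS n) ler_pM2r//.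
by rewrite ler_nat ltnW.
Qed.

Lemma approx_gcauchy t f : 0 <= t -> smoothb f -> gcauchy r (fun n => approx n t f).
Proof.
move=> t0 sf; split=> [n|k]; first exact: approx_smooth.
have [C C0 HC] := approx_cauchy k t; have [M fM] := sf k.+4.
by exists (C * M) => n; apply: HC => //; rewrite t0 lexx.
Qed.

Lemma semigroup_smooth t f : 0 <= t -> smoothb f -> smoothb (semigroup t f).
Proof. by move=> t0 sf; apply: (flim_smoothb r0 r1); exact: approx_gcauchy. Qed.

Lemma semigroup0 f : semigroup 0 f = f.
Proof.
apply/funext => x; rewrite /semigroup /flim (_ : (fun n => _) = (fun=> f x)); first exact: lim_cst.
by apply/funext => n; rewrite /approx /steps mul0r truncn0.
Qed.

Lemma semigroup_stable0 t f M : 0 <= t -> smoothb f -> bddC 0 M f -> bddC 0 M (semigroup t f).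
Proof.
move=> t0 sf fM; apply: (flim_bddC r0 r1); first exact: approx_gcauchy.
by move=> n; exact: iter_stable0.
Qed.

Lemma semigroup_stable k T f : smoothb f -> exists M, forall t, 0 <= t <= T -> bddC k M (semigroup t f).
Proof.
move=> sf; have [E E1 HE] := approx_stable k T; have [M fM] := sf k.
exists (E * M) => t tT; have /andP[t0 _] := tT.
by apply: (flim_bddC r0 r1); [exact: approx_gcauchy|move=> n; exact: HE].
Qed.

Lemma semigroup_dist k T f : smoothb f -> exists2 C, 0 <= C & forall n t, 0 <= t <= T ->
  bddC k (C * r ^+ n) (fun x => semigroup t f x - approx n t f x).
Proof.
move=> sf; have [C C0 HC] := approx_cauchy k T; have [M fM] := sf k.+4.
have M0 := bddC_ge0 fM; have r1' := r1.
exists (C * M / (1 - r)) => [|n t tT]; first by rewrite divr_ge0 ?mulr_ge0//; lra.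
have /andP[t0 _] := tT; rewrite mulrAC.
by apply: (flim_dist r0 r1 (approx_gcauchy t0 sf)) => m; exact: HC.
Qed.

Lemma L_gcauchy f : smoothb f -> gcauchy r (fun n => L n f).
Proof.
move=> sf; split=> [n|k]; first exact: L_smooth.
by have [C C0 HC] := L_cauchy k; have [M fM] := sf k.+2; exists (C * M) => n; exact: HC.
Qed.

Lemma generator_smooth f : smoothb f -> smoothb (generator f).
Proof. by move=> sf; apply: (flim_smoothb r0 r1); exact: L_gcauchy. Qed.

Lemma generator_dist k f : smoothb f -> exists2 C, 0 <= C & forall n,
  bddC k (C * r ^+ n) (fun x => generator f x - L n f x).
Proof.
move=> sf; have [C C0 HC] := L_cauchy k; have [M fM] := sf k.+2.
have M0 := bddC_ge0 fM; have r1' := r1.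
exists (C * M / (1 - r)) => [|n]; first by rewrite divr_ge0 ?mulr_ge0//; lra.
by rewrite mulrAC; apply: (flim_dist r0 r1 (L_gcauchy sf)) => m; exact: HC.
Qed.

(** The limit ignores the first terms, so an error tending to 0 disappears from the bound. *)
Lemma flim_bddC_tail F k a b : gcauchy r F -> 0 <= b ->
  (forall n, bddC k (a + b * r ^+ n) (F n)) -> bddC k a (flim F).
Proof.
move=> cF b0 H; apply: bddC_inf => e e0.
have cv : (fun n => b * r ^+ n) @ \oo --> 0.
  by have := @cvg_geometric R b r ltac:(by rewrite ger0_norm ?r1 ?r0).
have /cvgrPdist_lt/(_ e e0)[N _ hN] := cv.
have cG : gcauchy r (fun n => F (N + n)%N).
  case: cF => sF cF; split=> [n|j]; first exact: sF.
  have [C HC] := cF j; exists (C * r ^+ N) => n.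
  by have := HC (N + n)%N; rewrite exprD mulrA addnS.
have -> : flim F = flim (fun n => F (N + n)%N).
  apply/funext => x; apply/esym/cvg_lim => //.
  have := @gcauchy_cvg R r r0 r1 F x cF; rewrite -(cvg_shiftn N); under eq_fun do rewrite addnC.
  by [].
apply: (flim_bddC r0 r1) => // n; apply: bddC_mono (H _); rewrite lerD2l.
have := hN (N + n)%N (leq_addr _ _); rewrite /= sub0r normrN => /ltW; apply: le_trans.
exact: ler_norm.
Qed.

Lemma gcauchyD F G a : gcauchy r F -> gcauchy r G -> gcauchy r (fun n x => F n x + a * G n x).
Proof.
move=> [sF cF] [sG cG]; split=> [n|k]; first by apply: smoothbD => //; exact: smoothbZ.
have [C HC] := cF k; have [D HD] := cG k; exists (C + `|a| * D) => n.
rewrite mulrDl -mulrA; have := bddCD (HC n) (bddCZ a (HD n)).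
by apply: bddC_ext => x; ring.
Qed.

Lemma flimD F G a : gcauchy r F -> gcauchy r G ->
  flim (fun n x => F n x + a * G n x) = (fun x => flim F x + a * flim G x).
Proof.
move=> cF cG; apply/funext => x; apply/cvg_lim => //.
by apply: cvgD; [|apply: cvgM; first exact: cvg_cst]; exact: (gcauchy_cvg r0 r1).
Qed.

(** Uniform expansion in time, in every C^k; all regularity in time is drawn from it. On the
    discrete side the increment over [t' - t] is formed first, starting from [f], and then
    transported by the [j] stable steps that lead to [t]. *)
Lemma semigroup_taylor k T f : smoothb f -> exists2 C, 0 <= C & forall t t', 0 <= t -> t <= t' -> t' <= T ->
  bddC k (C * (t' - t) ^+ 2)
    (fun x => semigroup t' f x + (-1) * semigroup t f x + (- (t' - t)) * semigroup t (generator f) x).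
Proof.
move=> sf; have sL := generator_smooth sf.
have [E E1 HE] := approx_stable k T; have [C2 C20 H2] := iter_second_order k T.
have [M fM] := sf k.+4; have M0 := bddC_ge0 fM.
have [A A0 HA] := generator_dist k sf.
have [ML LM] := sL k; have ML0 := bddC_ge0 LM.
have E0 : 0 <= E by lra.
pose K1 := E * (C2 * M).
have K10 : 0 <= K1 by rewrite !mulr_ge0.
exists (2 * K1) => [|t t' t0 tt' t'T]; first by rewrite mulr_ge0.
have T0 : 0 <= T by lra.
have t'0 : 0 <= t' by lra.
have tT : 0 <= t <= T by lra.
have cF := gcauchyD (- (t' - t)) (gcauchyD (-1) (approx_gcauchy t'0 sf) (approx_gcauchy t0 sf)) (approx_gcauchy t0 sL).
have <- : flim (fun n x => approx n t' f x + -1 * approx n t f x + - (t' - t) * approx n t (generator f) x) =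
   (fun x => semigroup t' f x + (-1) * semigroup t f x + (- (t' - t)) * semigroup t (generator f) x).
  rewrite flimD; [|exact: gcauchyD (approx_gcauchy _ _) (approx_gcauchy _ _)|exact: approx_gcauchy].
  by rewrite flimD//; exact: approx_gcauchy.
(* Collects what vanishes with the mesh: the excess of [d ^+ 2], the replacement of [L n] by the
   generator, and the rounding of [t' - t] to [d]. *)
pose b := 2 * K1 * h0 ^+ 2 + h0 * (E * (A + ML)) + T * (E * A).
apply: (flim_bddC_tail (b := b)) => //.
  by rewrite /b !addr_ge0 ?mulr_ge0 ?addr_ge0 ?sqr_ge0// ltW.
move=> n; have st := stp_gt0 n.
have rn0 : 0 <= r ^+ n by rewrite exprn_ge0.
have rn1 : r ^+ n <= 1 by rewrite exprn_ile1// ltW.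
have stn := stp_le n.
set j := steps n t; have jj := steps_mono n t0 tt'.
pose i := (steps n t' - j)%N.
have iE : steps n t' = (j + i)%N by rewrite /i subnKC.
pose d := i%:R * stp n.
have dE : `|d - (t' - t)| <= stp n.
  have := steps_le n t0; have := steps_gt n t0; have := steps_le n t'0; have := steps_gt n t'0.
  rewrite iE natrD mulrDl -/j -/d => *; rewrite ler_norml; lra.
have dT : i%:R * stp n <= T.
  have := steps_le n t'0; rewrite iE natrD mulrDl -/d.
  have : 0 <= j%:R * stp n by rewrite mulr_ge0// ltW.
  by lra.
have sfi := iter_smooth n i sf.
have h1 := H2 n i f M dT sf fM.
have sLn := L_smooth n sf; have sdiff := smoothbB sfi sf.
have h1' : bddC k (E * (C2 * M * d ^+ 2))
    (iter j (euler n) (fun x => (- d) * L n f x + (iter i (euler n) f x - f x))).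
  apply: (HE n t) => //; first by apply: smoothbD => //; exact: smoothbZ.
  by apply: bddC_ext h1 => x; rewrite mulNr addrC.
have sD := smoothbB sL sLn.
have h2 := HE n t _ _ tT sD (HA n).
have h3 := HE n t _ _ tT sL LM.
have := bddCD (bddCD h1' (bddCZ (- d) h2)) (bddCZ (d - (t' - t)) h3).
move=> H; apply: bddC_ext (bddC_mono _ H) => [x|].
  by rewrite /approx -/j iE iterD iter_lin// !iter_sub//; ring.
have d0 : 0 <= d by rewrite mulr_ge0// ltW.
have h4 : d ^+ 2 <= 2 * (t' - t) ^+ 2 + 2 * (h0 ^+ 2 * r ^+ n).
  have : d <= (t' - t) + stp n by move: dE; rewrite ler_norml => /andP[]; lra.
  have : stp n ^+ 2 <= h0 ^+ 2 * r ^+ n.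
    apply: (@le_trans _ _ ((h0 * r ^+ n) * (h0 * r ^+ n))).
      by rewrite expr2 ler_pM// ltW.
    rewrite (_ : h0 * r ^+ n * (h0 * r ^+ n) = h0 ^+ 2 * r ^+ n * r ^+ n); last by ring.
    by rewrite ler_piMr// mulr_ge0// sqr_ge0.
  have := sqr_ge0 (t' - t - stp n) ; set v := t' - t; set w := stp n.
  have v0 : 0 <= v by rewrite subr_ge0.
  have w0 : 0 <= w := ltW st.
  move=> h5 h6 h7; have : d ^+ 2 <= (v + w) ^+ 2 by rewrite lerXn2r// nnegrE; lra.
  by rewrite (sqrrD v w); rewrite (sqrrB v w) in h5; lra.
have h5 : K1 * d ^+ 2 <= K1 * (2 * (t' - t) ^+ 2 + 2 * (h0 ^+ 2 * r ^+ n)) by rewrite ler_wpM2l.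
have h6 : `|- d| * (E * (A * r ^+ n)) <= T * (E * A) * r ^+ n.
  rewrite normrN (ger0_norm d0) (_ : d * _ = d * (E * A) * r ^+ n); last by ring.
  by rewrite ler_wpM2r// ler_wpM2r// mulr_ge0.
have h7 : `|d - (t' - t)| * (E * ML) <= h0 * (E * ML) * r ^+ n.
  rewrite mulrAC ler_wpM2r ?mulr_ge0//; exact: le_trans dE stn.
have h8 : 0 <= h0 * (E * A) * r ^+ n by rewrite !mulr_ge0// ltW.
apply: (le_trans (lerD (lerD (_ : _ <= K1 * (2 * (t' - t) ^+ 2 + 2 * (h0 ^+ 2 * r ^+ n))) h6) h7)).
  by rewrite (_ : E * _ = K1 * d ^+ 2)// /K1; ring.
by rewrite /b; lra.
Qed.

(** The limit of [L n (approx n t f)] is computed twice: at each level [L n] commutes with its own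
    Euler iterates, so it may be applied last or first. *)
Lemma semigroup_generator t f : 0 <= t -> smoothb f ->
  generator (semigroup t f) = semigroup t (generator f).
Proof.
move=> t0 sf; apply/funext => x.
have sS := semigroup_smooth t0 sf; have sL := generator_smooth sf.
have tt : 0 <= t <= t by rewrite t0 lexx.
have [C C0 HC] := semigroup_dist 2 t sf; have [A A0 HA] := L_bounded 0.
have [E E1 HE] := approx_stable 0 t; have [D D0 HD] := generator_dist 0 sf.
have E0 : 0 <= E by lra.
have c1 : (fun n => L n (approx n t f) x) @ \oo --> generator (semigroup t f) x.
  rewrite -[X in _ --> X](subr0 _).
  have -> : (fun n => L n (approx n t f) x) =
      (fun n => L n (semigroup t f) x - L n (fun y => semigroup t f y - approx n t f y) x).
    by apply/funext => n; rewrite L_sub//; [ring|exact: approx_smooth].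
  apply: cvgB; first exact: (@gcauchy_cvg R r r0 r1 (fun n => L n (semigroup t f)) x (L_gcauchy sS)).
  apply: (geometric_cvg0 (c := A * C) r0 r1) => n; have sd := smoothbB sS (approx_smooth n t sf).
  rewrite -mulrA.
  exact: (bddC_bound (HA n _ _ sd (HC n t tt)) x).
have c2 : (fun n => L n (approx n t f) x) @ \oo --> semigroup t (generator f) x.
  rewrite -[X in _ --> X](subr0 _).
  have -> : (fun n => L n (approx n t f) x) =
      (fun n => approx n t (generator f) x - approx n t (fun y => generator f y - L n f y) x).
    apply/funext => n; rewrite /approx; rewrite iter_L// iter_sub//; [ring|exact: L_smooth].
  apply: cvgB; first exact: (@gcauchy_cvg R r r0 r1 (fun n => approx n t (generator f)) x (approx_gcauchy t0 sL)).
  apply: (geometric_cvg0 (c := E * D) r0 r1) => n; have sd := smoothbB sL (L_smooth n sf).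
  rewrite -mulrA.
  exact: (bddC_bound (HE n t _ _ tt sd (HD n)) x).
by rewrite -(cvg_lim _ c1)// (cvg_lim _ c2).
Qed.

End Semigroup.

(** * A monotone scheme for drift and fractional diffusion *)

Section Scheme.
Context {R : realType}.
Implicit Types (i j : bool) (a M e : R) (p x : R * R) (f g h : R * R -> R) (k n : nat).

Lemma sh_comm i j a e p : sh i a (sh j e p) = sh j e (sh i a p).
Proof. by case: i j => [] []; rewrite /sh /= ?(addrAC _ a). Qed.

Lemma isd_sh i j e f g : isd i f g -> isd i (fun x => f (sh j e x)) (fun x => g (sh j e x)).
Proof.
move=> fg p; have := fg (sh j e p); congr is_derive.
by apply/funext => a; rewrite sh_comm.
Qed.

Definition cdiff i e f x : R := (2 * e)^-1 * (f (sh i e x) - f (sh i (- e) x)).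
(** This is [- e / 2] times the second difference quotient, hence of order [e] on C^2 functions. *)
Definition sdiff i e f x : R := (2 * e)^-1 * (2 * f x - (f (sh i e x) + f (sh i (- e) x))).

Lemma cdiff_commutes j e : commutes (cdiff j e).
Proof. by move=> i f g _ fg; apply/isdZ/isdB; exact: isd_sh. Qed.

Lemma sdiff_commutes j e : commutes (sdiff j e).
Proof. by move=> i f g _ fg; apply/isdZ/isdB; [exact: isdZ|apply: isdD; exact: isd_sh]. Qed.

Lemma cdiff_bound i e f M x : 0 < e -> bddC 1 M f -> `|cdiff i e f x| <= M.
Proof.
move=> e0 fM; rewrite /cdiff normrM gtr0_norm; last by rewrite invr_gt0 mulr_gt0.
rewrite ler_pdivrMl ?mulr_gt0//.
have := bddC_lip i e x fM; have := bddC_lip i (- e) x fM; rewrite normrN (gtr0_norm e0).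
by rewrite !ler_norml => /andP[] ? ? /andP[] ? ?; apply/andP; split; lra.
Qed.

Lemma cdiff_dist i e f g M x : 0 < e -> bddC 2 M f -> isd i f g -> `|cdiff i e f x - g x| <= M * e.
Proof.
move=> e0 fM fg.
have -> : cdiff i e f x - g x = (2 * e)^-1 *
    ((f (sh i e x) - f x - e * g x) - (f (sh i (- e) x) - f x - (- e) * g x)).
  by rewrite /cdiff; field; rewrite gt_eqF.
rewrite normrM gtr0_norm; last by rewrite invr_gt0 mulr_gt0.
rewrite ler_pdivrMl ?mulr_gt0//; apply: (le_trans (ler_normB _ _)).
have h1 := bddC_taylor e x fM fg; have h2 := bddC_taylor (- e) x fM fg; rewrite sqrrN in h2.
by rewrite (_ : 2 * e * (M * e) = M * e ^+ 2 + M * e ^+ 2); [exact: lerD|ring].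
Qed.

Lemma sdiff_bound i e f M x : 0 < e -> smoothb f -> bddC 2 M f -> `|sdiff i e f x| <= M * e.
Proof.
move=> e0 sf fM; have [g fg] := smoothb_isd i sf.
have -> : sdiff i e f x = - ((2 * e)^-1 *
    ((f (sh i e x) - f x - e * g x) + (f (sh i (- e) x) - f x - (- e) * g x))).
  by rewrite /sdiff; ring.
rewrite normrN normrM gtr0_norm; last by rewrite invr_gt0 mulr_gt0.
rewrite ler_pdivrMl ?mulr_gt0//; apply: (le_trans (ler_normD _ _)).
have h1 := bddC_taylor e x fM fg; have h2 := bddC_taylor (- e) x fM fg; rewrite sqrrN in h2.
by rewrite (_ : 2 * e * (M * e) = M * e ^+ 2 + M * e ^+ 2); [exact: lerD|ring].
Qed.

Variables (s : R) (U : bool -> R * R -> R) (B : R).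
Hypotheses (s0 : 0 < s) (s1 : s < 1) (sU : forall i, smoothb (U i)) (UB : forall i x, `|U i x| <= B).

Definition mesh n : R := 2^-1 ^+ n.

(* The artificial viscosity [B * sdiff] makes the explicit Euler step order preserving. *)
Definition diffusion n f x : R :=
  - (B * (sdiff true (mesh n) f x + sdiff false (mesh n) f x) +
     frac_const s * (kern_mass s (mesh n) * f x - kern_avg s (mesh n) f x)).
Definition drift_diffusion n f x : R :=
  - (U true x * cdiff true (mesh n) f x + U false x * cdiff false (mesh n) f x) + diffusion n f x.
Definition cfl : R := (2 * B + frac_const s * far_const s + 1)^-1.
(** Dominates both consistency orders, [mesh n] for the drift and [mesh n] to the power [2 - 2 s]
    for the dissipation, because [1 - s] is below both 1 and [2 - 2 s]. *)
Definition rate : R := 2^-1 `^ (1 - s).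

Lemma mesh_gt0 n : 0 < mesh n.
Proof. by rewrite exprn_gt0 ?invr_gt0. Qed.
Local Hint Resolve mesh_gt0 : core.

Lemma mesh_le1 n : mesh n <= 1.
Proof. by rewrite exprn_ile1 ?invr_ge0 ?invf_le1 ?ler1n. Qed.

Let B_ge0 : 0 <= B.
Proof. exact: le_trans (UB true (0, 0)). Qed.

Let c_ge0 : 0 <= frac_const s. Proof. exact: frac_const_ge0. Qed.
Let far_ge0 : 0 <= far_const s. Proof. exact: far_const_ge0. Qed.
Let nearc_ge0 : 0 <= near_const s. Proof. exact: near_const_ge0. Qed.

Lemma cfl_gt0 : 0 < cfl.
Proof. by rewrite invr_gt0 ltr_wpDl ?ltr01// (addr_ge0 (mulr_ge0 _ B_ge0) (mulr_ge0 c_ge0 far_ge0)). Qed.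

Lemma rate_gt0 : 0 < rate. Proof. by rewrite powR_gt0. Qed.

Lemma mesh_powR n a : mesh n `^ a = (2^-1 `^ a) ^+ n.
Proof. by rewrite /mesh -!powR_mulrn ?powR_ge0 ?invr_ge0 ?ler0n// -!powRrM mulrC. Qed.

Lemma rate_ge : 2^-1 <= rate.
Proof.
rewrite -[leLHS]powRr1//; apply: ger_powR; last by move: (s0); lra.
by rewrite invr_gt0 ltr0n invf_le1 ?ler1n.
Qed.

Lemma rate_lt1 : rate < 1.
Proof.
apply: (@lt_le_trans _ _ (1 `^ (1 - s))); last by rewrite powR1.
apply: gt0_ltr_powR; rewrite ?nnegrE ?invr_ge0//; first by move: (s1); lra.
by rewrite invf_lt1 ?ltr1n.
Qed.

Lemma mesh_le_rate n : mesh n <= rate ^+ n.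
Proof. by rewrite lerXn2r ?nnegrE ?rate_ge// ?invr_ge0// ltW// rate_gt0. Qed.

Lemma mesh_powR_le_rate n : mesh n `^ (2 - 2 * s) <= rate ^+ n.
Proof.
rewrite mesh_powR lerXn2r ?nnegrE ?powR_ge0//.
apply: ger_powR; last by move: (s1); lra.
by rewrite invr_gt0 ltr0n invf_le1 ?ler1n.
Qed.

Lemma kern_avg_lin e f g a : 0 < e -> smoothb f -> smoothb g ->
  kern_avg s e (fun x => a * f x + g x) = (fun x => a * kern_avg s e f x + kern_avg s e g x).
Proof.
move=> e0 sf sg; apply/funext => x.
have [mf mg] := (smoothb_measurable sf, smoothb_measurable sg).
have [M fM] := sf 0%N; have [M' gM] := sg 0%N.
have mD : measurable (far e) by exact: measurable_enorm_gt.
have jf := integrable_avg s0 x e0 mf (bddC_bound fM).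
have jg := integrable_avg s0 x e0 mg (bddC_bound gM).
rewrite /kern_avg -RintegralZl// -RintegralD//; last exact: integrable_leb2Z.
by apply: eq_Rintegral => z _; ring.
Qed.

Lemma diffusion_commutes n : commutes (diffusion n).
Proof.
move=> i f g sf fg p; rewrite /diffusion.
have H := isdD (isdZ B (isdD (@sdiff_commutes true (mesh n) i f g sf fg) (@sdiff_commutes false (mesh n) i f g sf fg)))
  (isdZ (frac_const s) (isdB (isdZ (kern_mass s (mesh n)) fg) (kern_avg_commutes s0 (mesh_gt0 n) sf fg))).
have := isdZ (-1) H p; rewrite mulN1r; congr is_derive.
by apply/funext => a; rewrite mulN1r.
Qed.

(** Comparison with the truncation at radius 1 makes the bound uniform in [n], although the kernel
    mass blows up. *)
Lemma nonlocal_bound n f M x : smoothb f -> bddC 2 M f ->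
  `|kern_mass s (mesh n) * f x - kern_avg s (mesh n) f x| <= (2 * far_const s + 2 * near_const s) * M.
Proof.
move=> sf fM; rewrite -pv_trunc_smoothb//.
have := pv_trunc_dist s0 s1 x (mesh_gt0 n) (mesh_le1 n) sf fM; rewrite powR1 mulr1 => h1.
have M0 := bddC_ge0 fM.
have h2 : `|pv_trunc s f x 1| <= 2 * far_const s * M.
  rewrite pv_trunc_smoothb//.
  have k0 := kern_mass_ge0 s 1.
  have k1 : kern_mass s 1 <= far_const s by have := kern_mass_le s0 ltr01; rewrite powR1 mulr1.
  apply: (le_trans (ler_normB _ _)); rewrite normrM (ger0_norm k0).
  have j1 := kern_avg_abs s0 x ltr01 (smoothb_measurable sf) (bddC_bound fM).
  have j2 : kern_mass s 1 * `|f x| <= kern_mass s 1 * M by rewrite ler_wpM2l// (bddC_bound fM).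
  have j3 : kern_mass s 1 * M <= far_const s * M by rewrite ler_wpM2r.
  by rewrite [M * _]mulrC in j1; lra.
rewrite -[X in `|X|](subrK (pv_trunc s f x 1)); apply: (le_trans (ler_normD _ _)).
by rewrite mulrDl addrC; apply: lerD => //; rewrite (_ : _ * M = 2 * M * near_const s)//; ring.
Qed.

Definition diff_const : R := 2 * B + frac_const s * (2 * far_const s + 2 * near_const s).

Lemma diff_const_ge0 : 0 <= diff_const.
Proof.
have := far_ge0; have := nearc_ge0 => a b.
exact: addr_ge0 (mulr_ge0 (ler0n _ 2) B_ge0) (mulr_ge0 c_ge0 (addr_ge0 (mulr_ge0 (ler0n _ 2) b) (mulr_ge0 (ler0n _ 2) a))).
Qed.

Lemma sdiff_mesh i n f M x : smoothb f -> bddC 2 M f -> `|B * sdiff i (mesh n) f x| <= B * (M * mesh n).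
Proof. by move=> sf fM; rewrite normrM (ger0_norm B_ge0) ler_wpM2l ?B_ge0//; exact: sdiff_bound. Qed.

Lemma diffusion_bound n f M x : smoothb f -> bddC 2 M f -> `|diffusion n f x| <= diff_const * M.
Proof.
move=> sf fM; have M0 := bddC_ge0 fM.
rewrite /diffusion normrN; apply: (le_trans (ler_normD _ _)).
rewrite mulrDl; apply: lerD.
  rewrite mulrDr; apply: (le_trans (ler_normD _ _)).
  have := sdiff_mesh true n x sf fM; have := sdiff_mesh false n x sf fM.
  have : B * (M * mesh n) <= B * M by rewrite ler_wpM2l ?B_ge0// ler_piMr// mesh_le1.
  lra.
by rewrite normrM (ger0_norm c_ge0) -mulrA ler_wpM2l ?c_ge0// nonlocal_bound.
Qed.

Definition cons_const : R := 2 * B + frac_const s * (2 * near_const s).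

Lemma cons_const_ge0 : 0 <= cons_const.
Proof. exact: addr_ge0 (mulr_ge0 (ler0n _ 2) B_ge0) (mulr_ge0 c_ge0 (mulr_ge0 (ler0n _ 2) nearc_ge0)). Qed.

Lemma diffusion_dist n f M x : smoothb f -> bddC 2 M f ->
  `|diffusion n f x - (- fraclap s f x)| <= cons_const * M * rate ^+ n.
Proof.
move=> sf fM; have M0 := bddC_ge0 fM; have mr := mesh_le_rate n.
have mp := mesh_powR_le_rate n; have c0 := c_ge0; have n0 := nearc_ge0.
have h := fraclap_dist s0 s1 x (mesh_gt0 n) sf fM.
rewrite pv_trunc_smoothb// in h.
rewrite /diffusion.
rewrite (_ : _ - _ = (fraclap s f x - frac_const s * (kern_mass s (mesh n) * f x - kern_avg s (mesh n) f x))
   - B * sdiff true (mesh n) f x - B * sdiff false (mesh n) f x); last by ring.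
apply: (le_trans (ler_normB _ _)).
have h1 := sdiff_mesh true n x sf fM; have h2 := sdiff_mesh false n x sf fM.
have h3 : B * (M * mesh n) <= B * (M * rate ^+ n) by rewrite !ler_wpM2l ?B_ge0.
have h4 : frac_const s * (2 * M * (near_const s * mesh n `^ (2 - 2 * s))) <=
  frac_const s * (2 * M * (near_const s * rate ^+ n)).
  by rewrite ler_wpM2l// ler_wpM2l ?mulr_ge0// ler_wpM2l.
have := ler_normB (fraclap s f x - frac_const s * (kern_mass s (mesh n) * f x - kern_avg s (mesh n) f x)) (B * sdiff true (mesh n) f x).
rewrite /cons_const; lra.
Qed.

Lemma diffusion_smooth n f : smoothb f -> smoothb (diffusion n f).
Proof. exact: (commutes_smoothb (@diffusion_commutes n) (fun g M sg gM x => diffusion_bound n x sg gM)). Qed.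

Lemma cdiff_smooth i n f : smoothb f -> smoothb (cdiff i (mesh n) f).
Proof.
apply: (commutes_smoothb (m := 1) (e := 1) (@cdiff_commutes i (mesh n))) => g M _ gM x.
by rewrite mul1r; exact: cdiff_bound.
Qed.

Lemma drift_diffusion_smooth n f : smoothb f -> smoothb (drift_diffusion n f).
Proof.
move=> sf; apply: smoothbD; last exact: diffusion_smooth.
have H : smoothb (fun x => U true x * cdiff true (mesh n) f x + U false x * cdiff false (mesh n) f x).
  by apply: smoothbD; apply: smoothbM => //; exact: cdiff_smooth.
by have := smoothbZ (-1) H; under eq_fun do rewrite mulN1r.
Qed.

Lemma drift_diffusion_lin n f g a : smoothb f -> smoothb g ->
  drift_diffusion n (fun x => a * f x + g x) = (fun x => a * drift_diffusion n f x + drift_diffusion n g x).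
Proof.
move=> sf sg; apply/funext => x.
by rewrite /drift_diffusion /diffusion kern_avg_lin// /cdiff /sdiff; ring.
Qed.

(** Both the inverse mesh and its power [2 s] are at most the inverse square of the mesh, that is
    [4 ^+ n], so steps proportional to [4^(- n)] are admissible at every level. *)
Lemma cfl_condition n : cfl * 4^-1 ^+ n * (2 * B / mesh n + frac_const s * kern_mass s (mesh n)) <= 1.
Proof.
have m0 := mesh_gt0 n; have c0 := c_ge0; have B0 := B_ge0; have f0 := far_ge0.
have E4 : (4 ^+ n : R) = (mesh n ^+ 2)^-1 by rewrite /mesh -exprM mulnC exprM -exprVn; congr (_ ^+ n); field.
have h1 : (mesh n)^-1 <= 4 ^+ n.
  by rewrite E4 lef_pV2 ?posrE ?exprn_gt0// expr2 ler_piMr ?mesh_le1// ltW.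
have h2 : mesh n `^ (- (2 * s)) <= 4 ^+ n.
  rewrite E4 -(powR_mulrn _ (ltW m0)) -powRN; apply: ger_powR; last by move: (s1); lra.
  by rewrite m0 mesh_le1.
have h3 : kern_mass s (mesh n) <= far_const s * 4 ^+ n.
  by apply: (le_trans (kern_mass_le s0 m0)); rewrite ler_wpM2l.
have h4 : 2 * B / mesh n + frac_const s * kern_mass s (mesh n) <= cfl^-1 * 4 ^+ n.
  rewrite /cfl invrK.
  have : 2 * B / mesh n <= 2 * B * 4 ^+ n by rewrite ler_wpM2l ?mulr_ge0.
  have : frac_const s * kern_mass s (mesh n) <= frac_const s * (far_const s * 4 ^+ n) by rewrite ler_wpM2l.
  have : (0 : R) <= 4 ^+ n by rewrite exprn_ge0.
  lra.
have q0 : 0 < cfl * 4^-1 ^+ n by rewrite mulr_gt0 ?cfl_gt0// exprn_gt0 ?invr_gt0.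
apply: (le_trans (ler_wpM2l (ltW q0) h4)).
rewrite exprVn mulrACA divff ?gt_eqF ?cfl_gt0// mul1r mulVf// expf_neq0//.
Qed.

Local Notation evolve := (euler drift_diffusion cfl).
Local Notation tau := (stp cfl).

(* [f + h L f] is a combination of values of [f] with nonnegative weights of total mass 1. *)
Lemma euler_stable0 n f M : smoothb f -> bddC 0 M f -> bddC 0 M (evolve n f).
Proof.
move=> sf fM; split=> // x; have M0 := bddC_ge0 fM; have fb := bddC_bound fM.
have m0 := mesh_gt0 n; have c0 := c_ge0; have k0 := kern_mass_ge0 s (mesh n).
pose h := tau n; have hE : h = cfl * 4^-1 ^+ n by [].
have h0 : 0 < h by rewrite hE mulr_gt0 ?cfl_gt0// exprn_gt0 ?invr_gt0.
have cond := cfl_condition n; rewrite -hE in cond.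
pose w := h / (2 * mesh n); have w0 : 0 <= w by exact: divr_ge0 (ltW h0) (mulr_ge0 (ler0n _ 2) (ltW m0)).
pose A := kern_avg s (mesh n) f x.
have AM : `|A| <= M * kern_mass s (mesh n) by exact: kern_avg_abs (smoothb_measurable sf) fb.
pose l := h * (2 * B / mesh n + frac_const s * kern_mass s (mesh n)).
have -> : evolve n f x = (1 - l) * f x + w * ((B - U true x) * f (sh true (mesh n) x) + (B + U true x) * f (sh true (- mesh n) x)
   + (B - U false x) * f (sh false (mesh n) x) + (B + U false x) * f (sh false (- mesh n) x)) + h * frac_const s * A.
  rewrite /euler -/h /drift_diffusion /diffusion /cdiff /sdiff -/A /w /l.
  by field; rewrite gt_eqF.
have term i e : `|(B - U i x) * f (sh i e x) + (B + U i x) * f (sh i (- e) x)| <= 2 * B * M.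
  have := UB i x; rewrite ler_norml => /andP[u1 u2]; apply: (le_trans (ler_normD _ _)).
  rewrite !normrM (ger0_norm (_ : 0 <= B - U i x)) ?(ger0_norm (_ : 0 <= B + U i x)); try lra.
  have : (B - U i x) * `|f (sh i e x)| <= (B - U i x) * M by apply: ler_wpM2l; [lra|exact: fb].
  have : (B + U i x) * `|f (sh i (- e) x)| <= (B + U i x) * M by apply: ler_wpM2l; [lra|exact: fb].
  by lra.
have t1 := term true (mesh n); have t2 := term false (mesh n).
apply: (le_trans (ler_normD _ _)).
have a3 : `|h * frac_const s * A| <= h * frac_const s * (M * kern_mass s (mesh n)).
  have hc := mulr_ge0 (ltW h0) c0.
  by rewrite normrM (ger0_norm hc); exact: ler_wpM2l.
apply: (le_trans (lerD (ler_normD _ _) a3)).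
have a1 : `|(1 - l) * f x| <= (1 - l) * M.
  have l0 : 0 <= 1 - l by rewrite subr_ge0.
  by rewrite normrM (ger0_norm l0); apply: ler_wpM2l => //; exact: fb.
have a2 : `|w * ((B - U true x) * f (sh true (mesh n) x) + (B + U true x) * f (sh true (- mesh n) x)
   + (B - U false x) * f (sh false (mesh n) x) + (B + U false x) * f (sh false (- mesh n) x))| <= w * (2 * B * M + 2 * B * M).
  rewrite normrM (ger0_norm w0) -addrA; apply: ler_wpM2l => //.
  exact: le_trans (ler_normD _ _) (lerD t1 t2).
rewrite [leRHS](_ : _ = (1 - l) * M + w * (2 * B * M + 2 * B * M) + h * frac_const s * (M * kern_mass s (mesh n))).
  by rewrite lerD2r; exact: lerD.
by rewrite /w /l; field; rewrite gt_eqF.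
Qed.

Lemma exists_derivatives (F : bool -> R * R -> R) j : (forall i, smoothb (F i)) ->
  exists G : bool -> R * R -> R, forall i, isd j (F i) (G i) /\ smoothb (G i).
Proof.
move=> sF; have /choice[G HG] : forall i, exists g, isd j (F i) g by move=> i; exact: smoothb_isd.
by exists G => i; split; [exact: HG|exact: smoothb_der (HG i)].
Qed.

Lemma exists_common_bound (F : bool -> R * R -> R) k : (forall i, smoothb (F i)) ->
  exists2 M, 0 <= M & forall i, bddC k M (F i).
Proof.
move=> sF; have [M1 H1] := sF true k; have [M2 H2] := sF false k.
have [M10 M20] := (bddC_ge0 H1, bddC_ge0 H2).
exists (M1 + M2) => [|i]; first exact: addr_ge0.
by case: i; [apply: bddC_mono H1|apply: bddC_mono H2]; lra.
Qed.

(** Only the drift coefficients fail to commute with the derivative, and the commutator contains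
    first differences of [f] alone. *)
Lemma euler_der n f g i (G : bool -> R * R -> R) : smoothb f -> isd i f g ->
  (forall j, isd i (U j) (G j)) ->
  isd i (evolve n f) (fun x => evolve n g x -
    tau n * (G true x * cdiff true (mesh n) f x + G false x * cdiff false (mesh n) f x)).
Proof.
move=> sf fg UG.
have D j := isdM (UG j) (@cdiff_commutes j (mesh n) _ _ _ sf fg).
have H := isdD fg (isdZ (tau n) (isdD (isdZ (-1) (isdD (D true) (D false))) (@diffusion_commutes n _ _ _ sf fg))).
move=> p; have := H p; rewrite /euler /drift_diffusion; congr is_derive.
  by apply/funext => a; rewrite mulN1r.
by ring.
Qed.

(** Induction on [k] through [euler_der]. The commutator is [stp] times a product that the C^(k+1)
    bound of [f] controls in C^k, so it raises the growth rate without costing derivatives. *)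
Lemma euler_stable k : exists2 C, 0 <= C & forall n f M, smoothb f -> bddC k M f ->
  bddC k ((1 + C * tau n) * M) (evolve n f).
Proof.
have st n : 0 < tau n by rewrite /stp mulr_gt0 ?cfl_gt0// exprn_gt0 ?invr_gt0.
elim: k => [|k [C C0 IH]].
  by exists 0 => // n f M sf fM; rewrite mul0r addr0 mul1r; exact: euler_stable0.
have /choice[G HG] : forall i, exists G : bool -> R * R -> R, forall j, isd i (U j) (G j) /\ smoothb (G j).
  by move=> i; exact: exists_derivatives.
have [A A0 HA] := exists_common_bound k (fun j => proj2 (HG true j)).
have [A' A'0 HA'] := exists_common_bound k (fun j => proj2 (HG false j)).
pose Q := 2 ^+ k * (A + A'); have Q0 : 0 <= Q by rewrite mulr_ge0 ?exprn_ge0// addr_ge0.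
exists (C + 2 * Q) => [|n f M sf fM]; first by rewrite addr_ge0// mulr_ge0.
have M0 := bddC_ge0 fM; have st0 := st n.
have CQ : M <= (1 + (C + 2 * Q) * tau n) * M.
  by rewrite ler_peMl// lerDl mulr_ge0 ?(ltW st0)// addr_ge0// mulr_ge0.
split=> [x|i].
  by apply: le_trans CQ; apply: (bddC_bound (euler_stable0 n sf (bddC_le (leq0n _) fM))).
have [g fg] := smoothb_isd i sf.
exists (fun x => evolve n g x - tau n * (G i true x * cdiff true (mesh n) f x + G i false x * cdiff false (mesh n) f x)).
split; first by apply: euler_der => // j; exact: (HG i j).1.
have gM : bddC k ((1 + C * tau n) * M) (evolve n g) by apply: IH; [exact: smoothb_der fg|exact: bddC_S fM fg].
have dM j : bddC k M (cdiff j (mesh n) f).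
  rewrite -[M]mul1r; apply: (@commutes_bddC R (cdiff j (mesh n)) 1 1 (@cdiff_commutes j (mesh n))) => //.
    by move=> h N _ hN x; rewrite mul1r; exact: cdiff_bound.
  by rewrite addn1.
have GM j : bddC k (A + A') (G i j).
  case: i {fg} g {gM} => [] _; [apply: (bddC_mono _ (HA j))|apply: (bddC_mono _ (HA' j))]; lra.
have pM j := bddCM (GM j) (dM j).
have := bddCB gM (bddCZ (tau n) (bddCD (pM true) (pM false))).
rewrite (gtr0_norm st0); apply: bddC_mono; rewrite /Q; lra.
Qed.

Lemma drift_diffusion_bounded k : exists2 C, 0 <= C & forall n f M, smoothb f -> bddC k.+2 M f ->
  bddC k (C * M) (drift_diffusion n f).
Proof.
have [A A0 HA] := exists_common_bound k sU; have d0 := diff_const_ge0.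
pose Q := 2 ^+ k * A; have Q0 : 0 <= Q by rewrite mulr_ge0 ?exprn_ge0.
exists (2 * Q + diff_const) => [|n f M sf fM]; first by rewrite addr_ge0// mulr_ge0.
have dM j : bddC k M (cdiff j (mesh n) f).
  rewrite -[M]mul1r; apply: (@commutes_bddC R (cdiff j (mesh n)) 1 1 (@cdiff_commutes j (mesh n))) => //.
    by move=> h N _ hN x; rewrite mul1r; exact: cdiff_bound.
  by rewrite addn1; exact: bddC_pred.
have eM : bddC k (diff_const * M) (diffusion n f).
  apply: (commutes_bddC (m := 2) (@diffusion_commutes n)) => //; last by rewrite addn2.
  by move=> h N sh hN x; exact: diffusion_bound.
have pM j := bddCM (HA j) (dM j).
have := bddCD (bddCZ (-1) (bddCD (pM true) (pM false))) eM.
under eq_fun do rewrite mulN1r.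
rewrite normrN normr1; apply: bddC_mono; rewrite /Q; lra.
Qed.

(** Both levels are compared with [T0] in sup norm, and the difference of levels is lifted to C^k by
    [commutes_bddC]; the 2 is the triangle inequality. *)
Lemma bddC_commutes_diff (T : nat -> (R * R -> R) -> R * R -> R) (T0 : (R * R -> R) -> R * R -> R) (c : R) k n f M :
  0 <= c -> (forall n, commutes (T n)) ->
  (forall n f M x, smoothb f -> bddC 2 M f -> `|T n f x - T0 f x| <= c * M * rate ^+ n) ->
  smoothb f -> bddC k.+2 M f -> bddC k (2 * c * M * rate ^+ n) (fun x => T n.+1 f x - T n f x).
Proof.
move=> c0 cT HT sf fM; have r0 := ltW rate_gt0; have r1 := ltW rate_lt1.
rewrite mulrAC; apply: (@commutes_bddC R (fun f x => T n.+1 f x - T n f x) 2) => //; last by rewrite addn2.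
  by move=> i g h sg gh; apply: isdB; exact: cT.
move=> g N sg gN x; have N0 := bddC_ge0 gN.
rewrite (_ : _ - _ = (T n.+1 g x - T0 g x) - (T n g x - T0 g x)); last by ring.
apply: (le_trans (ler_normB _ _)).
have h1 := HT n.+1 g N x sg gN; have h2 := HT n g N x sg gN.
have h3 : c * N * rate ^+ n.+1 <= c * N * rate ^+ n.
  by rewrite ler_wpM2l ?mulr_ge0// exprS ler_piMl ?exprn_ge0.
lra.
Qed.

Lemma drift_diffusion_cauchy k : exists2 C, 0 <= C & forall n f M, smoothb f -> bddC k.+2 M f ->
  bddC k (C * M * rate ^+ n) (fun x => drift_diffusion n.+1 f x - drift_diffusion n f x).
Proof.
have [A A0 HA] := exists_common_bound k sU; have d0 := cons_const_ge0.
pose Q := 2 ^+ k * A; have Q0 : 0 <= Q by rewrite mulr_ge0 ?exprn_ge0.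
exists (4 * Q + 2 * cons_const) => [|n f M sf fM]; first by rewrite addr_ge0 ?mulr_ge0.
have dM j : bddC k (2 * 1 * M * rate ^+ n) (fun x => cdiff j (mesh n.+1) f x - cdiff j (mesh n) f x).
  have [g fg] := smoothb_isd j sf.
  (* The exact partial derivative as a total operator, with value 0 where there is none. *)
  pose T0 h := xget (fun=> 0) [set g | isd j h g].
  apply: (@bddC_commutes_diff (fun n => cdiff j (mesh n)) T0) => // [m|m h N x sh hN].
    exact: cdiff_commutes.
  have [g' hg'] := smoothb_isd j sh.
  have T0E : isd j h (T0 h) := xgetPex (fun=> 0) (ex_intro _ g' hg').
  rewrite mul1r; apply: (le_trans (cdiff_dist x (mesh_gt0 m) hN T0E)).
  by rewrite ler_wpM2l ?(bddC_ge0 hN)// mesh_le_rate.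
have eM : bddC k (2 * cons_const * M * rate ^+ n) (fun x => diffusion n.+1 f x - diffusion n f x).
  apply: (@bddC_commutes_diff diffusion (fun f x => - fraclap s f x)) => // m; first exact: diffusion_commutes.
  by move=> h N x; exact: diffusion_dist.
have pM j := bddCM (HA j) (dM j).
have := bddCD (bddCZ (-1) (bddCD (pM true) (pM false))) eM.
rewrite normrN normr1 (_ : (fun x => _) = (fun x => drift_diffusion n.+1 f x - drift_diffusion n f x)).
  by apply: bddC_mono; rewrite /Q; lra.
by apply/funext => x; rewrite /drift_diffusion; ring.
Qed.

Lemma drift_diffusion_generator f g1 g2 x : smoothb f -> isd true f g1 -> isd false f g2 ->
  generator drift_diffusion f x = - (U true x * g1 x + U false x * g2 x + fraclap s f x).
Proof.
move=> sf fg1 fg2; have [M fM] := sf 2%N; have M0 := bddC_ge0 fM.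
set l := RHS.
suff cv : (fun n => drift_diffusion n f x) @ \oo --> l by exact: cvg_lim cv.
rewrite -[l]addr0.
have -> : (fun n => drift_diffusion n f x) = (fun n => l + (drift_diffusion n f x - l)).
  by apply/funext => n; rewrite addrC subrK.
apply: cvgD; first exact: cvg_cst.
apply: (geometric_cvg0 (c := (2 * B + cons_const) * M) (ltW rate_gt0) rate_lt1) => n.
have h1 := cdiff_dist x (mesh_gt0 n) fM fg1; have h2 := cdiff_dist x (mesh_gt0 n) fM fg2.
have h3 := diffusion_dist n x sf fM; have mr := mesh_le_rate n.
have r0 : 0 <= rate ^+ n by rewrite exprn_ge0 ?(ltW rate_gt0).
rewrite (_ : _ - _ = (diffusion n f x - - fraclap s f x) - U true x * (cdiff true (mesh n) f x - g1 x)
  - U false x * (cdiff false (mesh n) f x - g2 x)); last by rewrite /drift_diffusion /l; ring.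
have hu i g (e : R) : `|e| <= M * mesh n -> `|U i x * e| <= B * (M * rate ^+ n).
  move=> he; rewrite normrM; apply: ler_pM => //; apply: (le_trans he).
  by rewrite ler_wpM2l.
have {}h1 := hu true g1 _ h1; have {}h2 := hu false g2 _ h2.
apply: (le_trans (ler_normB _ _)); apply: (le_trans (lerD (ler_normB _ _) (lexx _))); lra.
Qed.

End Scheme.

(** * Smoothness in space and time *)

Section Regularity.
Context {R : realType}.

(** It suffices to exhibit a class of continuous functions closed under partial derivatives.
    Agreement is needed on [A] only: [A] is open, so it contains short segments about each of its
    points. *)
Lemma smooth_on_class n (A : set 'rV[R]_n) (K : ('rV[R]_n -> R) -> Prop) f : open A -> K f ->
  (forall g, K g -> forall x, A x -> {for x, continuous g}) ->
  (forall g i, K g -> exists2 h, K h & forall x, A x ->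
     is_derive (0 : R) (1 : R) (fun a : R => g (x + a *: delta_mx 0 i)) (h x)) ->
  smooth_on A f.
Proof.
move=> oA Kf Kc Kd.
have line (x : 'rV[R]_n) i : A x -> \forall a \near (0 : R), A (x + a *: delta_mx 0 i).
  move=> Ax; have c : (fun a : R => x + a *: delta_mx 0 i) @ (0 : R) --> x.
    rewrite -[X in _ --> X]addr0 -(scale0r (delta_mx 0 i)).
    by apply: cvgD; [exact: cvg_cst|apply: cvgZl; exact: cvg_id].
  by apply: c; exact: open_nbhs_nbhs.
have ext (g1 g2 : 'rV[R]_n -> R) i (x : 'rV[R]_n) (l : R) : (forall x, A x -> g1 x = g2 x) -> A x ->
    is_derive (0 : R) (1 : R) (fun a : R => g1 (x + a *: delta_mx 0 i)) l ->
    is_derive (0 : R) (1 : R) (fun a : R => g2 (x + a *: delta_mx 0 i)) l.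
  move=> E Ax; apply: near_eq_is_derive.
  by apply: filterS (line x i Ax) => a Aa; rewrite E.
have key w : exists2 g, K g & forall x, A x -> pdw w f x = g x.
  elim: w => [|i w [g Kg E]]; first by exists f.
  have [h Kh gh] := Kd g i Kg; exists h => // x Ax.
  rewrite /= /pd; apply: is_derive_derive1; apply: ext (gh x Ax) => // y Ay; exact/esym/E.
move=> w x Ax; have [g Kg E] := key w; split.
  rewrite /prop_for /continuous_at E//; apply: cvg_trans (Kc g Kg x Ax).
  have /filterS nA : nbhs x A by exact: open_nbhs_nbhs.
  by apply: (@near_eq_cvg _ _ (nbhs x) _ g (pdw w f)); apply: nA => y Ay; rewrite E.
move=> i; have [h Kh gh] := Kd g i Kg.
by have [] := ext g (pdw w f) i x (h x) (fun y Ay => esym (E y Ay)) Ax (gh x Ax).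
Qed.

Lemma lipschitz_continuous_rV n (g : 'rV[R]_n -> R) (v : 'rV[R]_n) (C d : R) : 0 <= C -> 0 < d ->
  (forall w : 'rV[R]_n, (forall i, `|w 0 i - v 0 i| < d) -> forall e, (forall i, `|w 0 i - v 0 i| <= e) ->
     `|g w - g v| <= C * e) -> {for v, continuous g}.
Proof.
move=> C0 d0 H; rewrite /prop_for /continuous_at.
apply/(@cvgrPdist_le _ _ _ (nbhs v)) => e e0.
have C1 : 0 < C + 1 by rewrite ltr_wpDl.
have m0 : 0 < Num.min d (e / (C + 1)) by rewrite lt_min d0 divr_gt0.
have /filterS nb := nbhsx_ballx v _ m0; apply: nb => w vw.
have vw' i : `|w 0 i - v 0 i| < d /\ `|w 0 i - v 0 i| < e / (C + 1).
  by case: vw => _ /(_ 0 i); rewrite /ball /= distrC lt_min => /andP[].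
rewrite distrC; apply: (le_trans (H w (fun i => (vw' i).1) (e / (C + 1)) (fun i => ltW (vw' i).2))).
rewrite mulrA ler_pdivrMr// mulrC ler_wpM2l ?(ltW e0)//; lra.
Qed.

Implicit Types (i : bool) (t T M C : R) (x : R * R) (f g : R * R -> R) (k n : nat) (Th : R -> R * R -> R).

Lemma row3E (v : 'rV[R]_3) : v = row3 (v 0 0) (v 0 (inord 1), v 0 (inord 2)).
Proof.
by apply/rowP => j; case: (ord3_cases j) => ->; rewrite ?row3_0 ?row3_1 ?row3_2.
Qed.

Lemma sh_true_isd f g (x : R * R) : isd true f g -> is_derive x.1 (1 : R) (fun a => f (a, x.2)) (g x).
Proof. by move=> /(_ x) h; rewrite -[x.1]addr0; apply/is_derive_shift. Qed.

Lemma sh_false_isd f g (x : R * R) : isd false f g -> is_derive x.2 (1 : R) (fun a => f (x.1, a)) (g x).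
Proof. by move=> /(_ x) h; rewrite -[x.2]addr0; apply/is_derive_shift. Qed.

Variables (S : R -> (R * R -> R) -> R * R -> R) (G : (R * R -> R) -> R * R -> R).
Hypothesis S_smooth : forall t f, 0 <= t -> smoothb f -> smoothb (S t f).
Hypothesis S_stable : forall k T f, smoothb f -> exists M, forall t, 0 <= t <= T -> bddC k M (S t f).
Hypothesis S_taylor : forall k T f, smoothb f -> exists2 C, 0 <= C & forall t t', 0 <= t -> t <= t' -> t' <= T ->
  bddC k (C * (t' - t) ^+ 2) (fun x => S t' f x + (-1) * S t f x + (- (t' - t)) * S t (G f) x).
Hypothesis G_smooth : forall f, smoothb f -> smoothb (G f).

(* The orbits [t |-> S t f] and their iterated space derivatives: a class stable under all
   derivations in [(t, x)]. *)
Inductive orbit : (R -> R * R -> R) -> Prop :=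
| orbit_base f : smoothb f -> orbit (fun t => S t f)
| orbit_der i Th Th' : orbit Th -> (forall t, 0 <= t -> isd i (Th t) (Th' t)) -> orbit Th'.

Lemma orbit_smooth Th t : orbit Th -> 0 <= t -> smoothb (Th t).
Proof.
move=> oTh t0; elim: oTh => [f sf|i F F' _ sF /(_ t t0) d]; first exact: S_smooth.
exact: smoothb_der sF d.
Qed.

Lemma orbit_space_der i Th : orbit Th ->
  exists2 Th', orbit Th' & forall t, 0 <= t -> isd i (Th t) (Th' t).
Proof.
move=> oTh.
have /choice[Th' H] : forall t, exists g, 0 <= t -> isd i (Th t) g.
  move=> t; have [t0|t0] := boolP (0 <= t); last by exists (fun=> 0).
  by have [g hg] := smoothb_isd i (orbit_smooth oTh t0); exists g.
by exists Th' => //; exact: orbit_der oTh H.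
Qed.

Lemma orbit_bounded Th k T : orbit Th -> exists M, forall t, 0 <= t <= T -> bddC k M (Th t).
Proof.
move=> oTh; elim: oTh k => [f sf|i F F' _ IH d] k; first exact: S_stable.
have [M HM] := IH k.+1; exists M => t tT; have /andP[t0 _] := tT.
exact: bddC_S (HM t tT) (d t t0).
Qed.

Lemma orbit_time_der Th : orbit Th -> exists2 Th', orbit Th' &
  forall k T, exists2 C, 0 <= C & forall t t', 0 <= t -> t <= t' -> t' <= T ->
    bddC k (C * (t' - t) ^+ 2) (fun x => Th t' x + (-1) * Th t x + (- (t' - t)) * Th' t x).
Proof.
elim=> [f sf|i F F' oF [H oH FH] d].
  by exists (fun t => S t (G f)) => [|k T]; [apply: orbit_base; exact: G_smooth|exact: S_taylor].
have [H' oH' dH] := orbit_space_der i oH; exists H' => // k T.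
have [C C0 HC] := FH k.+1 T; exists C => // t t' t0 tt' t'T.
have t'0 := le_trans t0 tt'.
exact: bddC_S (HC t t' t0 tt' t'T) (isdD (isdD (d t' t'0) (isdZ _ (d t t0))) (isdZ _ (dH t t0))).
Qed.

Lemma orbit_time_lip Th T : orbit Th -> exists2 C, 0 <= C &
  forall t t' x, 0 <= t <= T -> 0 <= t' <= T -> `|Th t' x - Th t x| <= C * `|t' - t|.
Proof.
move=> oTh; have [H oH TH] := orbit_time_der oTh.
have [C C0 HC] := TH 0%N T; have [M HM] := orbit_bounded 0 T oH.
exists (C * `|T| + `|M|) => [|t t' x]; first by rewrite addr_ge0 ?mulr_ge0.
wlog tt' : t t' / t <= t'.
  move=> W tT t'T; have [tt'|/ltW t't] := leP t t'; first exact: W.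
  by rewrite distrC (distrC t'); exact: W.
move=> /andP[t0 tT] /andP[t'0 t'T].
have h1 := bddC_bound (HC t t' t0 tt' t'T) x.
have h2 : `|H t x| <= `|M|.
  by apply: le_trans (ler_norm M); apply: (bddC_bound (HM t _)); rewrite t0.
have d0 : 0 <= t' - t by rewrite subr_ge0.
have h3 : C * (t' - t) ^+ 2 <= C * `|T| * (t' - t).
  rewrite -mulrA ler_wpM2l// expr2 ler_wpM2r//; apply: le_trans (ler_norm T); lra.
have h4 : (t' - t) * `|H t x| <= `|M| * (t' - t) by rewrite mulrC ler_wpM2r.
rewrite (ger0_norm d0) (_ : _ - _ = (Th t' x + -1 * Th t x + - (t' - t) * H t x) + (t' - t) * H t x); last by ring.
apply: (le_trans (ler_normD _ _)); rewrite [X in _ + X]normrM (ger0_norm d0); lra.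
Qed.

Lemma orbit_lip Th T : orbit Th -> exists2 C, 0 <= C &
  forall t t' x x', 0 <= t <= T -> 0 <= t' <= T ->
    `|Th t' x' - Th t x| <= C * (`|t' - t| + `|x'.1 - x.1| + `|x'.2 - x.2|).
Proof.
move=> oTh; have [C C0 HC] := orbit_time_lip T oTh; have [M HM] := orbit_bounded 1 T oTh.
exists (C + `|M|) => [|t t' x x' tT t'T]; first by rewrite addr_ge0.
have h1 := HC t t' x' tT t'T.
have Mt : bddC 1 `|M| (Th t) by apply: bddC_mono (HM t tT); exact: ler_norm.
have h2 := bddC_lip true (x'.1 - x.1) x Mt.
have h3 := bddC_lip false (x'.2 - x.2) (sh true (x'.1 - x.1) x) Mt.
have E : sh false (x'.2 - x.2) (sh true (x'.1 - x.1) x) = x'.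
  by case: x' {h1 h2 h3} => a b; rewrite /sh /=; congr pair; ring.
rewrite E in h3; set y := sh true _ x in h2 h3.
rewrite (_ : _ - _ = (Th t' x' - Th t x') + (Th t x' - Th t y) + (Th t y - Th t x)); last by ring.
apply: (le_trans (ler_normD _ _)); apply: (le_trans (lerD (ler_normD _ _) (lexx _))).
have b1 : 0 <= C * (`|x'.1 - x.1| + `|x'.2 - x.2|) by rewrite mulr_ge0// addr_ge0.
have b2 : 0 <= `|M| * `|t' - t| by rewrite mulr_ge0.
lra.
Qed.

Lemma orbit_time_isd Th Th' :
  (forall k T, exists2 C, 0 <= C & forall t t', 0 <= t -> t <= t' -> t' <= T ->
    bddC k (C * (t' - t) ^+ 2) (fun x => Th t' x + (-1) * Th t x + (- (t' - t)) * Th' t x)) ->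
  orbit Th' -> forall t x, 0 < t -> is_derive t (1 : R) (fun tau => Th tau x) (Th' t x).
Proof.
move=> TH oH t x t0; apply/is_deriveP => e e0.
have [C C0 HC] := TH 0%N (t + 1); have [D D0 HD] := orbit_time_lip (t + 1) oH.
have K0 : 0 < C + D + 1 by rewrite ltr_wpDl// addr_ge0.
exists (Num.min (Num.min t 1) (e / (C + D + 1))); first by rewrite !lt_min t0 ltr01 divr_gt0.
move=> h; rewrite !lt_min => /andP[/andP[ht h1]]; rewrite ltr_pdivlMr// => he.
have := ht; rewrite ltr_norml => /andP[ht1 _].
have hle : h <= `|h| by exact: ler_norm.
have th0 : 0 <= t + h by lra.
have key : `|Th (t + h) x - Th t x - Th' t x * h| <= (C + D) * (`|h| * `|h|).
  have [hp|hn] := leP 0 h.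
    have := bddC_bound (HC t (t + h) (ltW t0) ltac:(lra) ltac:(lra)) x.
    rewrite (_ : t + h - t = h); last by ring.
    rewrite (_ : _ + _ = Th (t + h) x - Th t x - Th' t x * h); last by ring.
    move=> H; apply: (le_trans H); rewrite (ger0_norm hp) expr2 mulrDl lerDl.
    by rewrite !mulr_ge0.
  (* For [h < 0] the expansion is based at [t + h], and the derivative is moved back to [t] by its
     Lipschitz bound in time. *)
  have h2 := bddC_bound (HC (t + h) t ltac:(lra) ltac:(lra) ltac:(lra)) x.
  have h3 := HD t (t + h) x ltac:(lra) ltac:(lra).
  have E1 : t + h - t = h by ring.
  have E2 : t - (t + h) = - h by ring.
  rewrite E1 in h3; rewrite E2 in h2.
  rewrite (_ : _ - _ = - (Th t x + -1 * Th (t + h) x + - - h * Th' (t + h) x) + (Th' (t + h) x - Th' t x) * h); last by ring.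
  apply: (le_trans (ler_normD _ _)); rewrite normrN normrM mulrDl; apply: lerD.
    by apply: (le_trans h2); rewrite sqrrN -[h ^+ 2]real_normK ?num_real// expr2.
  by rewrite mulrA ler_wpM2r.
apply: (le_trans key); rewrite mulrA ler_wpM2r//.
have := normr_ge0 h; lra.
Qed.

Lemma orbit_smooth_on Th : orbit Th ->
  smooth_on [set v : 'rV[R]_3 | 0 < v 0 0] (fun v => Th (v 0 0) (v 0 (inord 1), v 0 (inord 2))).
Proof.
move=> oTh.
pose K (g : 'rV[R]_3 -> R) := exists2 F, orbit F & g = (fun v => F (v 0 0) (v 0 (inord 1), v 0 (inord 2))).
have coord (i : 'I_3) : continuous (fun v : 'rV[R]_3 => v 0 i) by exact: coord_continuous.
apply: (@smooth_on_class 3 _ K).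
- exact: (@open_comp _ _ (fun v : 'rV[R]_3 => v 0 0) [set t : R | 0 < t] (fun v _ => coord 0 v) (@open_gt R 0)).
- by exists Th.
- move=> g [F oF ->] v /= v0; have [C C0 HC] := orbit_lip (v 0 0 + 1) oF.
  have m0 : 0 < Num.min (v 0 0) 1 by rewrite lt_min v0 ltr01.
  apply: (lipschitz_continuous_rV (C := C * 3) (d := Num.min (v 0 0) 1)) => // [|w /(_ 0) + e we].
    by rewrite mulr_ge0.
  rewrite lt_min !ltr_norml => /andP[/andP[b1 b2] /andP[b3 b4]].
  have t1 : 0 <= v 0 0 <= v 0 0 + 1 by lra.
  have t2 : 0 <= w 0 0 <= v 0 0 + 1 by lra.
  apply: (le_trans (HC _ _ _ _ t1 t2)) => /=.
  rewrite -mulrA ler_wpM2l//; have := we 0; have := we (inord 1); have := we (inord 2); lra.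
- move=> g j [F oF ->]; have [->|->|->] := ord3_cases j.
  + have [H oH FH] := orbit_time_der oF.
    exists (fun v => H (v 0 0) (v 0 (inord 1), v 0 (inord 2))); first by exists H.
    move=> v /= v0; rewrite [in X in is_derive _ _ X](row3E v).
    under eq_fun do rewrite row3_shift0 row3_0 row3_1 row3_2.
    by apply/(is_derive_shift (fun t => F t (v 0 (inord 1), v 0 (inord 2)))); rewrite addr0; exact: (orbit_time_isd FH oH).
  + have [H oH FH] := orbit_space_der true oF.
    exists (fun v => H (v 0 0) (v 0 (inord 1), v 0 (inord 2))); first by exists H.
    move=> v /= v0; rewrite [in X in is_derive _ _ X](row3E v).
    under eq_fun do rewrite row3_shift1 row3_0 row3_1 row3_2.
    exact: (FH _ (ltW v0)).
  + have [H oH FH] := orbit_space_der false oF.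
    exists (fun v => H (v 0 0) (v 0 (inord 1), v 0 (inord 2))); first by exists H.
    move=> v /= v0; rewrite [in X in is_derive _ _ X](row3E v).
    under eq_fun do rewrite row3_shift2 row3_0 row3_1 row3_2.
    exact: (FH _ (ltW v0)).
Unshelve. all: by end_near. Qed.

Lemma orbit_continuous Th : orbit Th ->
  {within [set tx : R * (R * R) | 0 <= tx.1], continuous (fun tx => Th tx.1 tx.2)}.
Proof.
move=> oTh; apply/subspace_continuousP => -[t x] /= t0.
have [C C0 HC] := orbit_lip (t + 1) oTh.
apply/cvgrPdist_le => e e0.
have K0 : 0 < 3 * C + 1 by rewrite ltr_wpDl// mulr_ge0.
have d0 : 0 < e / (3 * C + 1) by rewrite divr_gt0.
have m0 : 0 < Num.min (e / (3 * C + 1)) 1 by rewrite lt_min d0 ltr01.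
rewrite near_withinE; near=> tx => /= tx0.
have : ball ((t, x) : R * (R * R)) (Num.min (e / (3 * C + 1)) 1) tx by near: tx; exact: nbhsx_ballx.
move=> [/= b1 [/= b2 b3]]; move: b1 b2 b3; rewrite /ball /= (distrC t) (distrC x.1) (distrC x.2) !lt_min => /andP[b1 c1] /andP[b2 _] /andP[b3 _].
move: c1; rewrite ltr_norml => /andP[c1 c2].
have t1 : 0 <= t <= t + 1 by lra.
have t2 : 0 <= tx.1 <= t + 1 by lra.
rewrite distrC; apply: (le_trans (HC _ _ _ _ t1 t2)) => /=.
apply: (@le_trans _ _ (C * (3 * (e / (3 * C + 1))))); first by rewrite ler_wpM2l//; lra.
rewrite (_ : C * _ = e * (3 * C) / (3 * C + 1)); last by ring.
by rewrite ler_pdivrMr// ler_wpM2l ?(ltW e0)// lerDl.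
Unshelve. all: by end_near. Qed.

End Regularity.

(** * Existence of solutions *)

Section Existence.
Context {R : realType}.

Lemma solution_exists (s : R) (u : R * R -> R * R) (f : R * R -> R) : 0 < s -> s < 1 ->
  smoothb (fun x => (u x).1) -> smoothb (fun x => (u x).2) -> smoothb f ->
  exists th, is_solution s u f th.
Proof.
move=> s0 s1 su1 su2 sf.
pose U i x := if i then (u x).1 else (u x).2.
have sU i : smoothb (U i) by case: i.
have [B B0 UB'] := exists_common_bound 0 sU.
have UB i x : `|U i x| <= B by exact: bddC_bound (UB' i) x.
pose L := drift_diffusion s U B; pose h := cfl s B; pose r := rate s.
have h0 : 0 < h by exact: cfl_gt0 UB.
have r14 : 4^-1 <= r by have := rate_ge s0; rewrite -/r; lra.
have r1 : r < 1 by exact: rate_lt1.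
have Ls n g : smoothb g -> smoothb (L n g) by exact: drift_diffusion_smooth.
have Ll n g k a : smoothb g -> smoothb k -> L n (fun x => a * g x + k x) = (fun x => a * L n g x + L n k x).
  exact: drift_diffusion_lin.
have L0 := euler_stable0 s0 s1 UB.
have Lk := euler_stable s0 s1 sU UB.
have Lb := drift_diffusion_bounded s0 s1 sU UB.
have Lc := drift_diffusion_cauchy s0 s1 sU UB.
have SS t g : 0 <= t -> smoothb g -> smoothb (semigroup L h t g).
  exact: (semigroup_smooth h0 r14 r1 Ls Ll Lk Lb Lc).
have SB := semigroup_stable h0 r14 r1 Ls Ll Lk Lb Lc.
have ST := semigroup_taylor h0 r14 r1 Ls Ll Lk Lb Lc.
have GS g : smoothb g -> smoothb (generator L g) by exact: (generator_smooth r14 r1 Ls Lc).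
have o := orbit_base (semigroup L h) sf.
have [M fM] := sf 0%N.
exists (fun t => semigroup L h t f); split; first exact: (orbit_smooth_on SS SB ST GS o).
split; first exact: (orbit_continuous SS SB ST GS o).
split; first by move=> x; rewrite semigroup0.
split.
  exists M => t x t0.
  by apply: (bddC_bound (semigroup_stable0 h0 r14 r1 Ls Ll L0 Lk Lb Lc t0 sf fM)).
move=> t x t0; have sT := SS t f (ltW t0) sf.
split; first exact: fraclap_defined_smoothb.
have [g1 fg1] := smoothb_isd true sT; have [g2 fg2] := smoothb_isd false sT.
have oG := orbit_base (semigroup L h) (GS f sf).
have dT := orbit_time_isd SS SB ST GS (fun k T => ST k T f sf) oG x t0.
rewrite /dt /d1 /d2 (is_derive_derive1 dT).
rewrite (is_derive_derive1 (sh_true_isd x fg1)) (is_derive_derive1 (sh_false_isd x fg2)).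
(* The time derivative appears as the evolution of [generator L f]; commutation turns it into the
   generator applied to the solution, as in the equation. *)
rewrite -(semigroup_generator h0 r14 r1 Ls Ll Lk Lb Lc (ltW t0) sf).
by rewrite (drift_diffusion_generator s0 s1 UB _ sT fg1 fg2)/=; ring.
Qed.

End Existence.

(** * Regularity of the flow and of the ramp *)

Section FlowRegularity.
Context {R : realType}.
Implicit Types (i j : bool) (x p : R * R) (f h : R * R -> R) (k : nat) (P : (R * R -> R) -> Prop).

Lemma smoothb_smooth2 f : smoothb f -> smooth2 f.
Proof.
move=> sf.
have c0 (v : 'rV[R]_2) i (a : R) : (v + a *: delta_mx 0 (if i then 0 else inord 1)) 0 0 = v 0 0 + (if i then a else 0).
  by case: i; rewrite !mxE ?[0 == inord 1]eq_sym ?inord1_neq0 ?eqxx /= ?mulr1 ?mulr0.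
have c1 (v : 'rV[R]_2) i (a : R) : (v + a *: delta_mx 0 (if i then 0 else inord 1)) 0 (inord 1) = v 0 (inord 1) + (if i then 0 else a).
  by case: i; rewrite !mxE ?inord1_neq0 ?eqxx /= ?mulr1 ?mulr0.
pose K (g : 'rV[R]_2 -> R) := exists2 F, smoothb F & g = (fun v => F (v 0 0, v 0 (inord 1))).
apply: (@smooth_on_class R 2 setT K); first exact: openT.
- by exists f.
- move=> g [F sF ->] v _; have [M FM] := sF 1%N; have M0 := bddC_ge0 FM.
  apply: (lipschitz_continuous_rV (C := M * 2) (d := 1)) => // [|w _ e we]; first by rewrite mulr_ge0.
  have h1 := bddC_lip true (w 0 0 - v 0 0) (v 0 0, v 0 (inord 1)) FM.
  have h2 := bddC_lip false (w 0 (inord 1) - v 0 (inord 1)) (w 0 0, v 0 (inord 1)) FM.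
  rewrite /sh /= (addrC (v 0 0)) subrK in h1; rewrite /sh /= (addrC (v 0 (inord 1))) subrK in h2.
  rewrite -[X in `|X|](subrKA (F (w 0 0, v 0 (inord 1)))); apply: (le_trans (ler_normD _ _)).
  have := ler_wpM2l M0 (we 0); have := ler_wpM2l M0 (we (inord 1)); lra.
- move=> g j [F sF ->].
  have [i ->] : exists i : bool, j = if i then 0 else inord 1.
    by case: j => -[|[|//]] hj; [exists true|exists false]; apply/val_inj; rewrite /= ?inordK.
  have [F' FF'] := smoothb_isd i sF.
  exists (fun v => F' (v 0 0, v 0 (inord 1))); first by exists F' => //; exact: smoothb_der FF'.
  move=> v _; under eq_fun do rewrite c0 c1.
  have := FF' (v 0 0, v 0 (inord 1)); congr is_derive.
  by apply/funext => a; case: (i); rewrite /sh /= ?addr0.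
Qed.

Inductive polynomial_in P : (R * R -> R) -> Prop :=
| pi_gen f : P f -> polynomial_in P f
| pi_smooth f : smoothb f -> polynomial_in P f
| pi_add f h : polynomial_in P f -> polynomial_in P h -> polynomial_in P (fun x => f x + h x)
| pi_mul f h : polynomial_in P f -> polynomial_in P h -> polynomial_in P (fun x => f x * h x).

(** C^k bounds on the members of [P] pass to polynomials in them, hence to their first derivatives,
    and so become C^(k+1) bounds on the members. *)
Lemma smoothb_closed P : (forall f, P f -> exists M, forall x, `|f x| <= M) ->
  (forall f i, P f -> exists2 h, isd i f h & polynomial_in P h) ->
  forall f, P f -> smoothb f.
Proof.
move=> Pb Pd f Pf k; elim: k f Pf => [|k IH] f Pf; first by have [M fM] := Pb f Pf; exists M.
have alg h : polynomial_in P h -> exists M, bddC k M h.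
  elim=> [{}h /IH //|{}h|h1 h2 _ [M1 b1] _ [M2 b2]|h1 h2 _ [M1 b1] _ [M2 b2]]; first by move=> /(_ k).
    by exists (M1 + M2); exact: bddCD.
  by exists (2 ^+ k * (M1 * M2)); exact: bddCM.
have [M fM] := Pb f Pf.
have [h1 d1 /alg[M1 b1]] := Pd f true Pf; have [h2 d2 /alg[M2 b2]] := Pd f false Pf.
have [p1 p2] := (bddC_ge0 b1, bddC_ge0 b2).
have p0 : 0 <= M := le_trans (normr_ge0 _) (fM (0, 0)).
exists (M + M1 + M2); split=> [x|[]]; first by apply: le_trans (fM x) _; lra.
  by exists h1; split=> //; apply: bddC_mono b1; lra.
by exists h2; split=> //; apply: bddC_mono b2; lra.
Qed.

Lemma isd_eq i f (h h' : R * R -> R) : isd i f h -> (forall x, h x = h' x) -> isd i f h'.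
Proof. by move=> d /funext <-. Qed.

Lemma isd_ext i (f f' h : R * R -> R) : isd i f h -> (forall x, f x = f' x) -> isd i f' h.
Proof. by move=> d /funext <-. Qed.

Definition co i x : R := if i then x.1 else x.2.

Lemma isd_co j i : isd j (co i) (fun=> (i == j)%:R).
Proof.
move=> p; case: i; case: j; rewrite /sh /co /=; try exact: derC.
  by apply: der_eq (derD (derC _ p.1) (derI _)) _; rewrite add0r.
by apply: der_eq (derD (derC _ p.2) (derI _)) _; rewrite add0r.
Qed.

Lemma nrm2_co x : nrm2 x = co true x * co true x + co false x * co false x.
Proof. by rewrite /nrm2 /co !expr2. Qed.

Lemma isd_nrm2 j : isd j (@nrm2 R) (fun x => 2 * co j x).
Proof.
have H i := isdM (@isd_co j i) (@isd_co j i).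
apply: (isd_ext _ (fun x => esym (nrm2_co x))).
by apply: isd_eq (isdD (H true) (H false)) _ => x; case: j {H} => /=; ring.
Qed.

(** * Regularised radius and directions *)

Section Weight.
Variable e : R.
Hypothesis e0 : 0 < e.

Definition wpow (c : R) x : R := (nrm2 x + e ^+ 2) `^ c.
Definition wt x : R := wpow (- 2^-1) x.
(** Components of a regularised unit vector, [wt] being the inverse regularised radius. Both are
    bounded and their derivatives are polynomials in them, as [smoothb_closed] requires. *)
Definition dir i x : R := co i x * wt x.

Lemma nrm2e_gt0 x : 0 < nrm2 x + e ^+ 2.
Proof. by rewrite ltr_wpDl ?nrm2_ge0 ?exprn_gt0. Qed.

Lemma wpow_gt0 c x : 0 < wpow c x.
Proof. by rewrite powR_gt0// nrm2e_gt0. Qed.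

Lemma wt_sqr x : wt x * wt x = (nrm2 x + e ^+ 2)^-1.
Proof.
rewrite /wt /wpow -powRD; last by apply/implyP => _; rewrite gt_eqF ?nrm2e_gt0.
rewrite (_ : - 2^-1 - 2^-1 = -1); last by field.
by rewrite powR_inv1// ltW// nrm2e_gt0.
Qed.

Lemma wpow_pred c x : wpow (c - 1) x = wpow c x * (wt x * wt x).
Proof.
rewrite wt_sqr /wpow powRD; last by apply/implyP => _; rewrite gt_eqF ?nrm2e_gt0.
by rewrite powR_inv1// ltW// nrm2e_gt0.
Qed.

Lemma isd_wpow j c : isd j (wpow c) (fun x => 2 * c * wpow c x * (dir j x * wt x)).
Proof.
move=> p; have h := isdD (isd_nrm2 j) (@isd_cst R j (e ^+ 2)) p.
have pos : 0 < nrm2 (sh j 0 p) + e ^+ 2 by exact: nrm2e_gt0.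
apply: der_eq (der_comp h (der_powR c pos)) _.
rewrite sh0 -/(wpow _ p) wpow_pred /dir; ring.
Qed.

Lemma dir_le1 i x : `|dir i x| <= 1.
Proof.
have h : dir i x ^+ 2 <= 1.
  rewrite /dir exprMn [wt x ^+ 2]expr2 wt_sqr ler_pdivrMr ?nrm2e_gt0// mul1r.
  have := sqr_ge0 e; have := sqr_ge0 x.1; have := sqr_ge0 x.2; rewrite /nrm2 /co; case: i; lra.
by rewrite -(@ler_pXn2r _ 2) ?nnegrE// real_normK ?num_real// expr1n.
Qed.

Lemma wpow_le c x : c <= 0 -> `|wpow c x| <= (e ^+ 2) `^ c.
Proof.
move=> c0; rewrite gtr0_norm ?wpow_gt0// -[c]opprK; apply: ler_powRN; last by lra.
- by rewrite exprn_gt0.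
- by rewrite lerDr nrm2_ge0.
Qed.

Lemma isd_wt j : isd j wt (fun x => - (wt x * (dir j x * wt x))).
Proof. by apply: isd_eq (isd_wpow j (- 2^-1)) _ => x; rewrite -/(wt x); field. Qed.

Lemma isd_dir j i : isd j (dir i) (fun x => (i == j)%:R * wt x - dir i x * (dir j x * wt x)).
Proof. by apply: isd_eq (isdM (@isd_co j i) (isd_wt j)) _ => x; rewrite /dir; ring. Qed.

Lemma smoothb_wt_dir : smoothb wt /\ forall i, smoothb (dir i).
Proof.
pose P f := f = wt \/ exists i, f = dir i.
have neg f : polynomial_in P f -> polynomial_in P (fun x => - f x).
  move=> pf; rewrite (_ : (fun x => - f x) = (fun x => -1 * f x)); last by apply/funext => x; rewrite mulN1r.
  by apply: pi_mul => //; apply: pi_smooth; exact: smoothb_cst.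
have pw : polynomial_in P wt by apply: pi_gen; left.
have pd i : polynomial_in P (dir i) by apply: pi_gen; right; exists i.
have H f : P f -> smoothb f.
  apply: smoothb_closed => [{}f [->|[i ->]]|{}f j [->|[i ->]]].
  - by exists ((e ^+ 2) `^ (- 2^-1)) => x; apply: wpow_le; rewrite oppr_le0 invr_ge0.
  - by exists 1 => x; exact: dir_le1.
  - by eexists; [exact: isd_wt|do 2?apply: pi_mul => //; apply: neg; apply: pi_mul => //; exact: pi_mul].
  - eexists; first exact: isd_dir.
    apply: pi_add; first by apply: pi_mul => //; apply: pi_smooth; exact: smoothb_cst.
    by apply: neg; apply: pi_mul => //; exact: pi_mul.
by split=> [|i]; apply: H; [left|right; exists i].
Qed.

Lemma smoothb_wpow c : c <= 0 -> smoothb (wpow c).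
Proof.
move=> c0; have [sw sd] := smoothb_wt_dir.
apply: (@smoothb_closed (fun f => f = wpow c)) => [f ->|f j ->|//].
  by exists ((e ^+ 2) `^ c) => x; exact: wpow_le.
eexists; first exact: isd_wpow.
by do 2?apply: pi_mul; [apply: pi_smooth; exact: smoothb_cst|exact: pi_gen|apply: pi_smooth; exact: sd|exact: pi_smooth].
Qed.

End Weight.

(** * Derivatives of the flow *)

Section Flow.
Variables (kp dl g : R).
Hypotheses (kp0 : 0 < kp) (dl0 : 0 < dl) (g0 : 0 < g) (g2 : g < 2).

Local Notation X := (dir dl).
Local Notation Y := (dir 1).
Local Notation W := (wt dl).
Local Notation V := (wt 1).

(** Dimensionless factor of the flow: a polynomial in the bounded directions that is left once
    strain, sign and coordinate are taken out. *)
Definition shear i x : R := - 1 + g * X (~~ i) x ^+ 2 + 4 * Y (~~ i) x ^+ 2.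
Definition sgb i : R := if i then 1 else - 1.
Definition uflow i x : R := if i then (flow kp dl g x).1 else (flow kp dl g x).2.

Lemma strainE x : strain kp dl g (nrm2 x) = kp * wpow dl (- (g / 2)) x * (V x * V x) ^+ 2.
Proof. by rewrite wt_sqr// /strain /wpow expr1n (addrC 1). Qed.

Lemma strain_rateE x : strain_rate dl g (nrm2 x) = g / 2 * (W x * W x) + 2 * (V x * V x).
Proof. by rewrite !wt_sqr// /strain_rate expr1n (addrC 1). Qed.

Lemma uflowE i x : uflow i x = sgb i * strain kp dl g (nrm2 x) * co i x * shear i x.
Proof.
rewrite /uflow /flow strain_rateE /shear /dir /sgb /co; by case: i => /=; field.
Qed.

Lemma uflow_smooth i : smoothb (uflow i).
Proof.
have [sW sX] := smoothb_wt_dir dl0; have [sV sY] := smoothb_wt_dir ltr01.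
have sA : smoothb (wpow dl (- (g / 2))) by apply: smoothb_wpow => //; rewrite oppr_le0 divr_ge0// ltW.
have E : uflow i = (fun x => sgb i * kp * (wpow dl (- (g / 2)) x * (Y i x * (V x * (V x * V x)))) *
   (-1 + g * (X (~~ i) x * X (~~ i) x) + 4 * (Y (~~ i) x * Y (~~ i) x))).
  by apply/funext => x; rewrite uflowE strainE /shear /dir; ring.
rewrite E.
apply: smoothbM.
  exact: smoothbZ (smoothbM sA (smoothbM (sY i) (smoothbM sV (smoothbM sV sV)))).
apply: smoothbD; last by apply: smoothbZ; apply: smoothbM.
by apply: smoothbD; [exact: smoothb_cst|apply: smoothbZ; exact: smoothbM].
Qed.

(** Arranged so that each derivative of the flow is the strain times a bounded polynomial: the
    coordinate [co i] absorbs the inverse radius created by differentiation. *)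
Definition shear_der j i x : R :=
  (i == j)%:R * shear i x - (g * (X j x * X i x) + 4 * (Y j x * Y i x)) * shear i x
  + 2 * g * (X (~~ i) x * ((~~ i == j)%:R * X i x - X (~~ i) x * (X j x * X i x)))
  + 8 * (Y (~~ i) x * ((~~ i == j)%:R * Y i x - Y (~~ i) x * (Y j x * Y i x))).

Lemma isd_uflow j i : isd j (uflow i) (fun x => sgb i * strain kp dl g (nrm2 x) * shear_der j i x).
Proof.
have dA := isd_wpow dl0 j (- (g / 2)); have dV := isd_wt ltr01 j.
have dX := isd_dir dl0 j (~~ i); have dY := isd_dir ltr01 j (~~ i).
have dS : isd j (shear i) (fun x => g * (2 * (X (~~ i) x * ((~~ i == j)%:R * W x - X (~~ i) x * (X j x * W x))))
   + 4 * (2 * (Y (~~ i) x * ((~~ i == j)%:R * V x - Y (~~ i) x * (Y j x * V x))))).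
  apply: (isd_ext (f := fun x => -1 + g * (X (~~ i) x * X (~~ i) x) + 4 * (Y (~~ i) x * Y (~~ i) x))).
    apply: isd_eq (isdD (isdD (@isd_cst R j (-1)) (isdZ g (isdM dX dX))) (isdZ 4 (isdM dY dY))) _ => x; ring.
  by move=> x; rewrite /shear !expr2.
have H := isdZ (sgb i * kp) (isdM (isdM (isdM dA (isdM (isdM dV dV) (isdM dV dV))) (@isd_co j i)) dS).
apply: isd_ext (isd_eq H _) _ => x; last by rewrite uflowE strainE; ring.
rewrite strainE /shear_der /shear /dir; move: (i == j)%:R (~~ i == j)%:R => d1 d2.
by field.
Qed.

Lemma normM_le (a b A B : R) : `|a| <= A -> `|b| <= B -> `|a * b| <= A * B.
Proof. by move=> ha hb; rewrite normrM; apply: ler_pM. Qed.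

Lemma normD_le (a b A B : R) : `|a| <= A -> `|b| <= B -> `|a + b| <= A + B.
Proof. by move=> ha hb; apply: le_trans (ler_normD _ _) (lerD ha hb). Qed.

Lemma normB_le (a b A B : R) : `|a| <= A -> `|b| <= B -> `|a - b| <= A + B.
Proof. by move=> ha hb; apply: le_trans (ler_normB _ _) (lerD ha hb). Qed.

Lemma normZ_le (k a A : R) : 0 <= k -> `|a| <= A -> `|k * a| <= k * A.
Proof. by move=> k0 ha; rewrite normrM (ger0_norm k0) ler_wpM2l. Qed.

Lemma normr_bool_le1 (b : bool) : `|b%:R : R| <= 1.
Proof. by case: b; rewrite ?normr1 ?normr0. Qed.

Lemma shear_le i x : `|shear i x| <= 7.
Proof.
have hX := dir_le1 dl0 (~~ i) x; have hY := dir_le1 ltr01 (~~ i) x.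
have := normD_le (normD_le (_ : `|- 1 : R| <= 1) (normZ_le (ltW g0) (normM_le hX hX))) (normZ_le (ler0n R 4) (normM_le hY hY)).
rewrite normrN1 lexx /shear !expr2 => /(_ isT) h; apply: (le_trans h).
by move: (g2); lra.
Qed.

(** With [g < 2] the four summands are at most 7, 42, 8 and 16. *)
Lemma shear_der_le j i x : `|shear_der j i x| <= 73.
Proof.
have hX b := dir_le1 dl0 b x; have hY b := dir_le1 ltr01 b x.
have m := shear_le i x; have g0' := ltW g0; have gg : 0 <= 2 * g by rewrite mulr_ge0.
have t1 := normM_le (normr_bool_le1 (i == j)) m.
have t2 := normM_le (normD_le (normZ_le g0' (normM_le (hX j) (hX i))) (normZ_le (ler0n R 4) (normM_le (hY j) (hY i)))) m.
have t3 := normZ_le gg (normM_le (hX (~~ i)) (normB_le (normM_le (normr_bool_le1 (~~ i == j)) (hX i)) (normM_le (hX (~~ i)) (normM_le (hX j) (hX i))))).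
have t4 := normZ_le (ler0n R 8) (normM_le (hY (~~ i)) (normB_le (normM_le (normr_bool_le1 (~~ i == j)) (hY i)) (normM_le (hY (~~ i)) (normM_le (hY j) (hY i))))).
apply: (le_trans (normD_le (normD_le (normB_le t1 t2) t3) t4)); move: (g2); lra.
Qed.

Lemma flow_div_free : div_free (flow kp dl g).
Proof.
move=> p; rewrite /d1 /d2.
rewrite (is_derive_derive1 (sh_true_isd p (isd_uflow true true))).
rewrite (is_derive_derive1 (sh_false_isd p (isd_uflow false false))).
by rewrite /sgb /shear_der /shear /=; ring.
Qed.

Lemma smooth_flow : smooth_field (flow kp dl g).
Proof. by split; apply: smoothb_smooth2; [exact: (uflow_smooth true)|exact: (uflow_smooth false)]. Qed.

Lemma strain_ge0 x : 0 <= strain kp dl g (nrm2 x).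
Proof. by apply: ltW; apply: strain_gt0 => //; exact: nrm2_ge0. Qed.

Lemma norm_sgb i : `|sgb i| = 1.
Proof. by case: i; rewrite ?normrN1 ?normr1. Qed.

Lemma uflow_le i x : `|uflow i x| <= 7 * (strain kp dl g (nrm2 x) * enorm x).
Proof.
rewrite uflowE 3!normrM norm_sgb mul1r (ger0_norm (strain_ge0 x)) mulrC.
apply: ler_pM => //; [exact: mulr_ge0 (strain_ge0 x) _|exact: shear_le|].
apply: ler_wpM2l; first exact: strain_ge0.
by case: i; [exact: ler_normfst_enorm|exact: ler_normsnd_enorm].
Qed.

Lemma uflow_der_le j i x : `|sgb i * strain kp dl g (nrm2 x) * shear_der j i x| <= 73 * strain kp dl g (nrm2 x).
Proof.
rewrite 2!normrM norm_sgb mul1r (ger0_norm (strain_ge0 x)) mulrC.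
by apply: ler_wpM2r; [exact: strain_ge0|exact: shear_der_le].
Qed.

Lemma enorm_flow_le x : enorm (flow kp dl g x) <= 14 * (strain kp dl g (nrm2 x) * enorm x).
Proof.
apply: (le_trans (ler_enorm_sum _)).
have := uflow_le true x; have := uflow_le false x; rewrite /uflow; lra.
Qed.

End Flow.

Lemma sup_norm_le (f : R * R -> R) (M : R) : (forall x, `|f x| <= M) -> (sup_norm f <= M%:E)%E.
Proof. by move=> fM; apply: ge_ereal_sup => _ [x _ <-]; rewrite lee_fin. Qed.

Lemma d1_isd (f h : R * R -> R) : isd true f h -> d1 f = h.
Proof. by move=> fh; apply/funext => x; exact: is_derive_derive1 (sh_true_isd x fh). Qed.

Lemma d2_isd (f h : R * R -> R) : isd false f h -> d2 f = h.
Proof. by move=> fh; apply/funext => x; exact: is_derive_derive1 (sh_false_isd x fh). Qed.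

Lemma C2norm_le (f : R * R -> R) (M : R) : bddC 2 M f -> (C2norm f <= (6 * M)%:E)%E.
Proof.
move=> [fM fd]; have [f1 [d1f [f1M f1d]]] := fd true; have [f2 [d2f [f2M f2d]]] := fd false.
have [f11 [d11 [f11M _]]] := f1d true; have [f12 [d12 [f12M _]]] := f1d false.
have [f22 [d22 [f22M _]]] := f2d false.
rewrite /C2norm (d1_isd d1f) (d2_isd d2f) (d1_isd d11) (d2_isd d12) (d2_isd d22).
rewrite (_ : (6 * M)%:E = M%:E + M%:E + M%:E + M%:E + M%:E + M%:E)%E; last first.
  by rewrite -!EFinD; congr EFin; ring.
by do 5?apply: leeD; exact: sup_norm_le.
Qed.

Lemma rampE (a mu : R) : ramp a mu = (fun x => a * dir mu true x).
Proof. by []. Qed.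

Lemma smoothb_ramp (a mu : R) : 0 < mu -> smoothb (ramp a mu).
Proof. by move=> mu0; rewrite rampE; apply: smoothbZ; exact: (smoothb_wt_dir mu0).2. Qed.

(** The amplitude depends on [mu] alone, so it can be fixed before the modulus is given. *)
Lemma small_ramp (mu : R) : 0 < mu -> exists2 a, 0 < a & (C2norm (ramp a mu) <= 1)%E.
Proof.
move=> mu0; have [M fM] := (smoothb_wt_dir mu0).2 true 2%N; have M0 := bddC_ge0 fM.
have a0 : 0 < (6 * (M + 1))^-1 by rewrite invr_gt0 mulr_gt0// ltr_wpDl.
exists (6 * (M + 1))^-1 => //.
have := C2norm_le (bddCZ (6 * (M + 1))^-1 fM); rewrite rampE => h; apply: (le_trans h).
rewrite lee_fin (gtr0_norm a0) mulrCA mulrC ler_pdivrMr ?mulr_gt0 ?ltr_wpDl//; lra.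
Qed.

End FlowRegularity.

(** * Norms of the flow *)

Section FlowNorm.
Context {R : realType}.
Implicit Types (x y : R * R) (i j : bool) (t : R).

Lemma powR_subadditive (a b al : R) : 0 <= a -> 0 <= b -> 0 < al -> al <= 1 ->
  (a + b) `^ al <= a `^ al + b `^ al.
Proof.
move=> a0 b0 al0 al1.
have [->|an0] := eqVneq a 0; first by rewrite add0r powR0 ?gt_eqF// add0r.
have [->|bn0] := eqVneq b 0; first by rewrite addr0 powR0 ?gt_eqF// addr0.
have {an0}a0 : 0 < a by rewrite lt0r an0.
have {bn0}b0 : 0 < b by rewrite lt0r bn0.
have key (c : R) : 0 < c -> c <= a + b -> c * (a + b) `^ (- (1 - al)) <= c `^ al.
  move=> c0 cab; rewrite (_ : c `^ al = c * c `^ (- (1 - al))).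
    by rewrite ler_pM2l//; apply: ler_powRN => //; lra.
  rewrite -{2}(powRr1 (ltW c0)) -powRD; last by apply/implyP => _; rewrite gt_eqF.
  by congr (_ `^ _); ring.
have ab0 : 0 < a + b by exact: addr_gt0.
have -> : (a + b) `^ al = a * (a + b) `^ (- (1 - al)) + b * (a + b) `^ (- (1 - al)).
  rewrite -mulrDl -{2}(powRr1 (ltW ab0)) -powRD; last by apply/implyP => _; rewrite gt_eqF.
  by congr (_ `^ _); ring.
by apply: lerD; apply: key => //; lra.
Qed.

(** [Q] is a primitive of the bound on [F'], so [Q - F] and [Q + F] are nondecreasing; subadditivity
    of the power bounds the increment of [Q] independently of [d]. *)
Lemma holder_halfline (F F' : R -> R) (C al d : R) : 0 < al -> al <= 1 -> 0 < d -> 0 <= C ->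
  (forall t, is_derive t (1 : R) F (F' t)) ->
  (forall t, 0 <= t -> `|F' t| <= C * (t + d) `^ (al - 1)) ->
  forall a b, 0 <= a -> a <= b -> `|F b - F a| <= C / al * (b - a) `^ al.
Proof.
move=> al0 al1 d0 C0 dF F'C a b a0 ab.
pose Q t := C / al * (t + d) `^ al.
have dQ t : 0 <= t -> is_derive t (1 : R) Q (C * (t + d) `^ (al - 1)).
  move=> t0; have td : 0 < t + d by rewrite ltr_wpDl.
  have h := der_comp (derD (derI t) (derC t d)) (der_powR al td).
  by apply: der_eq (derM (derC t (C / al)) h) _; field; rewrite gt_eqF.
have QE : Q b - Q a <= C / al * (b - a) `^ al.
  rewrite /Q -mulrBr ler_wpM2l ?divr_ge0 ?(ltW al0)// lerBlDl.
  rewrite (_ : b + d = (a + d) + (b - a)); last by ring.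
  by apply: powR_subadditive => //; lra.
have h1 : Q a - F a <= Q b - F b.
  apply: (der_ge0_le (f := fun t => Q t - F t) (df := fun t => C * (t + d) `^ (al - 1) - F' t) ab) => t /andP[ta tb].
    by apply: derB => //; apply: dQ; lra.
  by have := F'C t ltac:(lra); rewrite ler_norml; lra.
have h2 : Q a + F a <= Q b + F b.
  apply: (der_ge0_le (f := fun t => Q t + F t) (df := fun t => C * (t + d) `^ (al - 1) + F' t) ab) => t /andP[ta tb].
    by apply: derD => //; apply: dQ; lra.
  by have := F'C t ltac:(lra); rewrite ler_norml; lra.
by apply: le_trans QE; rewrite ler_norml; lra.
Qed.

(** The 4 is a factor 2 for replacing [t^2 + d^2] by [(t + d)^2] and a factor 2 for intervals that
    cross the origin. *)
Lemma holder_line (F F' : R -> R) (C al d : R) : 0 < al -> al <= 1 -> 0 < d -> 0 <= C ->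
  (forall t, is_derive t (1 : R) F (F' t)) ->
  (forall t, `|F' t| <= C * (t ^+ 2 + d ^+ 2) `^ (- ((1 - al) / 2))) ->
  forall a b, `|F b - F a| <= 4 * C / al * `|b - a| `^ al.
Proof.
move=> al0 al1 d0 C0 dF F'C.
have w t : 0 <= t -> (t ^+ 2 + d ^+ 2) `^ (- ((1 - al) / 2)) <= 2 * (t + d) `^ (al - 1).
  move=> t0; have td : 0 < t + d by rewrite ltr_wpDl.
  have td2 : 0 < (t + d) / 2 by rewrite divr_gt0.
  have h : ((t + d) / 2) ^+ 2 <= t ^+ 2 + d ^+ 2.
    by have := sqr_ge0 (t - d); have := sqr_ge0 t; have := sqr_ge0 d; rewrite sqrrB; lra.
  apply: (le_trans (ler_powRN (exprn_gt0 2 td2) h _)); first by lra.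
  rewrite -powR_mulrn ?(ltW td2)// -powRrM (_ : 2%:R * - ((1 - al) / 2) = al - 1); last by field.
  rewrite powRM ?invr_ge0 ?(ltW td)// mulrC ler_wpM2r ?powR_ge0//.
  rewrite -(powR_inv1 (_ : 0 <= 2))// -powRrM -[leRHS](powRr1 (_ : 0 <= 2))//.
  by apply: ler_powR; [rewrite ler1n|lra].
have half (f f' : R -> R) : (forall t, is_derive t (1 : R) f (f' t)) ->
    (forall t, `|f' t| <= C * (t ^+ 2 + d ^+ 2) `^ (- ((1 - al) / 2))) ->
    forall a b, 0 <= a -> a <= b -> `|f b - f a| <= 2 * C / al * (b - a) `^ al.
  move=> df f'C; apply: (holder_halfline (F' := f') (d := d)) => //; first by rewrite mulr_ge0.
  move=> t t0; apply: (le_trans (f'C t)); rewrite (mulrC 2) -mulrA ler_wpM2l//; exact: w.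
have hp := half F F' dF F'C.
have hn := half (fun t => F (- t)) (fun t => - F' (- t)) _ _.
have {}hn : forall a b, 0 <= a -> a <= b -> `|F (- b) - F (- a)| <= 2 * C / al * (b - a) `^ al.
  apply: hn => [t|t]; first by have := is_derive_reflect (dF (- t)); rewrite opprK.
  by rewrite normrN; have := F'C (- t); rewrite sqrrN.
have c0 : 0 <= 2 * C / al by rewrite divr_ge0 ?mulr_ge0 ?(ltW al0).
have E : 4 * C / al = 2 * C / al + 2 * C / al by field; rewrite gt_eqF.
move=> a b; wlog ab : a b / a <= b.
  move=> H; have [ab|/ltW ba] := leP a b; first exact: H.
  by rewrite distrC (distrC b); exact: H.
have ab0 : 0 <= b - a by rewrite subr_ge0.
rewrite (ger0_norm ab0) E mulrDl.
have q0 : 0 <= 2 * C / al * (b - a) `^ al by rewrite mulr_ge0 ?powR_ge0.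
have [a0|a0] := leP 0 a; first by have := hp a b a0 ab; lra.
have [b0|b0] := leP b 0.
  have := hn (- b) (- a) ltac:(lra) ltac:(lra); rewrite !opprK distrC.
  by rewrite (addrC (- a)); lra.
have h1 := hp 0 b (lexx 0) (ltW b0); have h2 := hn 0 (- a) (lexx 0) ltac:(lra).
rewrite subr0 in h1; rewrite oppr0 opprK addr0 in h2.
have m t : 0 <= t -> t <= b - a -> 2 * C / al * t `^ al <= 2 * C / al * (b - a) `^ al.
  by move=> t0 tb; rewrite ler_wpM2l//; apply: ge0_ler_powR; rewrite ?nnegrE// ltW.
have := m b (ltW b0) ltac:(lra); have := m (- a) ltac:(lra) ltac:(lra).
rewrite -[F b - F a](subrKA (F 0)) (addrC (F b - F 0)) => m1 m2.
apply: (le_trans (ler_normD _ _)); rewrite distrC; lra.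
Qed.

Lemma integral_le_scaled (D : set (R * R)) (F h : R * R -> R) (k I : R) : measurable D ->
  measurable_fun [set: R * R] F -> measurable_fun D h -> (forall x, 0 <= F x) -> (forall x, 0 <= h x) -> 0 <= k ->
  (forall x, D x -> F x <= k * h x) ->
  (\int[@leb2 R]_(x in D) (h x)%:E <= I%:E)%E -> (\int[@leb2 R]_(x in D) (F x)%:E <= (k * I)%:E)%E.
Proof.
move=> mD mF mh F0 h0 k0 Fh hI.
have mF' : measurable_fun D F by exact: measurable_funTS.
apply: (@le_trans _ _ (\int[@leb2 R]_(x in D) (k%:E * (h x)%:E))%E).
  apply: ge0_le_integral => //.
  - by move=> x _; rewrite lee_fin.
  - exact/measurable_EFinP.
  - have mk : measurable_fun D (fun x => k * h x) by exact: measurable_funM.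
    exact: (measurable_EFinP D (fun x => k * h x)).2 mk.
rewrite ge0_integralZl_EFin//.
- by rewrite EFinM lee_wpmul2l.
- by move=> x _; rewrite lee_fin.
- exact/measurable_EFinP.
Qed.

(** * Bounds on the X^alpha' norm uniform in the regularisation *)

Section Norms.
Variables (kp dl g : R).
Hypotheses (kp0 : 0 < kp) (dl0 : 0 < dl) (dl1 : dl <= 1) (g0 : 0 < g) (g2 : g < 2).
Local Notation S x := (strain kp dl g (nrm2 x)).

Lemma nrm2_enorm x : nrm2 x = enorm x ^+ 2.
Proof. by rewrite enorm_sqr. Qed.

Lemma inv_sqr_le1 x : ((1 + nrm2 x)^-1) ^+ 2 <= 1.
Proof.
have := nrm2_ge0 x => q0; rewrite exprn_ile1 ?invr_ge0 ?invf_le1 ?ltr_wpDr//; first lra.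
by rewrite lerDl.
Qed.

Lemma strain_le_powR x : S x <= kp * (nrm2 x + dl ^+ 2) `^ (- (g / 2)).
Proof. by rewrite /strain ler_piMr ?mulr_ge0 ?powR_ge0 ?(ltW kp0)//; exact: inv_sqr_le1. Qed.

Lemma strain_enorm_le1 x : g <= 1 -> S x * enorm x <= kp.
Proof.
move=> g1; have q0 := nrm2_ge0 x; set q := nrm2 x in q0 *.
have d2 : dl ^+ 2 <= 1 by rewrite exprn_ile1// ltW.
have d20 : 0 < dl ^+ 2 by rewrite exprn_gt0.
have z0 : 0 < q + dl ^+ 2 by lra.
have ez : enorm x <= (q + dl ^+ 2) `^ 2^-1.
  by rewrite powR12_sqrt ?(ltW z0)// /enorm -/(nrm2 x) ler_wsqrtr// lerDl ltW.
have h : (q + dl ^+ 2) `^ (- (g / 2)) * enorm x <= 1 + q.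
  apply: (@le_trans _ _ ((q + dl ^+ 2) `^ (- (g / 2)) * (q + dl ^+ 2) `^ 2^-1)).
    by rewrite ler_wpM2l ?powR_ge0.
  rewrite -powRD; last by apply/implyP => _; rewrite gt_eqF.
  apply: (@le_trans _ _ ((1 + q) `^ (- (g / 2) + 2^-1))).
    by apply: ge0_ler_powR; rewrite ?nnegrE; lra.
  rewrite -[leRHS]powRr1; last by lra.
  by apply: ler_powR; move: (g0); lra.
rewrite /strain.
rewrite (_ : _ * _ = kp * ((q + dl ^+ 2) `^ (- (g / 2)) * enorm x * (1 + q)^-1 ^+ 2)); last by ring.
rewrite ler_piMr ?(ltW kp0)//.
have q1 : 0 < 1 + q by lra.
rewrite expr2 mulrA ler_pdivrMr// mul1r ler_pdivrMr//; nra.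
Qed.

Lemma strain_enorm_pow x : 0 < enorm x -> S x * enorm x <= kp * (enorm x `^ (1 - g) * (1 + nrm2 x)^-1 ^+ 2).
Proof.
move=> x0; rewrite /strain (_ : _ * enorm x =
  kp * ((nrm2 x + dl ^+ 2) `^ (- (g / 2)) * enorm x * (1 + nrm2 x)^-1 ^+ 2)); last by ring.
rewrite ler_pM2l//; apply: ler_wpM2r; first exact: sqr_ge0.
have -> : enorm x `^ (1 - g) = (enorm x ^+ 2) `^ (- (g / 2)) * enorm x.
  rewrite -powR_mulrn ?(ltW x0)// -powRrM -{3}(powRr1 (ltW x0)) -powRD; last by apply/implyP => _; rewrite gt_eqF.
  by congr (_ `^ _); field.
rewrite ler_wpM2r ?(ltW x0)// nrm2_enorm; apply: ler_powRN; first by rewrite exprn_gt0.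
  by rewrite lerDl sqr_ge0.
by rewrite divr_ge0// ltW.
Qed.

(** On a coordinate line the radius is at least the modulus of the running coordinate, so the
    derivative of the flow obeys the hypothesis of [holder_line] with exponent [1 - g] and the
    constant is free of [dl]. *)
Lemma uflow_coord_holder i j (p : R * R) (a : R) : g < 1 ->
  `|uflow kp dl g i (sh j a p) - uflow kp dl g i p| <= 4 * (73 * kp) / (1 - g) * `|a| `^ (1 - g).
Proof.
move=> g1.
pose F t := uflow kp dl g i (if j then (t, p.2) else (p.1, t)).
pose F' t := let x := (if j then (t, p.2) else (p.1, t)) in sgb i * S x * shear_der dl g j i x.
have dF t : is_derive t (1 : R) F (F' t).
  have E (b : R) : sh j b p = (if j then (co j p + b, p.2) else (p.1, co j p + b)) by rewrite /sh /co; case: (j).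
  have := isd_at p (t - co j p) (isd_uflow kp g dl0 j i); rewrite E subrKC => h.
  rewrite -[t](subrKC (co j p)); apply/(is_derive_shift F); rewrite /F' subrKC.
  by move: h; congr is_derive; apply/funext => b; rewrite E.
have F'C t : `|F' t| <= 73 * kp * (t ^+ 2 + dl ^+ 2) `^ (- ((1 - (1 - g)) / 2)).
  rewrite subKr; apply: (le_trans (uflow_der_le kp0 dl0 g0 g2 _ _ _)).
  rewrite -mulrA ler_wpM2l//; apply: (le_trans (strain_le_powR _)); rewrite ler_wpM2l ?(ltW kp0)//.
  apply: ler_powRN; [by rewrite ltr_wpDl ?sqr_ge0 ?exprn_gt0| |by rewrite divr_ge0// ltW].
  by rewrite lerD2r /nrm2; case: (j) => /=; rewrite ?lerDl ?lerDr sqr_ge0.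
have := @holder_line F F' (73 * kp) (1 - g) dl _ _ dl0 _ dF F'C (co j p) (co j p + a).
move=> /(_ ltac:(lra) ltac:(move: (g0); lra) (mulr_ge0 (ler0n R 73) (ltW kp0))).
rewrite addrAC subrr add0r.
by rewrite /F /co /sh; case: (j) (p) => -[p1 p2].
Qed.

Lemma uflow_holder i x y : g < 1 ->
  `|uflow kp dl g i x - uflow kp dl g i y| <= 8 * (73 * kp) / (1 - g) * Defs.edist x y `^ (1 - g).
Proof.
move=> g1; set z := sh true (x.1 - y.1) y.
have h1 := uflow_coord_holder i true y (x.1 - y.1) g1.
have h2 := uflow_coord_holder i false z (x.2 - y.2) g1.
have g1' : 0 <= 1 - g by lra.
have c0 : 0 <= 4 * (73 * kp) / (1 - g) := divr_ge0 (mulr_ge0 (ler0n R 4) (mulr_ge0 (ler0n R 73) (ltW kp0))) g1'.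
have m (a : R) : `|a| <= Defs.edist x y -> 4 * (73 * kp) / (1 - g) * `|a| `^ (1 - g) <= 4 * (73 * kp) / (1 - g) * Defs.edist x y `^ (1 - g).
  by move=> ha; rewrite ler_wpM2l//; apply: ge0_ler_powR; rewrite ?nnegrE ?enorm_ge0//; lra.
have m1 := m (x.1 - y.1) (ler_normfst_enorm (x.1 - y.1, x.2 - y.2)).
have m2 := m (x.2 - y.2) (ler_normsnd_enorm (x.1 - y.1, x.2 - y.2)).
have E : sh false (x.2 - y.2) z = x.
  by rewrite /z /sh /=; case: (x) => a b /=; congr pair; ring.
rewrite E in h2; rewrite -/z in h1.
rewrite -[X in `|X|](subrKA (uflow kp dl g i z)); apply: (le_trans (ler_normD _ _)).
apply: (le_trans (lerD (le_trans h2 m2) (le_trans h1 m1))).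
by rewrite (_ : 8 * (73 * kp) = 2 * (4 * (73 * kp))); [lra|ring].
Qed.

(** The Hölder seminorm takes at most [73 / 75] of the allowance; the remaining [2 / 75] exceeds the
    sup norm bound [14 * kp]. *)
Lemma Xnorm_flow_pos : 16 * (75 * kp) <= 1 - g -> g < 1 -> (Xnorm (1 - g) (flow kp dl g) <= 1)%E.
Proof.
move=> kg g1; have al0 : 0 < 1 - g by lra.
have al1 : 1 - g <= 1 by move: (g0); lra.
rewrite /Xnorm al0.
apply: (@le_trans _ _ ((14 * kp)%:E + (16 * (73 * kp) / (1 - g))%:E)%E).
  apply: leeD.
    apply: ge_ereal_sup => _ [x _ <-]; rewrite lee_fin; apply: (le_trans (enorm_flow_le kp0 dl0 g0 g2 x)).
    by rewrite ler_wpM2l//; apply: strain_enorm_le1; lra.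
  apply: ge_ereal_sup => _ [x [y [xy ->]]]; rewrite lee_fin.
  have xy0 : 0 < Defs.edist x y.
    rewrite lt0r enorm_ge0 andbT; apply/eqP => e0; apply: xy.
    have := ler_normfst_enorm (x.1 - y.1, x.2 - y.2); have := ler_normsnd_enorm (x.1 - y.1, x.2 - y.2).
    rewrite -[enorm _]/(Defs.edist x y) e0 /= !normr_le0 !subr_eq0 => /eqP e2 /eqP e1.
    by rewrite [x]surjective_pairing [y]surjective_pairing e1 e2.
  rewrite ler_pdivrMr ?powR_gt0//; apply: (le_trans (ler_enorm_sum _)) => /=.
  have := uflow_holder true x y g1; have := uflow_holder false x y g1; rewrite /uflow.
  rewrite (_ : 16 * (73 * kp) / (1 - g) = 2 * (8 * (73 * kp) / (1 - g))); last by field; rewrite gt_eqF.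
  lra.
have h : 16 * (73 * kp) / (1 - g) <= 73 / 75 by rewrite ler_pdivrMr//; lra.
by rewrite -EFinD lee_fin; move: (g0); lra.
Qed.

Lemma Xnorm_flow_zero : g = 1 -> 14 * kp <= 1 -> (Xnorm 0 (flow kp dl g) <= 1)%E.
Proof.
move=> g1 k1; rewrite /Xnorm ltxx eqxx unlock; case: ifPn => // _.
apply/ess_supP; apply: nearW => x /=.
rewrite lee_fin ger0_norm ?enorm_ge0//; apply: (le_trans (enorm_flow_le kp0 dl0 g0 g2 x)).
apply: le_trans k1; rewrite ler_wpM2l//; apply: strain_enorm_le1; lra.
Qed.

(** With [p = 2 / |al'|], the integrand is at most a multiple of [|x|^(- p (g - 1))] near the
    origin, integrable because [g < 1 - al'] means [p (g - 1) < 2], and of [|x|^(- 4 p)] at infinity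
    because of the cutoff. Neither bound involves [dl]. *)
Lemma Xnorm_flow_neg (al' : R) : al' < 0 -> -1 < al' -> al' < 1 - g -> 1 < g ->
  14 * kp * (inner_const (2 / `|al'| * (g - 1)) + outer_const (8 / `|al'|) + 1) <= 1 ->
  (Xnorm al' (flow kp dl g) <= 1)%E.
Proof.
move=> an an1 alg g1; set K := (X in _ * X <= _) => kK.
have aE : `|al'| = - al' by rewrite ltr0_norm.
have a0 : 0 < - al' by lra.
rewrite /Xnorm ltNge (ltW an) /= (lt_eqF an) unlock; set p := 2 / `|al'|.
have p0 : 0 < p by rewrite divr_gt0// aE.
have p2 : 2 < p by rewrite /p aE ltr_pdivlMr//; lra.
have pg0 : 0 < p * (g - 1) by rewrite mulr_gt0//; lra.
have pg2 : p * (g - 1) < 2 by rewrite /p aE mulrAC ltr_pdivrMr//; lra.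
have p8 : 2 < 4 * p by lra.
have p8E : 8 / `|al'| = 4 * p by rewrite /p; ring.
have mflow : measurable_fun [set: R * R] (fun x => enorm (flow kp dl g x)).
  have m1 := smoothb_measurable (uflow_smooth kp dl0 g0 true); have m2 := smoothb_measurable (uflow_smooth kp dl0 g0 false).
  exact: (measurableT_comp (@measurable_enorm R) (measurable_fun_pair m1 m2)).
pose F x := enorm (flow kp dl g x) `^ p.
have F0 x : 0 <= F x by exact: powR_ge0.
have mF : measurable_fun [set: R * R] F by exact: measurableT_comp (measurable_powR p) mflow.
have ib := inner_const_ge0 pg2; have ob := outer_const_ge0 p8.
have KE : K = inner_const (p * (g - 1)) + outer_const (4 * p) + 1 by rewrite /K p8E.
have kp14 : 0 < 14 * kp by rewrite mulr_gt0.
have k1 : 14 * kp <= 1.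
  by apply: le_trans kK; rewrite ler_peMr ?(ltW kp14)// KE; lra.
(* As [14 * kp <= 1] and [p > 1], this power is at most [14 * kp], so a condition linear in [kp]
   suffices. *)
pose k := (14 * kp) `^ p.
have kk : k <= 14 * kp.
  rewrite -[leRHS](powRr1 (ltW kp14)); apply: ger_powR; last by lra.
  by rewrite kp14.
have near_le x : enorm x <= 1 -> F x <= k * enorm x `^ (- (p * (g - 1))).
  move=> _; have [x0|x0] := ltP 0 (enorm x); last first.
    have e0 : enorm x = 0 by apply/eqP; rewrite eq_le x0 enorm_ge0.
    have f0 : enorm (flow kp dl g x) = 0.
      apply/eqP; rewrite eq_le enorm_ge0 andbT; apply: (le_trans (enorm_flow_le kp0 dl0 g0 g2 x)).
      by rewrite e0 !mulr0.
    by rewrite /F f0 powR0 ?gt_eqF// mulr_ge0 ?powR_ge0.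
  rewrite (_ : - (p * (g - 1)) = (1 - g) * p); last by ring.
  rewrite powRrM -powRM ?powR_ge0 ?(ltW kp14)//; apply: ge0_ler_powR; rewrite ?(ltW p0)// ?nnegrE ?enorm_ge0//.
    by rewrite mulr_ge0 ?powR_ge0 ?(ltW kp14).
  apply: (le_trans (enorm_flow_le kp0 dl0 g0 g2 x)); rewrite -mulrA ler_wpM2l//.
  apply: (le_trans (strain_enorm_pow x0)); rewrite ler_wpM2l ?(ltW kp0)// ler_piMr ?powR_ge0//.
  exact: inv_sqr_le1.
have far_le x : 1 < enorm x -> F x <= k * enorm x `^ (- (4 * p)).
  move=> x1; have x0 : 0 < enorm x by lra.
  rewrite (_ : - (4 * p) = (- 4%:R) * p); last by ring.
  rewrite powRrM -powRM ?powR_ge0 ?(ltW kp14)//; apply: ge0_ler_powR; rewrite ?(ltW p0)// ?nnegrE ?enorm_ge0//.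
    by rewrite mulr_ge0 ?powR_ge0 ?(ltW kp14).
  apply: (le_trans (enorm_flow_le kp0 dl0 g0 g2 x)); rewrite -mulrA ler_wpM2l//.
  apply: (le_trans (strain_enorm_pow x0)); rewrite ler_wpM2l ?(ltW kp0)//.
  rewrite -[leRHS]mul1r; apply: ler_pM; rewrite ?powR_ge0 ?sqr_ge0//.
    apply: (@le_trans _ _ (enorm x `^ 0)); last by rewrite powRr0.
    by apply: ler_powR; lra.
  rewrite powRN powR_mulrn ?enorm_ge0// -exprVn (_ : 4 = 2 * 2)%N// exprM.
  rewrite ler_pXn2r ?nnegrE ?invr_ge0 ?exprn_ge0 ?invr_ge0 ?enorm_ge0//; last by have := nrm2_ge0 x; lra.
  have q0 : 0 < enorm x ^+ 2 by rewrite exprn_gt0.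
  by rewrite exprVn lef_pV2 ?posrE// nrm2_enorm; lra.
have I1 : (\int[@leb2 R]_(x in [set z | (enorm z <= 1)%R]) (F x)%:E <= (k * inner_const (p * (g - 1)))%:E)%E.
  have h := integral_enorm_powR_inner pg0 pg2 ltr01; rewrite powR1 mulr1 in h.
  apply: integral_le_scaled h => //; [exact: measurable_enorm_le|exact: measurable_enorm_powR|..].
  - by move=> x; exact: powR_ge0.
  - exact: powR_ge0.
have I2 : (\int[@leb2 R]_(x in [set z | (1 < enorm z)%R]) (F x)%:E <= (k * outer_const (4 * p))%:E)%E.
  have h := integral_enorm_powR_outer p8 ltr01; rewrite powR1 mulr1 in h.
  apply: integral_le_scaled h => //; [exact: measurable_enorm_gt|exact: measurable_enorm_powR|..].
  - by move=> x; exact: powR_ge0.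
  - exact: powR_ge0.
have IT : (\int[@leb2 R]_x (F x)%:E <= 1)%E.
  rewrite (_ : [set: R * R] = [set z | (enorm z <= 1)%R] `|` [set z | (1 < enorm z)%R]); last first.
    by apply/seteqP; split => z //= _; have [h|h] := leP (enorm z) 1; [left|right].
  rewrite ge0_integral_setU//.
  - apply: (le_trans (leeD I1 I2)); rewrite -EFinD lee_fin -mulrDr.
    apply: le_trans kK; rewrite KE; apply: ler_pM => //; [exact: powR_ge0|lra|lra].
  - exact: measurable_enorm_le.
  - exact: measurable_enorm_gt.
  - exact/measurable_EFinP/measurable_funTS.
  - by move=> x _; rewrite lee_fin.
  - by apply/disj_setPS => z [/=]; rewrite leNgt => /negP.
rewrite (_ : (fun x => _) = (fun x => (F x)%:E)); last first.
  by apply/funext => x; rewrite /= ger0_norm ?enorm_ge0.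
rewrite -(poweR1r (R := R) p^-1); apply: gt0_ler_poweR => //.
- by rewrite invr_ge0 ltW.
- by rewrite in_itv /= leey andbT; apply: integral_ge0 => x _; rewrite lee_fin.
- by rewrite in_itv /= lee_fin ler01 leey.
Qed.

End Norms.

Lemma drift_exponents (s al' : R) : 0 < s -> s < 1 -> -1 < al' -> al' < 1 - 2 * s ->
  exists g kp : R, [/\ 2 * s < g, g < 2, 0 < kp &
    forall dl, 0 < dl -> dl <= 1 -> (Xnorm al' (flow kp dl g) <= 1)%E].
Proof.
move=> s0 s1 a1 a2; have [ap|an|al0] := ltgtP al' 0; last rewrite al0 in a2 *.
(* Thus [1 - g] is the midpoint of [al'] and [min 0 (1 - 2 s)]: above [al'] for integrability, below
   0 so that [g > 1], and below [1 - 2 s] so that [2 s < g]. *)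
- pose g := 1 - al' / 2 - Num.min 0 (1 - 2 * s) / 2.
  have m0 : Num.min 0 (1 - 2 * s) <= 0 by rewrite ge_min lexx.
  have m1 : Num.min 0 (1 - 2 * s) <= 1 - 2 * s by rewrite ge_min lexx orbT.
  have m2 : al' < Num.min 0 (1 - 2 * s) by rewrite lt_min ap.
  have aE : `|al'| = - al' by rewrite ltr0_norm.
  have p1 : 2 / `|al'| * (g - 1) < 2.
    by rewrite aE mulrAC ltr_pdivrMr ?oppr_gt0// /g; lra.
  have p2 : 2 < 8 / `|al'| by rewrite aE ltr_pdivlMr ?oppr_gt0//; lra.
  pose K := inner_const (2 / `|al'| * (g - 1)) + outer_const (8 / `|al'|) + 1.
  have K0 : 0 < K by rewrite ltr_wpDl// addr_ge0 ?inner_const_ge0 ?outer_const_ge0.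
  exists g, (14 * K)^-1; split; [rewrite /g; lra|rewrite /g; lra|by rewrite invr_gt0 mulr_gt0|].
  move=> dl dl0 dl1; apply: Xnorm_flow_neg => //; rewrite -/K; try (rewrite /g; lra).
    by rewrite invr_gt0 mulr_gt0.
  by rewrite mulrAC divff// gt_eqF// mulr_gt0.
- have [kp kp0 kpE] : exists2 kp : R, 0 < kp & 16 * (75 * kp) <= al'.
    exists (al' / 16 / 75); first by rewrite !divr_gt0.
    by rewrite le_eqVlt; apply/orP; left; apply/eqP; field.
  have [g1 g2 g3] : [/\ 0 < 1 - al', 1 - al' < 2 & 1 - al' < 1] by split; lra.
  exists (1 - al'), kp; split=> //; [lra|move=> dl dl0 dl1].
  have := @Xnorm_flow_pos kp dl (1 - al') kp0 dl0 dl1 g1 g2.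
  by rewrite subKr; apply.
- exists 1, 14^-1; split; [lra|lra|by rewrite invr_gt0|].
  by move=> dl dl0 dl1; apply: Xnorm_flow_zero => //; lra.
Qed.

End FlowNorm.

(** * Reflected solutions *)

Section Reflection.
Context {R : realType}.
Implicit Types (x y : R * R) (h : R * R -> R) (th : R -> R * R -> R).

Local Notation mu2 := (@leb2 R).

Lemma edist_opp x y : Defs.edist (opp2 x) (opp2 y) = Defs.edist x y.
Proof. by rewrite /Defs.edist /enorm /=; congr Num.sqrt; ring. Qed.

Lemma pv_reflect_integrand s h x y :
  (- h (opp2 x) - - h (opp2 y)) / Defs.edist x y `^ (2 + 2 * s) =
  - ((h (opp2 x) - h (opp2 y)) / Defs.edist (opp2 x) (opp2 y) `^ (2 + 2 * s)).
Proof. by rewrite edist_opp -mulNr; congr (_ / _); ring. Qed.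

Lemma preimage_opp_edist x eps :
  @opp2 R @^-1` [set y | eps < Defs.edist (opp2 x) y] = [set y | eps < Defs.edist x y].
Proof. by apply/seteqP; split => y /=; rewrite edist_opp. Qed.

Lemma integrable_pv_reflect s h x eps :
  mu2.-integrable [set y | eps < Defs.edist (opp2 x) y]
    (fun y => ((h (opp2 x) - h y) / Defs.edist (opp2 x) y `^ (2 + 2 * s))%:E) ->
  mu2.-integrable [set y | eps < Defs.edist x y]
    (fun y => ((- h (opp2 x) - - h (opp2 y)) / Defs.edist x y `^ (2 + 2 * s))%:E).
Proof.
move=> ih; have := integrable_preimage_opp (measurable_edist_gt (opp2 x) eps) ih.
rewrite preimage_opp_edist => /(integrable_leb2Z (-1) (measurable_edist_gt x eps)).
congr integrable; apply/funext => y /=; rewrite pv_reflect_integrand mulN1r//.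
Qed.

Lemma pv_trunc_reflect s h x eps :
  mu2.-integrable [set y | eps < Defs.edist (opp2 x) y]
    (fun y => ((h (opp2 x) - h y) / Defs.edist (opp2 x) y `^ (2 + 2 * s))%:E) ->
  pv_trunc s (fun y => - h (opp2 y)) x eps = - pv_trunc s h (opp2 x) eps.
Proof.
move=> ih; rewrite /pv_trunc -(Rintegral_preimage_opp (measurable_edist_gt (opp2 x) eps) ih) preimage_opp_edist.
have := integrable_preimage_opp (measurable_edist_gt (opp2 x) eps) ih; rewrite preimage_opp_edist => ih'.
rewrite -[RHS]mulN1r -RintegralZl//; last exact: measurable_edist_gt.
by apply: eq_Rintegral => y _; rewrite pv_reflect_integrand mulN1r.
Qed.

Lemma fraclap_reflect s h x : fraclap_defined s h (opp2 x) ->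
  fraclap_defined s (fun y => - h (opp2 y)) x /\
  fraclap s (fun y => - h (opp2 y)) x = - fraclap s h (opp2 x).
Proof.
move=> [ih ch].
have cv : pv_trunc s (fun y => - h (opp2 y)) x @ 0^'+ --> - lim (pv_trunc s h (opp2 x) @ 0^'+).
  have cN : (fun e => - pv_trunc s h (opp2 x) e) @ 0^'+ --> - lim (pv_trunc s h (opp2 x) @ 0^'+) by exact: cvgN.
  apply: cvg_trans cN; apply: near_eq_cvg; near=> e.
  by rewrite pv_trunc_reflect//; apply: ih.
split; first by split=> [eps e0|]; [exact: integrable_pv_reflect (ih eps e0)|apply/cvg_ex; eexists; exact: cv].
rewrite /fraclap -mulrN; congr (_ * _); exact: cvg_lim cv.
Unshelve. all: by end_near. Qed.

Definition refl3 (v : 'rV[R]_3) : 'rV[R]_3 := \row_j (if j == 0 then v 0 0 else - v 0 j).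

Lemma refl3_shift (v : 'rV[R]_3) (i : 'I_3) (a : R) :
  refl3 (v + a *: delta_mx 0 i) = refl3 v + ((if i == 0 then 1 else -1) * a) *: delta_mx 0 i.
Proof.
apply/rowP => j; rewrite !mxE /= (eq_sym 0 i).
have [->|j0] := eqVneq j 0; first by rewrite (eq_sym 0 i); case: (i == 0); rewrite /=; ring.
have [ji|ji] := eqVneq j i; first by rewrite -ji (negbTE j0) /=; ring.
by rewrite /=; ring.
Qed.

Lemma refl3_continuous : continuous refl3.
Proof.
move=> v N /nbhs_ballP[e /= e0 eN].
have /filterS nb := nbhsx_ballx v _ e0; apply: nb => w [_ vw]; apply: eN; split=> // i j.
rewrite !mxE; have := vw 0 j; have := vw 0 0; rewrite /ball /=.
by case: eqP => // _ _; rewrite -opprD normrN.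
Qed.

(** The multiples of the [pdw w F] composed with the reflection form a class closed under partial
    derivatives, each space derivative only flipping a sign. *)
Lemma smooth_on_reflect (F : 'rV[R]_3 -> R) :
  smooth_on [set v | 0 < v 0 0] F -> smooth_on [set v : 'rV[R]_3 | 0 < v 0 0] (fun v => - F (refl3 v)).
Proof.
move=> sF.
pose K (f : 'rV[R]_3 -> R) := exists w, exists c : R, f = (fun v => c * pdw w F (refl3 v)).
have r0 (v : 'rV[R]_3) : refl3 v 0 0 = v 0 0 by rewrite mxE eqxx.
apply: (@smooth_on_class R 3 _ K).
- exact: (@open_comp _ _ (fun v : 'rV[R]_3 => v 0 0) [set t : R | 0 < t] (fun v _ => @coord_continuous _ _ _ _ _ v) (@open_gt R 0)).
- by exists [::], (-1); apply/funext => v; rewrite mulN1r.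
- move=> _ [w [c ->]] v v0.
  have [|cw _] := sF w (refl3 v) _; first by rewrite /= r0.
  have cc : {for v, continuous (fun v => pdw w F (refl3 v))} by apply: (@continuous_comp _ _ _ refl3 (pdw w F) v) cw; exact: refl3_continuous.
  by apply: (@continuousM _ _ (fun=> c)) cc; exact: cst_continuous.
- move=> _ i [w [c ->]]; exists (fun v => (c * (if i == 0 then 1 else -1)) * pdw (i :: w) F (refl3 v)).
    by exists (i :: w), (c * (if i == 0 then 1 else -1)).
  move=> v v0.
  have [|_ /(_ i)/derivable_derive1P d] := sF w (refl3 v) _; first by rewrite /= r0.
  under eq_fun do rewrite refl3_shift.
  set k : R := if i == 0 then 1 else -1.
  have dk : is_derive (0 : R) (1 : R) (fun a : R => k * a) k.
    by apply: der_eq (derM (derC 0 k) (derI 0)) _; ring.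
  have d' : is_derive (k * 0) (1 : R) (fun a : R => pdw w F (refl3 v + a *: delta_mx 0 i)) (pdw (i :: w) F (refl3 v)).
    by rewrite mulr0.
  apply: der_eq (derM (derC 0 c) (der_comp dk d')) _; ring.
Qed.

(** For an odd velocity the transport term and the fractional Laplacian are both compatible with the
    point reflection. Producing a second solution replaces the oddness of [th], which would call for
    uniqueness. *)
Lemma solution_reflect s u f th : (forall x, u (opp2 x) = opp2 (u x)) -> (forall x, f (opp2 x) = - f x) ->
  is_solution s u f th -> is_solution s u f (fun t x => - th t (opp2 x)).
Proof.
move=> uo fo sol; have D t x t0 := @solution_is_derive R s u f th t x sol t0.
have [sm [ct [ini [[M bd] pde]]]] := sol.
split.
  have := smooth_on_reflect sm; congr (smooth_on _ _).
  by apply/funext => v; rewrite !mxE eqxx inord1_neq0 inord2_neq0.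
split.
  apply/subspace_continuousP => -[t x] /= t0; apply: cvgN.
  apply: (@within_cvg_comp _ _ _ _ [set tx : R * (R * R) | 0 <= tx.1]
    (fun tx : R * (R * R) => (tx.1, opp2 tx.2)) (fun tx => th tx.1 tx.2)) => //.
    move=> N /nbhs_ballP[e /= e0 eN].
    have /filterS nb := nbhsx_ballx ((t, x) : R * (R * R)) _ e0; apply: nb => -[t' x'] [/= b1 [b2 b3]].
    by apply: eN; split=> //; split; rewrite /ball /= -opprD normrN.
  by have /subspace_continuousP := ct; apply.
split; first by move=> x; rewrite ini fo opprK.
split; first by exists M => t x t0; rewrite normrN; exact: bd.
move=> t x t0; have [fd eq] := pde t (opp2 x) t0; have [fd' fE] := fraclap_reflect fd.
split; first exact: fd'.
have [dt0 d10 d20] := D t (opp2 x) t0.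
have E0 : dt (fun t x => - th t (opp2 x)) t x = - dt th t (opp2 x) by exact: is_derive_derive1 (derN dt0).
have E1 : d1 (fun y => - th t (opp2 y)) x = d1 (th t) (opp2 x).
  by apply: is_derive_derive1; have := derN (is_derive_reflect d10); rewrite /= !opprK.
have E2 : d2 (fun y => - th t (opp2 y)) x = d2 (th t) (opp2 x).
  by apply: is_derive_derive1; have := derN (is_derive_reflect d20); rewrite /= !opprK.
rewrite E0 E1 E2 fE; rewrite uo /= in eq.
rewrite -[RHS]oppr0 -eq; ring.
Qed.

End Reflection.

(** * Breaking the modulus *)

Section Breaking.
Context {R : realType}.
Implicit Types (rho : R -> R).

Lemma modulus_small rho (e : R) : modulus rho -> 0 < e -> exists2 d, 0 < d & rho d < e.
Proof.
move=> [/subspace_continuousP ct [_ r0]] e0.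
have /ct : `[0, +oo[%classic (0 : R) by rewrite /= in_itv /= lexx.
move=> /cvgrPdist_lt/(_ e e0); rewrite near_withinE => -[d /= d0 hd].
exists (d / 2); first by rewrite divr_gt0.
have d2 : 0 < d / 2 by rewrite divr_gt0.
have := hd (d / 2); rewrite /= sub0r normrN (gtr0_norm d2) in_itv /= andbT => h.
have {}h : `|rho 0 - rho (d / 2)| < e by apply: h; lra.
rewrite r0 sub0r normrN in h.
exact: le_lt_trans (ler_norm _) h.
Qed.

Lemma small_length (g nu A : R) : g < 2 -> 0 < nu ->
  exists X0 : R, [/\ 0 < X0, X0 <= 1, 64 * X0 ^+ 2 <= 2 - g & 8 * (A * X0 `^ nu) <= nu].
Proof.
move=> g2 nu0.
have A0 : 0 < `|A| + 1 by rewrite ltr_wpDl.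
have [d d0 hd] := @powR_cvg0_nbhs R nu (nu / 8 / (`|A| + 1)) nu0 ltac:(by rewrite !divr_gt0).
pose X0 := Num.min 1 (Num.min d ((2 - g) / 64)).
have X00 : 0 < X0 by rewrite !lt_min ltr01 d0 divr_gt0// subr_gt0.
have X01 : X0 <= 1 by rewrite ge_min lexx.
have X0d : X0 <= d by rewrite !ge_min lexx orbT.
have X0g : X0 <= (2 - g) / 64 by rewrite !ge_min lexx !orbT.
exists X0; split=> //.
  have : X0 ^+ 2 <= X0 by rewrite expr2 ler_piMr// ltW.
  by move: X0g; rewrite ler_pdivlMr//; lra.
have h1 : A * X0 `^ nu <= (`|A| + 1) * X0 `^ nu.
  by rewrite ler_wpM2r ?powR_ge0//; have := ler_norm A; lra.
have h2 : (`|A| + 1) * X0 `^ nu <= nu / 8 by rewrite mulrC -ler_pdivlMr//; exact: hd.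
by lra.
Qed.

(** At one and the same time [focusing] bounds [th] below by [5 / 16 * a] at [(dl, 0)] and, applied
    to the reflected solution, above by [- (5 / 16 * a)] at the opposite point. *)
Lemma flow_breaks (s kp g X0 a dl : R) rho th : 0 < s -> s < 1 -> 2 * s < g -> g < 2 -> 0 < kp ->
  0 < dl -> dl <= X0 -> X0 <= 1 -> 64 * X0 ^+ 2 <= 2 - g -> 0 < a ->
  8 * (loss_rate s g kp * X0 `^ (g - 2 * s)) <= g - 2 * s ->
  rho (2 * dl) < 5 / 8 * a ->
  is_solution s (flow kp dl g) (ramp a (X0 / 2)) th ->
  exists t, 0 <= t <= 8 / (kp * g) * X0 `^ g /\ breaks th rho t.
Proof.
move=> s0 s1 gs g2 kp0 dl0 dX X01 X0g a0 loss small sol.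
have [t [tT H]] := focusing s0 s1 gs g2 kp0 dl0 dX X01 X0g a0 loss.
exists t; split=> //; exists (dl, 0), (opp2 (dl, 0)).
have h1 := H th sol.
have /H h2 := solution_reflect (@flow_opp R kp dl g) (@ramp_opp R a (X0 / 2)) sol.
have -> : Defs.edist (dl, 0) (opp2 (dl, 0)) = 2 * dl.
  rewrite /Defs.edist /enorm /= !opprK addr0 expr0n /= addr0 sqrtr_sqr ger0_norm; first by ring.
  by rewrite addr_ge0// ltW.
apply: (lt_le_trans small); apply: le_trans (ler_norm _); lra.
Qed.

End Breaking.
Unset Implicit Arguments.

Theorem theorem3p1 (R : realType) (s alpha' : R) :
  0 < s < 1 -> -1 < alpha' < 1 - 2 * s ->
  exists Tstar : R, 0 < Tstar /\
  forall rho : R -> R, modulus rho ->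
  exists (u : R * R -> R * R) (th0 : R * R -> R),
    smooth_field u /\ div_free u /\ (Xnorm alpha' u <= 1)%E /\
    smooth2 th0 /\ (C2norm th0 <= 1)%E /\
    (exists th : R -> R * R -> R, is_solution s u th0 th) /\
    (forall th : R -> R * R -> R, is_solution s u th0 th ->
       exists t : R, 0 <= t <= Tstar /\ breaks th rho t).
Proof.
move=> /andP[s0 s1] /andP[a1 a2].
have [g [kp [gs g2 kp0 norm1]]] := drift_exponents s0 s1 a1 a2.
have g0 : 0 < g by lra.
have nu0 : 0 < g - 2 * s by lra.
have [X0 [X00 X01 X0g loss]] := @small_length R g (g - 2 * s) (loss_rate s g kp) g2 nu0.
have mu0 : 0 < X0 / 2 by lra.
have [a a0 aC] := small_ramp mu0.
(* At this stage [g], [kp], [X0] and [a] have been fixed from [s] and [alpha'] alone. *)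
exists (8 / (kp * g) * X0 `^ g); split.
  by rewrite mulr_gt0 ?powR_gt0// divr_gt0// mulr_gt0.
move=> rho mrho; have ea : 0 < 5 / 8 * a by rewrite mulr_gt0// divr_gt0.
have [d d0 rd] := modulus_small mrho ea.
(* Only the regularisation scale depends on [rho]; the half accounts for the distance [2 * dl]
   between the two points. *)
pose dl := Num.min X0 (d / 2).
have dl0 : 0 < dl by rewrite lt_min X00 divr_gt0.
have dX : dl <= X0 by rewrite ge_min lexx.
have dd : 2 * dl <= d.
  have : dl <= d / 2 by rewrite ge_min lexx orbT.
  lra.
have rdl : rho (2 * dl) < 5 / 8 * a.
  have [_ [mono _]] := mrho; apply: le_lt_trans rd; apply: mono => //.
  by rewrite mulr_ge0// ltW.
exists (flow kp dl g), (ramp a (X0 / 2)).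
have su := uflow_smooth kp dl0 g0; have sr := smoothb_ramp a mu0.
split; first exact: smooth_flow.
split; first exact: flow_div_free.
split; first exact: norm1 dl0 (le_trans dX X01).
split; first exact: smoothb_smooth2 sr.
split; first exact: aC.
split; first exact: solution_exists s0 s1 (su true) (su false) sr.
move=> th sol; exact: flow_breaks s0 s1 gs g2 kp0 dl0 dX X01 X0g a0 loss rdl sol.
Qed.
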